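(* Let $d\ge1$ and let $\mu$ be a stationary point process on $\mathbb{R}^d$ with unit intensity, with reduced pair correlation measure $\beta$ (not assumed integrable). For $n\ge2$ let $\Lambda_n=(-\pi n^{1/d},\pi n^{1/d}]^d$, $N=\mu(\Lambda_n)$, let $\tilde\mu_n=\frac{n}{N}\mu\mathbf{1}_{\Lambda_n}$ (and $\tilde\mu_n=n\delta_0$ when $N=0$), let $\tilde{\mathcal L}_n=\frac{1}{(2\pi)^d}\mathrm{Leb}\,\mathbf{1}_{\Lambda_n}$, and let $$b_n=1+|\beta|(\Lambda_n+\Lambda_n)=1+\int_{\Lambda_{2^dn}}|\beta|(dx).$$ Then there is a finite constant $c$, independent of $n$, such that for all $n\ge2$ $$\mathbf{E}\,\widetilde{\mathsf W}_2^2(\tilde\mu_n,\tilde{\mathcal L}_n;\Lambda_n)\le c\,\alpha_2(n),$$ and for every $p\in(0,1]$ there is a finite constant $c$, independent of $n$, such that for all $n\ge2$ $$\sqrt{\mathbf{E}\,\widetilde{\mathsf W}_p^{2p}(\tilde\mu_n,\tilde{\mathcal L}_n;\Lambda_n)}\le c\,\alpha_p(n),$$ where $$\alpha_2(n)=b_n\times\begin{cases}n^2 & d=1\\ n\ln n & d=2\\ n & d\ge3\end{cases}$$ and, for $p\in(0,1]$, $$\alpha_p(n)=\begin{cases}\sqrt{b_n}\;n\;n^{p-1/2} & d=1,\ p\in(1/2,1]\\ \sqrt{b_n}\;n\,\ln n & d=1,\ p=1/2\\ \sqrt{b_n}\;n\,\sqrt{\ln n} & d=1,\ p\in(0,1/2)\\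 \sqrt{b_n^{\,p}}\;n\,\sqrt{(\ln n)^p} & d=2\\ \sqrt{b_n^{\,p}}\;n & d\ge3.\end{cases}$$
   Context: A point process is a random locally finite counting measure on $\mathbb{R}^d$; it is stationary if its law is translation invariant and has unit intensity if $\mathbf{E}\mu(\cdot)=\mathrm{Leb}$. Reduced pair correlation measure (RPCM). It is implicitly assumed that $\mu(A)$ has finite second moment for every bounded Borel $A$ whenever the RPCM is mentioned. The RPCM $\beta$ of $\mu$ is the signed measure (defined on bounded sets) characterized by $$\mathbf{E}\int\!\!\int\mathbf{1}[x\ne y]\varphi(x)\psi(y)\,\mu(dx)\mu(dy)=\int\!\!\int\varphi(x)\psi(y)\,dx\,dy+\int\!\!\int\varphi(z)\psi(x+z)\,dz\,\beta(dx)$$ for non-negative continuous compactly supported $\varphi,\psi$; $|\beta|$ is its total variation measure, which is locally finite. Toric transport costs. For two measures $\mu,\nu$ on $\Lambda=\Lambda_n$ with the same finite mass, and a non-decreasing $w:\mathbb{R}_+\to\mathbb{R}_+$, $$\widetilde{\mathsf C}_w(\mu,\nu;\Lambda)=\inf_M\int_{\Lambda^2}w(d_\Lambda(x,y))\,M(dx,dy),$$ the infimum being over measures $M$ on $\Lambda\times\Lambda$ with marginals $\mu$ and $\nu$, where $d_\Lambda(x,y)=\min_{z\in\mathbb{Z}^d}\|x-y+2\pi n^{1/d}z\|$ is the toric distance on $\Lambda_n$. For $p>0$ and $w_p(t)=t^p$, $\widetilde{\mathsf W}_p^p=\widetilde{\mathsf C}_{w_p}$, so that $\widetilde{\mathsf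 W}_p^{2p}=(\widetilde{\mathsf C}_{w_p})^2$. The constants $c$ may depend on $d$, on $p$ and on the law of $\mu$, but not on $n$. *)

(* Defs.v *)
From HB Require Import structures.
From mathcomp Require Import all_boot all_order all_algebra.
From mathcomp Require Import all_classical all_reals all_analysis.
From mathcomp Require Import measurable_realfun.
Set Implicit Arguments.
Unset Strict Implicit.
Unset Printing Implicit Defensive.
Import Order.TTheory GRing.Theory Num.Theory.
Import numFieldNormedType.Exports.
Local Open Scope classical_set_scope.
Local Open Scope ring_scope.

(* R^d is 'rV[R]_d. Its measurable sets are generated by the coordinate
   functions, as the library does for tuples; measurable_rVE shows that this is
   the Borel sigma-algebra. *)
Section measurable_rV.
Context {R : realType} {d : nat}.

Definition rV_coord (i : 'I_d) (x : 'rV[R]_d) : R := x ord0 i.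

Let rV_set0 : g_sigma_preimage rV_coord set0.
Proof. exact: sigma_algebra0. Qed.

Let rV_setC A : g_sigma_preimage rV_coord A -> g_sigma_preimage rV_coord (~` A).
Proof. exact: sigma_algebraC. Qed.

Let rV_bigcup (F : (set 'rV[R]_d)^nat) :
  (forall i, g_sigma_preimage rV_coord (F i)) ->
  g_sigma_preimage rV_coord (\bigcup_i F i).
Proof. exact: sigma_algebra_bigcup. Qed.

HB.instance Definition _ := @isMeasurable.Build
  default_measure_display 'rV[R]_d
  (g_sigma_preimage rV_coord) rV_set0 rV_setC rV_bigcup.

Lemma measurable_rV_coord i : measurable_fun setT (rV_coord i).
Proof.
move=> _ A mA; rewrite setTI; apply: sub_sigma_algebra.
rewrite (bigD1 i)//=; left; exists A => //; by rewrite setTI.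
Qed.

Lemma measurable_fun_rV d0 (T : measurableType d0) (f : T -> 'rV[R]_d) :
  (forall i, measurable_fun setT (rV_coord i \o f)) -> measurable_fun setT f.
Proof.
move=> mf; apply: (@measurability _ _ _ _ setT f
  (\big[setU/set0]_(i < d) preimage_set_system setT (rV_coord i) measurable)) => //.
move=> _ [B + <-].
elim/big_ind : _ => //=.
- by move=> U V HU HV [/HU|/HV].
- by move=> i _ [C mC <-]; rewrite setTI; exact: mf.
Qed.

Lemma measurable_rV_ball (x : 'rV[R]_d) (e : R) : 0 < e -> measurable (ball x e).
Proof.
move=> e0.
have -> : ball x e =
    \bigcap_(i in [set: 'I_d]) (rV_coord i @^-1` ball (x ord0 i) e).
  apply/seteqP; split => [y [_ xy] i _|y xy]; first exact: xy.
  by split => // i j; rewrite (ord1 i); exact: xy.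
apply: fin_bigcap_measurable; first exact: finite_finset.
move=> i _; rewrite -[X in measurable X]setTI.
by apply: measurable_rV_coord => //; apply: open_measurable; apply: ball_open.
Qed.

Lemma measurable_rV_open (U : set 'rV[R]_d) : open U -> measurable U.
Proof.
move=> oU; pose q (v : 'rV[rat]_d) : 'rV[R]_d := map_mx ratr v.
pose B (p : 'rV[rat]_d * nat) := ball (q p.1) (p.2.+1%:R^-1 : R).
have -> : U = \bigcup_p (if `[< B p `<=` U >] then B p else set0).
  apply/seteqP; split => [x Ux|x [p _]]; last first.
    by case: ifPn => // /asboolP; apply.
  have /nbhs_ballP[e /= e0 xeU] := open_nbhs_nbhs (conj oU Ux).
  have [k] : exists k : nat, 0 + k.+1%:R^-1 < e / 2.
    by apply: ltr_add_invr; rewrite divr_gt0.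
  rewrite add0r => ke.
  have k0 : 0 < k.+1%:R^-1 :> R by rewrite invr_gt0.
  have /choice[f fP] : forall i : 'I_d, exists r : rat,
      ball (x ord0 i) (k.+1%:R^-1 : R) (ratr r).
    move=> i; have [r] : exists r : rat,
        ratr r \in `](x ord0 i - k.+1%:R^-1), (x ord0 i + k.+1%:R^-1)[.
      by apply: rat_in_itvoo; rewrite ltrD2l gtrN.
    by rewrite in_itv/= => rI; exists r; rewrite /ball/= distrC ltr_distl.
  exists (\row_i f i, k) => //.
  have xq : ball x (k.+1%:R^-1 : R) (q (\row_i f i)).
    by split => // i j; rewrite (ord1 i) !mxE; exact: fP.
  have -> : `[< B (\row_i f i, k) `<=` U >].
    apply/asboolP => y By; apply: xeU; apply: (@le_ball _ _ _ (k.+1%:R^-1 + k.+1%:R^-1)).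
      by rewrite (splitr e) lerD// ltW.
    exact: ball_triangle xq By.
  exact: ball_sym.
apply: countable_bigcupT_measurable => // p.
by case: ifP => // _; apply: measurable_rV_ball; rewrite invr_gt0.
Qed.

Lemma measurable_rVE : measurable = <<s [set U : set 'rV[R]_d | open U] >>.
Proof.
apply/seteqP; split; last first.
  apply: smallest_sub; first exact: sigma_algebra_measurable.
  exact: measurable_rV_open.
apply: smallest_sub; first exact: smallest_sigma_algebra.
elim/big_ind : _ => //=.
- by move=> U V HU HV; rewrite subUset.
- move=> i _ _ [C mC <-]; rewrite setTI.
  pose b : set (set R) :=
    [set C | <<s [set U : set 'rV[R]_d | open U] >> (rV_coord i @^-1` C)].
  move: C mC; rewrite [measurable](RGenOInfty.measurableE R).
  apply: (@smallest_sub _ _ _ b).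
    split => [|A bA|F bF]; rewrite /b/=.
    - by rewrite preimage_set0; exact: sigma_algebra0.
    - by rewrite setTD preimage_setC; exact: sigma_algebraC.
    - by rewrite preimage_bigcup; exact: sigma_algebra_bigcup.
  move=> _ [x ->]; apply: sub_sigma_algebra.
  apply: (@open_comp _ _ (rV_coord i)) => [y _|]; last exact: interval_open.
  exact: coord_continuous.
Qed.

End measurable_rV.

Section Lebesgue.
Context {R : realType}.

(* 'rV_(1 + d) is convertible to 'rV_d.+1. *)
Definition rV_cons d (p : measurableTypeR R * 'rV[R]_d) : 'rV[R]_(1 + d) :=
  row_mx (p.1%:M) p.2.

Lemma rV_cons0 d p : @rV_cons d p ord0 ord0 = p.1.
Proof. by rewrite mxE; case: split_ordP => // j _; rewrite (ord1 j) mxE. Qed.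

Lemma rV_consS d p (i : 'I_d) : @rV_cons d p ord0 (lift ord0 i) = p.2 ord0 i.
Proof.
rewrite (_ : lift ord0 i = rshift 1 i); last exact: val_inj.
by rewrite /rV_cons row_mxEr.
Qed.

(* Lebesgue measure on R^d, as an iterated product measure. *)
Fixpoint leb (d : nat) : set 'rV[R]_d -> \bar R :=
  match d with
  | 0 => \d_(0 : 'rV[R]_0)
  | d'.+1 => pushforward (lebesgue_measure \x @leb d')%E (@rV_cons d')
  end.

Lemma measurable_rV_cons d : measurable_fun setT (@rV_cons d).
Proof.
apply: measurable_fun_rV => i; case: (split_ordP i) => j ->.
  rewrite (_ : _ \o _ = fst); first exact: measurable_fst.
  by apply/funext => -[x v]; rewrite /= /rV_coord row_mxEl (ord1 j) mxE eqxx mulr1n.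
rewrite (_ : _ \o _ = rV_coord j \o snd).
  exact: measurableT_comp (measurable_rV_coord j) measurable_snd.
by apply/funext => -[x v]; rewrite /= /rV_coord row_mxEr.
Qed.

HB.instance Definition _ d :=
  isMeasurableFun.Build _ _ _ _ (@rV_cons d) (@measurable_rV_cons d).

Let step d (m : {sigma_finite_measure set 'rV[R]_d -> \bar R}) :=
  pushforward (lebesgue_measure \x m)%E (@rV_cons d).

Section step.
Context (d : nat) (m : {sigma_finite_measure set 'rV[R]_d -> \bar R}).

Let step0 : step m set0 = 0%E. Proof. exact: measure0. Qed.
Let step_ge0 A : (0 <= step m A)%E. Proof. exact: measure_ge0. Qed.
Let step_sigma_additive : semi_sigma_additive (step m).
Proof. exact: measure_semi_sigma_additive. Qed.

HB.instance Definition _ :=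
  isMeasure.Build _ _ _ (step m) step0 step_ge0 step_sigma_additive.

Let step_sigma_finite : sigma_finite setT (step m).
Proof.
have /sigma_finiteP[F [FT ndF Foo]] :=
  sigma_finiteT (lebesgue_measure : {sigma_finite_measure set _ -> \bar R}).
have /sigma_finiteP[G [GT ndG Goo]] := sigma_finiteT m.
pose f (x : 'rV[R]_(1 + d)) : measurableTypeR R * 'rV[R]_d :=
  (x ord0 ord0, rsubmx x).
have mf : measurable_fun setT f.
  apply: measurable_fun_pair; first exact: measurable_rV_coord.
  apply: measurable_fun_rV => i.
  rewrite (_ : _ \o _ = rV_coord (rshift 1 i)); first exact: measurable_rV_coord.
  by apply/funext => x; rewrite /= /rV_coord mxE.
have fK p : f (rV_cons p) = p.
  by case: p => x v; rewrite /f rV_cons0 /rV_cons row_mxKr.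
exists (fun i => f @^-1` (F i `*` G i)).
  rewrite -preimage_bigcup (_ : \bigcup_i _ = setT) ?preimage_setT//.
  apply/seteqP; split => // -[x v] _.
  have [i _ Fix] : (\bigcup_i F i) x by rewrite -FT.
  have [j _ Gjv] : (\bigcup_i G i) v by rewrite -GT.
  exists (maxn i j) => //; split => /=.
    by move: x Fix; exact/subsetPset/ndF/leq_maxl.
  by move: v Gjv; exact/subsetPset/ndG/leq_maxr.
move=> i; have [mFi Fioo] := Foo i; have [mGi Gioo] := Goo i; split.
  by rewrite -[X in measurable X]setTI; apply: mf => //; exact: measurableX.
rewrite /step /pushforward (_ : _ @^-1` _ = F i `*` G i); last first.
  by rewrite -comp_preimage (_ : f \o @rV_cons d = id)//; apply/funext => p; exact: fK.
by rewrite product_measure1E// lte_mul_pinfty// ge0_fin_numE.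
Qed.

HB.instance Definition _ :=
  Measure_isSigmaFinite.Build _ _ _ (step m) step_sigma_finite.

End step.

Let leb_ex d : exists m : {sigma_finite_measure set 'rV[R]_d -> \bar R},
  @leb d = m.
Proof.
elim: d => [|d [m lebE]].
  by exists [the {sigma_finite_measure set _ -> \bar R} of \d_(0 : 'rV[R]_0)].
by exists [the {sigma_finite_measure set _ -> \bar R} of step m]; rewrite /= lebE.
Qed.

Section instances.
Context (d : nat).
Let leb0 : @leb d set0 = 0%E.
Proof. by have [m ->] := leb_ex d; exact: measure0. Qed.
Let leb_ge0 A : (0 <= @leb d A)%E.
Proof. by have [m ->] := leb_ex d; exact: measure_ge0. Qed.
Let leb_sigma_additive : semi_sigma_additive (@leb d).
Proof. by have [m ->] := leb_ex d; exact: measure_semi_sigma_additive. Qed.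

HB.instance Definition _ :=
  isMeasure.Build _ _ _ (@leb d) leb0 leb_ge0 leb_sigma_additive.

Let leb_sigma_finite : sigma_finite setT (@leb d).
Proof. by have [m ->] := leb_ex d; exact: sigma_finiteT. Qed.

HB.instance Definition _ :=
  Measure_isSigmaFinite.Build _ _ _ (@leb d) leb_sigma_finite.
End instances.

Lemma leb_box d (a b : 'I_d -> R) : (forall i, a i <= b i) ->
  leb [set x : 'rV[R]_d | forall i, a i < x ord0 i <= b i] =
  (\prod_(i < d) (b i - a i))%:E.
Proof.
elim: d a b => [|d IH] a b ab.
  rewrite big_ord0 /= diracE mem_set//; by case.
rewrite /= /pushforward.
pose B := [set x : 'rV[R]_d |
  forall i, a (lift ord0 i) < x ord0 i <= b (lift ord0 i)].
have mB : measurable B.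
  have -> : B = \bigcap_(i in [set: 'I_d])
      (rV_coord i @^-1` `]a (lift ord0 i), b (lift ord0 i)]).
    apply/seteqP; split => [x Bx i _ /=|x Bx i]; first by rewrite in_itv; exact: Bx.
    by have /= := Bx i I; rewrite in_itv.
  apply: fin_bigcap_measurable; first exact: finite_finset.
  move=> i _; rewrite -[X in measurable X]setTI.
  by apply: measurable_rV_coord => //; exact: measurable_itv.
rewrite (_ : _ @^-1` _ = `]a ord0, b ord0]%classic `*` B); last first.
  apply/seteqP; split => -[x v] /=.
    move=> H; split => [|i].
      by have := H ord0; rewrite rV_cons0 in_itv.
    by have := H (lift ord0 i); rewrite rV_consS.
  rewrite in_itv/= => -[xab Bv] i; case: (unliftP ord0 i) => [j|] ->.
    by rewrite rV_consS; exact: Bv.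
  by rewrite rV_cons0.
rewrite product_measure1E//= IH => [|i]; last exact: ab.
rewrite lebesgue_measure_itv/= lte_fin big_ord_recl EFinM.
case: ltP => // ba; have -> : a ord0 = b ord0 by apply/le_anti; rewrite ab.
by rewrite subrr.
Qed.

End Lebesgue.

Section point_process.
Context {R : realType} {d : nat} {dO : measure_display} {O : measurableType dO}.
Implicit Types (P : probability O R) (mu : R.-ker O ~> 'rV[R]_d).

(* A kernel from the sample space is a random measure: each mu w is a measure
   and w |-> mu w A is measurable for every Borel A. Counting measures are the
   integer-valued ones, so atoms may have multiplicity. *)
Definition point_process mu : Prop :=
  (forall w (A : set 'rV[R]_d), measurable A -> bounded_set A ->
     (mu w A < +oo)%E) /\
  (forall w (A : set 'rV[R]_d), measurable A -> (mu w A < +oo)%E ->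
     exists k : nat, mu w A = k%:R%:E).

(* The sigma-algebra generated by the evaluations m |-> m A, A Borel. *)
Definition measure_events : set (set (set 'rV[R]_d -> \bar R)) :=
  <<s [set S | exists (A : set 'rV[R]_d) (B : set (\bar R)),
         [/\ measurable A, measurable B & S = [set m | B (m A)]]] >>.

Definition stationary P mu : Prop :=
  forall (x : 'rV[R]_d) S, measure_events S ->
    P [set w | S (pushforward (mu w) (+%R x))] =
    P [set w | S (mu w : set 'rV[R]_d -> \bar R)].

Definition unit_intensity P mu : Prop :=
  forall A : set 'rV[R]_d, measurable A -> (\int[P]_w mu w A)%E = leb A.

Definition locally_square_integrable P mu : Prop :=
  forall A : set 'rV[R]_d, measurable A -> bounded_set A ->
    (\int[P]_w (mu w A) ^+ 2 < +oo)%E.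

End point_process.

Section reduced_pair_correlation.
Context {R : realType} {d : nat}.
Implicit Types (beta : set 'rV[R]_d -> \bar R) (f phi psi : 'rV[R]_d -> R).

(* A signed measure defined on bounded sets: the values of beta on unbounded
   or non-measurable sets are never used. *)
Definition local_charge beta : Prop :=
  forall K : set 'rV[R]_d, measurable K -> bounded_set K ->
    exists nu : {charge set 'rV[R]_d -> \bar R},
      forall A : set 'rV[R]_d, measurable A -> nu A = beta (A `&` K).

(* Jordan decomposition and total variation of a local_charge. *)
Definition pos_part beta (A : set 'rV[R]_d) : \bar R :=
  ereal_sup [set beta B | B in
    [set B : set 'rV[R]_d | [/\ measurable B, bounded_set B & B `<=` A]]].

Definition neg_part beta : set 'rV[R]_d -> \bar R :=
  pos_part (fun A => - beta A)%E.

Definition total_variation beta (A : set 'rV[R]_d) : \bar R :=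
  (pos_part beta A + neg_part beta A)%E.

(* For F bounded with bounded support both integrals are finite. *)
Definition charge_integral beta (F : 'rV[R]_d -> \bar R) : \bar R :=
  (\int[pos_part beta]_x F x - \int[neg_part beta]_x F x)%E.

Definition test_function phi : Prop :=
  [/\ forall x, 0 <= phi x, continuous phi &
      compact (closure [set x | phi x != 0])].

Definition is_rpcm (dO : measure_display) (O : measurableType dO)
    (P : probability O R) (mu : R.-ker O ~> 'rV[R]_d) beta : Prop :=
  [/\ local_charge beta,
      forall A : set 'rV[R]_d, measurable A -> bounded_set A ->
        (total_variation beta A < +oo)%E &
      forall phi psi, test_function phi -> test_function psi ->
        (\int[P]_w \int[mu w]_x \int[mu w]_y
           ((x != y)%:R * (phi x * psi y))%:E =
         \int[@leb R d]_x \int[@leb R d]_y (phi x * psi y)%:E +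
         charge_integral beta
           (fun x => \int[@leb R d]_z (phi z * psi (x + z))%:E))%E].

End reduced_pair_correlation.

Section toric_transport.
Context {R : realType} {d : nat}.
Implicit Types (n : nat) (x y : 'rV[R]_d).

(* The library norm on 'rV[R]_d is the sup norm. *)
Definition enorm x : R := Num.sqrt (\sum_(i < d) x ord0 i ^+ 2).

Definition side n : R := n%:R `^ (d%:R^-1).

Definition Lambda n : set 'rV[R]_d :=
  [set x | forall i, - (pi * side n) < x ord0 i <= pi * side n].

Definition toric_dist n x y : R :=
  inf [set enorm (x - y + (2 * pi * side n) *: map_mx intr z)
      | z in [set: 'rV[int]_d]].

(* Only the values of mu and nu on subsets of Lambda n matter. *)
Definition coupling n (mu nu : set 'rV[R]_d -> \bar R)
    (M : {measure set ('rV[R]_d * 'rV[R]_d) -> \bar R}) : Prop :=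
  forall A, measurable A -> A `<=` Lambda n ->
    M (A `*` Lambda n) = mu A /\ M (Lambda n `*` A) = nu A.

Definition toric_cost n (w : R -> R) (mu nu : set 'rV[R]_d -> \bar R) : \bar R :=
  ereal_inf [set \int[M]_(z in Lambda n `*` Lambda n)
                    (w (toric_dist n z.1 z.2))%:E
            | M in coupling n mu nu]%E.

(* The p-th power of the toric Wasserstein distance of order p. *)
Definition toric_Wp n (p : R) := toric_cost n (fun t => t `^ p).

Definition tilde_mu n (m : set 'rV[R]_d -> \bar R) (A : set 'rV[R]_d) : \bar R :=
  if m (Lambda n) == 0%E then (n%:R%:E * \d_(0%R : 'rV[R]_d) A)%E
  else ((n%:R / fine (m (Lambda n)))%:E * m (A `&` Lambda n))%E.

Definition tilde_L n (A : set 'rV[R]_d) : \bar R :=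
  (((2 * pi) ^- d)%:E * leb (A `&` Lambda n))%E.

(* fine is harmless: total_variation is finite on bounded sets, see is_rpcm. *)
Definition bn (beta : set 'rV[R]_d -> \bar R) n : R :=
  1 + fine (total_variation beta [set x + y | x in Lambda n & y in Lambda n]).

Lemma LambdaD n : (0 < d)%N ->
  [set x + y | x in Lambda n & y in Lambda n] = Lambda (2 ^ d * n).
Proof.
move=> d0; have sE : side (2 ^ d * n) = 2 * side n.
  rewrite /side natrM powRM ?natrX//; congr (_ * _).
  by rewrite -powR_mulrn// -powRrM divff ?powRr1// pnatr_eq0 -lt0n.
apply/seteqP; split => [_ [x nx [y ny <-]] i|x nx].
  have /andP[? ?] := nx i; have /andP[? ?] := ny i.
  by rewrite mxE sE mulrCA mulr2n mulrDl mul1r opprD ltrD// lerD.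
have h : Lambda n (2^-1 *: x).
  move=> i; have /andP[] := nx i; rewrite mxE sE mulrCA => l u.
  by rewrite ltr_pdivlMl// ler_pdivrMl// u mulrN l.
exists (2^-1 *: x) => //; exists (2^-1 *: x) => //.
by rewrite -scalerDl -[RHS]scale1r [in RHS](splitr 1) mul1r.
Qed.

End toric_transport.

Definition alpha2 {R : realType} (d n : nat) (b : R) : R :=
  b * (if d == 1%N then n%:R ^+ 2
       else if d == 2%N then n%:R * ln n%:R
       else n%:R).

Definition alpha {R : realType} (d n : nat) (b p : R) : R :=
  if d == 1%N then
    if 2^-1 < p then Num.sqrt b * n%:R * n%:R `^ (p - 2^-1)
    else if p == 2^-1 then Num.sqrt b * n%:R * ln n%:R
    else Num.sqrt b * n%:R * Num.sqrt (ln n%:R)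
  else if d == 2%N then
    Num.sqrt (b `^ p) * n%:R * Num.sqrt (ln n%:R `^ p)
  else Num.sqrt (b `^ p) * n%:R.

(* Main.v *)
(* Lambda_n is cut into 2^(dK) congruent dyadic cells Q_x of side h, with K maximal
   such that 2^(dK) <= n, so that h lies between 2 pi and 4 pi. Writing
   X_x = mu(Q_x) - h^d, the defining relation of the reduced pair correlation
   measure gives E (sum_x a_x X_x)^2 <= B b_n sum_x a_x^2 for all coefficients a:
   off the diagonal, each row of the covariance matrix is bounded by the total
   variation of beta on Lambda_n + Lambda_n, and the diagonal is bounded by
   stationarity.

   The cell counts are then transported to the uniform ones along the Haar
   expansion of X: at each dyadic level the excess mass of one half of a box is
   moved to the other half. For the quadratic cost this is done by a flow between
   neighbouring cells; following it by many small steps of a Markov chain gives a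
   plan whose cost is bounded by the squared norm of the flow. For the cost t^p with
   p <= 1 in dimension 1 it is done by direct jumps, and Cauchy-Schwarz is applied
   with the standard deviations of the Haar coefficients as weights. In dimension
   d >= 2 the case p <= 1 follows from the quadratic cost by concavity. *)
Require Import Defs.
From mathcomp Require Import all_boot all_order all_algebra.
From mathcomp Require Import all_classical all_reals all_analysis.
From mathcomp Require Import ring lra zify measurable_realfun.
Set Implicit Arguments.
Unset Strict Implicit.
Unset Printing Implicit Defensive.
Import Order.TTheory GRing.Theory Num.Theory.
Import numFieldNormedType.Exports.
Local Open Scope classical_set_scope.
Local Open Scope ring_scope.

(** * Transport plans along flows *)

(** The randomness enters only through linear forms in [X] with deterministic coefficients, so a
    single bound on the quadratic form suffices. The flow of a Haar term of level k is its discrete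
    primitive, a tent of height 2^k, while the variance of its coefficient is at most of order b_n /
    2^(dk). The ratio 4 / 2^d from one level to the next separates d = 1, d = 2 and d >= 3; for
    direct jumps on the line the corresponding ratio is 2^(p - 1/2). Two obstacles shape the
    argument. The charge [beta] has no sign, so summing covariances cell by cell would lose a factor
    equal to the number of cells: one bump is tested against the sum of the bumps of an arbitrary
    set of cells, and the signs are sorted afterwards. The division by N is neither linear nor
    bounded: when N is at least half of its mean, the normalised counts are the uniform ones plus
    [theta] times the centred fluctuation, with [theta <= 1]; otherwise the fluctuation of N is at
    least n and pays for any plan. The maximal K makes the uniform mass of a cell at least 1, which
    absorbs the cross term of the quadratic cost. *)

Definition is_plan {R : realType} {V : finType} (mu nu : V -> R) (M : V -> V -> R) :=
  [/\ forall x y, 0 <= M x y, forall x, \sum_y M x y = mu x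
    & forall y, \sum_x M x y = nu y].

Definition plan_cost {R : realType} {V : finType} (k M : V -> V -> R) : R :=
  \sum_x \sum_y M x y * k x y.

Section plans.
Context {R : realType} {V : finType}.
Implicit Types (mu nu : V -> R) (M k : V -> V -> R).

Lemma plan_row0 mu nu M x y : is_plan mu nu M -> mu x = 0 -> M x y = 0.
Proof.
move=> [M0 M1 _] mx; have := M1 x; rewrite mx => /eqP.
by rewrite psumr_eq0// => /allP/(_ y)/= /(_ (mem_index_enum _))/eqP.
Qed.

Lemma plan_col0 mu nu M x y : is_plan mu nu M -> nu y = 0 -> M x y = 0.
Proof.
move=> [M0 _ M2] my; have := M2 y; rewrite my => /eqP.
by rewrite psumr_eq0// => /allP/(_ x)/= /(_ (mem_index_enum _))/eqP.
Qed.

(** The two plans are made independent given the middle point. Where [nu y = 0] the quotient is 0,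
    harmlessly: [plan_col0] and [plan_row0] make the numerator vanish too. *)
Definition glue nu M1 M2 x z : R := \sum_y M1 x y * M2 y z / nu y.

Lemma plan_glue mu nu pi M1 M2 : is_plan mu nu M1 -> is_plan nu pi M2 ->
  is_plan mu pi (glue nu M1 M2).
Proof.
move=> p1 p2; have [A0 A1 A2] := p1; have [B0 B1 B2] := p2.
have nu0 y : 0 <= nu y by rewrite -A2 sumr_ge0.
split=> [x z|x|z].
- by apply: sumr_ge0 => y _; rewrite divr_ge0// mulr_ge0.
- rewrite exchange_big -A1; apply: eq_bigr => y _.
  rewrite -mulr_suml -mulr_sumr B1; have [n0|n0] := eqVneq (nu y) 0.
    by rewrite (plan_col0 _ p1)// !mul0r.
  by rewrite mulfK.
- rewrite exchange_big -B2; apply: eq_bigr => y _.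
  rewrite -!mulr_suml A2; have [n0|n0] := eqVneq (nu y) 0.
    by rewrite (plan_row0 _ p2)// mulr0 mul0r.
  by rewrite mulrAC divff// mul1r.
Qed.

Lemma plan_cost_glue mu nu pi M1 M2 k (a b : R) :
  (forall x y z, k x z <= a * k x y + b * k y z) ->
  is_plan mu nu M1 -> is_plan nu pi M2 ->
  plan_cost k (glue nu M1 M2) <= a * plan_cost k M1 + b * plan_cost k M2.
Proof.
move=> kt p1 p2; have [A0 A1 A2] := p1; have [B0 B1 B2] := p2.
have nu0 y : 0 <= nu y by rewrite -A2 sumr_ge0.
(* [W] is the joint law of the three points: summing over [z] gives [M1], over [x] gives [M2]. *)
pose W x y z := M1 x y * M2 y z / nu y.
have W0 x y z : 0 <= W x y z by rewrite divr_ge0// mulr_ge0.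
apply: (@le_trans _ _ (\sum_x \sum_z \sum_y W x y z * (a * k x y + b * k y z))).
  apply: ler_sum => x _; apply: ler_sum => z _.
  by rewrite /glue mulr_suml; apply: ler_sum => y _; apply: ler_wpM2l; [exact: W0|exact: kt].
have -> : plan_cost k M1 = \sum_x \sum_z \sum_y W x y z * k x y.
  apply: eq_bigr => x _; rewrite [RHS]exchange_big; apply: eq_bigr => y _.
  rewrite -mulr_suml; congr (_ * _); rewrite -mulr_suml -mulr_sumr B1.
  have [n0|n0] := eqVneq (nu y) 0; first by rewrite (plan_col0 _ p1)// !mul0r.
  by rewrite mulfK.
have -> : plan_cost k M2 = \sum_x \sum_z \sum_y W x y z * k y z.
  rewrite /plan_cost [LHS]exchange_big [RHS]exchange_big; apply: eq_bigr => z _.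
  rewrite [RHS]exchange_big; apply: eq_bigr => y _ /=.
  rewrite -mulr_suml; congr (_ * _); rewrite -!mulr_suml A2.
  have [n0|n0] := eqVneq (nu y) 0; first by rewrite (plan_row0 _ p2)// !(mulr0, mul0r).
  by rewrite mulrAC divff// mul1r.
rewrite !mulr_sumr -big_split; apply: ler_sum => x _ /=.
rewrite !mulr_sumr -big_split; apply: ler_sum => z _ /=.
rewrite !mulr_sumr -big_split; apply: ler_sum => y _ /=.
by rewrite mulrDr !(mulrCA a) !(mulrCA b).
Qed.

Lemma plan_cost_ge0 mu nu M k : (forall x y, 0 <= k x y) -> is_plan mu nu M ->
  0 <= plan_cost k M.
Proof. by move=> k0 [M0 _ _]; do 2![apply: sumr_ge0 => ? _]; exact: mulr_ge0. Qed.

Lemma diag_plan mu : (forall x, 0 <= mu x) ->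
  is_plan mu mu (fun x y => (x == y)%:R * mu x).
Proof.
move=> mu0; split=> [x y|x|y]; first by rewrite mulr_ge0.
- rewrite (bigD1 x)//= eqxx mul1r big1 ?addr0// => y /negbTE.
  by rewrite eq_sym => ->; rewrite mul0r.
- rewrite (bigD1 y)//= eqxx mul1r big1 ?addr0// => x /negbTE ->.
  by rewrite mul0r.
Qed.

Lemma diag_plan_cost mu k : (forall x, k x x = 0) ->
  plan_cost k (fun x y => (x == y)%:R * mu x) = 0.
Proof.
move=> k0; apply: big1 => x _; apply: big1 => y _.
by have [->|] := eqVneq x y; rewrite ?k0 ?mulr0// !mul0r.
Qed.

(* One step of a Markov chain moving the mass [e * J y z] from [y] to [z]. *)
Lemma flow_step mu nu M k (J : V -> V -> R) (e q : R) (a : V -> R) :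
  0 <= e -> 0 < q -> (forall y z, 0 <= J y z) -> (forall x y, 0 <= k x y) ->
  (forall y, q <= nu y) -> (forall y, e * \sum_z J y z <= nu y) ->
  (forall x y, \sum_z J y z * (k x z - k x y) <= q * k x y + a y) ->
  is_plan mu nu M ->
  exists2 M', is_plan mu (fun y => nu y + e * (\sum_z J z y - \sum_z J y z)) M' &
    plan_cost k M' <= (1 + e) * plan_cost k M + e * \sum_y a y.
Proof.
move=> e0 q0 J0 k0 qnu enu H p1.
have nu0 y : 0 < nu y by exact: lt_le_trans (qnu y).
pose S y z := e * J y z + (y == z)%:R * (nu y - e * \sum_z J y z).
(* The kernel [S] acts as multiplication by [nu] plus [e] times the generator of the jump chain with
   rates [J]. *)
have Srow y (g : V -> R) :
    \sum_z S y z * g z = nu y * g y + e * \sum_z J y z * (g z - g y).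
  under eq_bigr do rewrite mulrDl; rewrite big_split/=.
  rewrite [X in _ + X](bigD1 y)//= eqxx mul1r [X in _ + (_ + X)]big1; last first.
    by move=> z /negbTE; rewrite eq_sym => ->; rewrite !mul0r.
  rewrite addr0 mulrBl addrC -addrA; congr (_ + _).
  under [in RHS]eq_bigr do rewrite mulrBr.
  rewrite [in RHS]big_split/= mulrDr sumrN mulrN -!mulr_suml mulrA addrC; congr (_ - _).
  by rewrite mulr_sumr; apply: eq_bigr => z _; rewrite mulrA.
have pS : is_plan nu (fun y => nu y + e * (\sum_z J z y - \sum_z J y z)) S.
  split=> [y z|y|z].
  - by rewrite addr_ge0 ?mulr_ge0// subr_ge0.
  - under eq_bigr do rewrite -[S _ _]mulr1.
    by rewrite (Srow _ (fun=> 1)) mulr1 big1 ?mulr0 ?addr0// => z _; rewrite subrr mulr0.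
  - rewrite big_split/= -mulr_sumr [X in _ + X](bigD1 z)//= eqxx mul1r [X in _ + (_ + X)]big1.
      by rewrite addr0 mulrBr; ring.
    by move=> y /negbTE ->; rewrite mul0r.
exists (glue nu M S); first exact: plan_glue pS.
have [M0 M1 M2] := p1.
have -> : plan_cost k (glue nu M S) =
    \sum_x \sum_y M x y * (k x y + e * (\sum_z J y z * (k x z - k x y)) / nu y).
  apply: eq_bigr => x _; under eq_bigr do rewrite /glue mulr_suml.
  rewrite exchange_big; apply: eq_bigr => y _ /=.
  transitivity (M x y * ((\sum_z S y z * k x z) / nu y)).
    by rewrite mulr_suml mulr_sumr; apply: eq_bigr => z _; rewrite /=; ring.
  congr (_ * _).
  rewrite (Srow y (k x)) mulrDl; congr (_ + _).
  by rewrite mulrAC divff ?mul1r// gt_eqF.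
rewrite /plan_cost mulrDl mul1r -addrA.
(* Since [q <= nu y], the drift [q * k x y / nu y] is at most [k x y]; the remaining [a y / nu y]
   becomes [a y] when summed against column [y] of [M]. *)
apply: (@le_trans _ _ (\sum_x \sum_y (M x y * k x y +
    (e * (M x y * k x y) + e * (M x y * (a y / nu y)))))).
  apply: ler_sum => x _; apply: ler_sum => y _.
  rewrite mulrDr lerD2l -mulrA mulrCA -mulrDr ler_wpM2l// -mulrDr ler_wpM2l//.
  rewrite ler_pdivrMr// mulrDl divfK ?gt_eqF//; apply: (le_trans (H x y)).
  by rewrite lerD2r mulrC ler_wpM2l.
rewrite pair_big big_split/= [X in _ + X]big_split/= -!mulr_sumr.
rewrite -!(pair_big xpredT xpredT (fun x y => M x y * k x y))/= lerD2l lerD2l.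
rewrite -(pair_big xpredT xpredT (fun x y => M x y * (a y / nu y)))/=.
rewrite ler_wpM2l// exchange_big; apply: ler_sum => y _ /=.
by rewrite -mulr_suml M2 mulrCA divff ?mulr1// gt_eqF.
Qed.

End plans.

(** * Plans that follow a flow to its end *)

Section flow_plan.
Context {R : realType} {V : finType}.
Variables (q : R) (nu : V -> R) (J k : V -> V -> R) (a : V -> R).
Hypothesis q0 : 0 < q.
Hypothesis nu0 : forall y, 0 <= nu y.
Hypothesis J0 : forall y z, 0 <= J y z.
Hypothesis nuE : forall y, nu y = q + (\sum_z J z y - \sum_z J y z).
Hypothesis k0 : forall x y, 0 <= k x y.
Hypothesis kxx : forall x, k x x = 0.
Hypothesis kt : forall x y z, k x z <= 3 * k x y + 3 / 2 * k y z.
Hypothesis H : forall x y,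
  \sum_z J y z * (k x z - k x y) <= q / 2 * k x y + a y.

Let a0 y : 0 <= a y.
Proof.
apply: le_trans (_ : \sum_z J y z * (k y z - k y y) <= _).
  by apply: sumr_ge0 => z _; rewrite kxx subr0 mulr_ge0.
by have := H y y; rewrite kxx mulr0 add0r.
Qed.

Lemma bernoulli_mul (x : R) t : 0 <= x -> (1 + x) ^+ t * (1 - t%:R * x) <= 1.
Proof.
move=> x0; elim: t => [|t]; first by rewrite expr0 mul0r subr0 mulr1.
apply: le_trans; rewrite exprSr -mulrA ler_wpM2l ?exprn_ge0 ?addr_ge0//.
rewrite -natr1; have : 0 <= (t%:R + 1) * x ^+ 2 by rewrite mulr_ge0 ?addr_ge0// sqr_ge0.
by nra.
Qed.

(* The mass is displaced along [J] only until it reaches the midpoint of the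
   uniform measure and [nu]: up to there all the masses stay above [q / 2]. *)
Let half : exists2 M, is_plan (fun=> q) (fun y => (q + nu y) / 2) M &
  plan_cost k M <= \sum_y a y.
Proof.
(* There are enough steps for each to move at most [q / 2] out of any point; the total time [T * e]
   is 1/2, the midpoint. *)
pose T := (Num.bound (\sum_y \sum_z J y z / q)).+1.
pose e : R := (2 * T%:R)^-1.
have e0 : 0 < e by rewrite invr_gt0 mulr_gt0.
have Te : T%:R * e = 2^-1 by rewrite /e; field; rewrite pnatr_eq0.
have JT y : e * \sum_z J y z <= q / 2.
  rewrite (_ : q / 2 = e * (T%:R * q)); last by rewrite mulrA [e * _]mulrC Te mulrC.
  rewrite ler_wpM2l ?(ltW e0)// -ler_pdivrMr//.
  have S0 : 0 <= \sum_y \sum_z J y z / q.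
    by do 2![apply: sumr_ge0 => ? _]; rewrite divr_ge0// ltW.
  apply: le_trans (_ : \sum_y \sum_z J y z / q <= _).
    rewrite [leRHS](bigD1 y)//= -mulr_suml lerDl.
    by do 2![apply: sumr_ge0 => ? _]; rewrite divr_ge0// ltW.
  by apply/ltW/(lt_le_trans (archi_boundP S0)); rewrite ler_nat leqnSn.
pose m t y := q + t%:R * e * (\sum_z J z y - \sum_z J y z).
have mq t y : (t <= T)%N -> q / 2 <= m t y.
  move=> tT; have -> : m t y = (1 - t%:R * e) * q + t%:R * e * nu y.
    by rewrite nuE /m; ring.
  have te : t%:R * e <= 2^-1 by rewrite -Te ler_wpM2r ?ler_nat// ltW.
  have te0 : 0 <= t%:R * e by rewrite mulr_ge0// ltW.
  have := mulr_ge0 te0 (nu0 y); have := ler_wpM2r (ltW q0) te; lra.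
have step t : (t <= T)%N -> exists2 M, is_plan (fun=> q) (m t) M &
    plan_cost k M <= ((1 + e) ^+ t - 1) * \sum_y a y.
  elim: t => [_|t IH tT].
    exists (fun x y => (x == y)%:R * q).
      have := @diag_plan R V (fun=> q) (fun=> ltW q0).
      by under [m 0]funext do rewrite /m !mul0r addr0.
    by rewrite (diag_plan_cost (fun=> q))// expr0 subrr mul0r.
  have [M pM cM] := IH (ltnW tT).
  have [M' pM' cM'] := flow_step (ltW e0) (divr_gt0 q0 (ltr0n _ 2)) J0 k0
    (fun y => mq t y (ltnW tT)) (fun y => le_trans (JT y) (mq t y (ltnW tT))) H pM.
  exists M'.
    suff -> : m t.+1 = (fun y => m t y + e * (\sum_z J z y - \sum_z J y z)) by [].
    by apply: boolp.funext => y; rewrite /m -natr1; ring.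
  apply: (le_trans cM'); rewrite exprS.
  have : 0 <= e by exact: ltW.
  move=> ?; have := ler_wpM2l (_ : 0 <= 1 + e) cM; rewrite addr_ge0// => /(_ isT).
  by nra.
have [M pM cM] := step T (leqnn _).
exists M.
  suff <- : m T = (fun y => (q + nu y) / 2) by [].
  by apply: boolp.funext => y; rewrite /m Te nuE; field.
apply: (le_trans cM); rewrite ler_piMl ?sumr_ge0//.
(* As [T * e] is 1/2, this gives [(1 + e) ^+ T <= 2], so the factor in front of the sum of [a] is at
   most 1. *)
have := @bernoulli_mul e T (ltW e0); rewrite Te.
have -> : 1 - 2^-1 = 2^-1 :> R by field.
by rewrite ler_pdivrMr//; lra.
Qed.

(* If a plan for [nu] costs C, then [(q + nu) / 2] can be sent to [nu] at cost
   C / 2, because half of [nu] stays in place; gluing this to the plan of [half]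
   gives a new plan for [nu] and contracts the cost up to a constant. *)
Lemma flow_plan (eta : R) : 0 < eta -> exists2 M, is_plan (fun=> q) nu M &
  plan_cost k M <= 12 * \sum_y a y + eta.
Proof.
move=> eta0; have [M1 p1 c1] := half; set A := \sum_y a y in c1 *.
have nxt M : is_plan (fun=> q) nu M -> exists2 M', is_plan (fun=> q) nu M' &
    plan_cost k M' <= 3 * A + 3 / 4 * plan_cost k M.
  move=> [M0 Mq Mnu].
  pose M2 x y := M x y / 2 + (x == y)%:R * (nu y / 2).
  have p2 : is_plan (fun y => (q + nu y) / 2) nu M2.
    split=> [x y|x|y].
    - by apply: addr_ge0; apply: mulr_ge0; rewrite ?divr_ge0 ?invr_ge0.
    - rewrite big_split/= -mulr_suml Mq (bigD1 x)//= eqxx mul1r big1 ?addr0 -?mulrDl//.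
      by move=> y /negbTE; rewrite eq_sym => ->; rewrite mul0r.
    - rewrite big_split/= -mulr_suml Mnu [X in _ + X](bigD1 y)//= eqxx mul1r.
      rewrite [X in _ + (_ + X)]big1 => [|x /negbTE ->]; last by rewrite mul0r.
      by rewrite addr0 -splitr.
  have c2 : plan_cost k M2 = plan_cost k M / 2.
    rewrite /plan_cost mulr_suml; apply: eq_bigr => x _.
    rewrite mulr_suml; apply: eq_bigr => y _; rewrite mulrDl mulrAC.
    by have [->|] := eqVneq x y; rewrite ?kxx ?mulr0 ?mul0r ?addr0.
  exists (glue (fun y => (q + nu y) / 2) M1 M2); first exact: plan_glue p1 p2.
  (* The weight 3/2 of [kt] times the factor 1/2 of [c2] gives the contraction factor 3/4. *)
  apply: (le_trans (plan_cost_glue kt p1 p2)); rewrite c2.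
  by apply: lerD; rewrite ?ler_wpM2l//; lra.
have [M0 pM0] : exists M, is_plan (fun=> q) nu M.
  pose Z := \sum_y nu y; exists (fun x y => nu y / #|V|%:R).
  have S : \sum_y nu y = q *+ #|V|.
    under eq_bigr do rewrite nuE; rewrite big_split/= sumr_const sumrB.
    by rewrite [X in _ + (X - _)]exchange_big subrr addr0.
  split=> [x y|x|y]; first by rewrite divr_ge0.
  - rewrite -mulr_suml S -(mulr_natr q) mulfK// pnatr_eq0 -lt0n.
    by apply/card_gt0P; exists x.
  - rewrite sumr_const -(mulr_natr (nu y / _)) divfK// pnatr_eq0 -lt0n.
    by apply/card_gt0P; exists y.
(* [12 * A] is the fixed point of the map sending t to [3 * A + 3 / 4 * t]. *)
have iter n : exists2 M, is_plan (fun=> q) nu M &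
    plan_cost k M <= 12 * A + (3 / 4) ^+ n * plan_cost k M0.
  elim: n => [|n [M /nxt[M' pM' cM'] cM]].
    by exists M0 => //; rewrite expr0 mul1r lerDr mulr_ge0// sumr_ge0.
  exists M' => //; apply: (le_trans cM'); rewrite exprS.
  by move: cM; move: ((3 / 4) ^+ n) => u; nra.
have C0 := plan_cost_ge0 k0 pM0.
have [n hn] : exists n, (3 / 4) ^+ n * plan_cost k M0 <= eta.
  exists (Num.bound (3 * plan_cost k M0 / eta)).
  set n := Num.bound _; have nb : 3 * plan_cost k M0 / eta < n%:R.
    by apply: archi_boundP; rewrite divr_ge0 ?mulr_ge0// ltW.
  have : (3 / 4) ^+ n * (1 + n%:R / 3) <= 1 :> R.
    elim: (n) => [|j IH]; first by rewrite expr0 mul0r addr0 mulr1.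
    apply: le_trans IH; rewrite exprSr -mulrA -[j.+1%:R]natr1.
    have := ler0n R j => j0; rewrite ler_wpM2l ?exprn_ge0//; lra.
  rewrite ltr_pdivrMr// in nb; move: nb.
  have : 0 <= (3 / 4) ^+ n :> R by rewrite exprn_ge0//; lra.
  move: ((3 / 4) ^+ n) (n%:R) => u v u0 h1 h2.
  have h3 : u * (3 * plan_cost k M0) <= u * (v * eta) by rewrite ler_wpM2l// ltW.
  have h4 : u * (1 + v / 3) * eta <= eta by rewrite ler_piMl// ltW.
  have h5 : 0 <= u * eta by rewrite mulr_ge0// ltW.
  by nra.
have [M pM cM] := iter n; exists M => //.
by apply: (le_trans cM); rewrite lerD2l.
Qed.

End flow_plan.

(** * Signed exchanges along edges *)

Section exchanges.
Context {R : realType} {V E : finType}.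
Variables (src dst : E -> V) (f : E -> R).

Definition net_flow y : R := \sum_(e | dst e == y) f e - \sum_(e | src e == y) f e.

Definition throughput y : R :=
  \sum_(e | src e == y) `|f e| + \sum_(e | dst e == y) `|f e|.

Let fp e := Num.max 0 (f e).
Let fm e := Num.max 0 (- f e).

(** A negative exchange is a positive one in the opposite direction. *)
Let J u v : R := \sum_e (((src e == u) && (dst e == v))%:R * fp e +
                         ((dst e == u) && (src e == v))%:R * fm e).

Let fp0 e : 0 <= fp e. Proof. by rewrite /fp le_max lexx. Qed.
Let fm0 e : 0 <= fm e. Proof. by rewrite /fm le_max lexx. Qed.
Let fpB e : fp e - fm e = f e.
Proof.
rewrite /fp /fm; have [h|h] := leP 0 (f e).
  by rewrite max_l ?subr0// oppr_le0.
by rewrite max_r ?sub0r ?opprK// oppr_ge0 ltW.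
Qed.
Let fpD e : fp e + fm e = `|f e|.
Proof.
rewrite /fp /fm; have [h|h] := leP 0 (f e).
  by rewrite max_l ?addr0 ?ger0_norm// oppr_le0.
by rewrite max_r ?add0r ?ltr0_norm// oppr_ge0 ltW.
Qed.

Let J0 u v : 0 <= J u v.
Proof. by apply: sumr_ge0 => e _; rewrite addr_ge0// mulr_ge0. Qed.

Let Jrow u (g : V -> R) : \sum_v J u v * g v =
  \sum_(e | src e == u) fp e * g (dst e) + \sum_(e | dst e == u) fm e * g (src e).
Proof.
under eq_bigr do rewrite mulr_suml; rewrite exchange_big/=.
rewrite [in RHS]big_mkcond [X in _ = _ + X]big_mkcond -big_split/=.
apply: eq_bigr => e _; under eq_bigr do rewrite mulrDl; rewrite big_split/=.
congr (_ + _).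
- case: eqP => _ /=; last by rewrite big1// => v _; rewrite !mul0r.
  rewrite (bigD1 (dst e))//= eqxx mul1r big1 ?addr0// => v.
  by rewrite eq_sym => /negbTE ->; rewrite !mul0r.
- case: eqP => _ /=; last by rewrite big1// => v _; rewrite !mul0r.
  rewrite (bigD1 (src e))//= eqxx mul1r big1 ?addr0// => v.
  by rewrite eq_sym => /negbTE ->; rewrite !mul0r.
Qed.

Let Jcol v : \sum_u J u v =
  \sum_(e | dst e == v) fp e + \sum_(e | src e == v) fm e.
Proof.
rewrite exchange_big/=.
rewrite [in RHS]big_mkcond [X in _ = _ + X]big_mkcond -big_split/=.
apply: eq_bigr => e _; rewrite big_split/=; congr (_ + _).
- case: eqP => _ /=; last by rewrite big1// => u _; rewrite andbF mul0r.
  rewrite (bigD1 (src e))//= eqxx mul1r big1 ?addr0// => u.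
  by rewrite eq_sym => /negbTE ->; rewrite !mul0r.
- case: eqP => _ /=; last by rewrite big1// => u _; rewrite andbF mul0r.
  rewrite (bigD1 (dst e))//= eqxx mul1r big1 ?addr0// => u.
  by rewrite eq_sym => /negbTE ->; rewrite !mul0r.
Qed.

Let Jsum u : \sum_v J u v =
  \sum_(e | src e == u) fp e + \sum_(e | dst e == u) fm e.
Proof.
transitivity (\sum_v J u v * 1); first by apply: eq_bigr => v _; rewrite mulr1.
by rewrite (Jrow u (fun=> 1)); congr (_ + _); apply: eq_bigr => e _; rewrite mulr1.
Qed.

Let Jnet y : \sum_z J z y - \sum_z J y z = net_flow y.
Proof.
rewrite Jcol Jsum /net_flow; under [X in _ = X - _]eq_bigr do rewrite -fpB.
under [X in _ = _ - X]eq_bigr do rewrite -fpB.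
by rewrite !sumrB; ring.
Qed.

Let Jthrough y : 0 <= \sum_z J y z <= throughput y.
Proof.
rewrite sumr_ge0//= Jsum lerD// ler_sum// => e _; rewrite -fpD.
  by rewrite lerDl.
by rewrite lerDr.
Qed.

Variables (q : R) (nu : V -> R) (rho : V -> V -> R).
Hypothesis q0 : 0 < q.
Hypothesis nu0 : forall y, 0 <= nu y.
Hypothesis nuE : forall y, nu y = q + net_flow y.
Hypothesis rho0 : forall x y, 0 <= rho x y.
Hypothesis rhoxx : forall x, rho x x = 0.
Hypothesis rhoC : forall x y, rho x y = rho y x.
Hypothesis rhoT : forall x y z, rho x z <= rho x y + rho y z.

Let nuJ y : nu y = q + (\sum_z J z y - \sum_z J y z).
Proof. by rewrite nuE Jnet. Qed.

(** A jump of length at most 1 out of [y] raises the squared distance to [x] by at most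
    [2 * rho x y + 1]. Multiplied by the outgoing rate [G y], the part in [rho x y] goes by Young's
    inequality and [1 <= q] into [q / 2 * rho x y ^+ 2], leaving [2 * G y ^+ 2 + G y]: the cost is
    quadratic in the flow. *)
Lemma exchange_plan_sqr : 1 <= q ->
  (forall e, f e != 0 -> rho (src e) (dst e) <= 1) ->
  exists2 M, is_plan (fun=> q) nu M &
    plan_cost (fun x y => rho x y ^+ 2) M <=
    13 * \sum_y (1 + 3 * throughput y ^+ 2).
Proof.
move=> q1 f1; pose G y := \sum_z J y z.
have G0 y : 0 <= G y by have /andP[] := Jthrough y.
have GT y : G y <= throughput y by have /andP[] := Jthrough y.
have H x y : \sum_z J y z * (rho x z ^+ 2 - rho x y ^+ 2) <=
    q / 2 * rho x y ^+ 2 + (2 * G y ^+ 2 + G y).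
  apply: (@le_trans _ _ (\sum_z J y z * (2 * rho x y + 1))).
    apply: ler_sum => z _.
    have [->|Jn0] := eqVneq (J y z) 0; first by rewrite !mul0r.
    rewrite ler_wpM2l//; suff yz1 : rho y z <= 1.
      by have := rhoT x y z; have := rho0 x z; have := rho0 x y; nra.
    have [e _ Jen0] : exists2 e, true & ((src e == y) && (dst e == z))%:R * fp e +
         ((dst e == y) && (src e == z))%:R * fm e != 0.
      apply/exists_inP; apply: contra_neqT Jn0 => /exists_inPn He.
      by apply: big1 => e _; apply/eqP; have := He e isT; rewrite negbK.
    have fe0 : f e != 0.
      apply: contra_neq Jen0 => fe0; rewrite /fp /fm fe0 oppr0 maxxx.
      by rewrite !mulr0 addr0.
    case: (boolP ((src e == y) && (dst e == z))) Jen0 => [/andP[/eqP<- /eqP<-] _|_].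
      exact: f1.
    case: (boolP ((dst e == y) && (src e == z))) => [/andP[/eqP<- /eqP<-] _|_].
      by rewrite rhoC; exact: f1.
    by rewrite !mul0r addr0 eqxx.
  rewrite -mulr_suml -/(G y); move: (G y) (rho x y) (G0 y) => g r g0.
  have : 0 <= (r / 2 - g * 2) ^+ 2 + (q - 1) / 2 * r ^+ 2.
    by rewrite addr_ge0 ?sqr_ge0// mulr_ge0 ?sqr_ge0//; lra.
  by have := sqr_ge0 r; have := sqr_ge0 (r - 2 * g); nra.
have kt x y z : rho x z ^+ 2 <= 3 * rho x y ^+ 2 + 3 / 2 * rho y z ^+ 2.
  apply: (@le_trans _ _ ((rho x y + rho y z) ^+ 2)).
    by rewrite ler_sqr ?nnegrE ?addr_ge0.
  by have := sqr_ge0 (2 * rho x y - rho y z); nra.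
have kxx x : rho x x ^+ 2 = 0 by rewrite rhoxx expr0n.
have [M pM cM] := @flow_plan R V q nu J (fun x y => rho x y ^+ 2)
  (fun y => 2 * G y ^+ 2 + G y) q0 nu0 J0 nuJ (fun x y => sqr_ge0 _) kxx kt H 1 ltr01.
(* The additive error [eta = 1] is at most the final sum as soon as [V] has a point, which turns 12
   into 13; without points every cost is 0. *)
have [v|V0] := pickP (xpredT : pred V); last first.
  exists M => //; rewrite /plan_cost !big1 ?mulr0// => v; by have := V0 v.
exists M => //; apply: (le_trans cM).
have h1 : \sum_y (2 * G y ^+ 2 + G y) <= \sum_y (1 + 3 * throughput y ^+ 2).
  apply: ler_sum => y _.
  by have := GT y; have := G0 y; have := sqr_ge0 (G y - 1); nra.
have h2 : 1 <= \sum_y (1 + 3 * throughput y ^+ 2).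
  rewrite (bigD1 v)//= -addrA lerDl; apply: addr_ge0.
    by rewrite mulr_ge0// sqr_ge0.
  by apply: sumr_ge0 => y _; apply: addr_ge0 => //; rewrite mulr_ge0// sqr_ge0.
lra.
Qed.

(** For a metric the triangle inequality bounds the effect of a jump by its own length, so long
    edges are allowed. Powers at most 1 of a distance are metrics, which covers the concave
    costs. *)
Lemma exchange_plan_metric (eta : R) : 0 < eta ->
  exists2 M, is_plan (fun=> q) nu M &
    plan_cost rho M <= 12 * \sum_e `|f e| * rho (src e) (dst e) + eta.
Proof.
move=> eta0; pose a y := \sum_z J y z * rho y z.
have a0 y : 0 <= a y by apply: sumr_ge0 => z _; rewrite mulr_ge0.
have H x y : \sum_z J y z * (rho x z - rho x y) <= q / 2 * rho x y + a y.
  apply: (@le_trans _ _ (a y)); last by rewrite lerDr mulr_ge0// ltW// divr_gt0.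
  by apply: ler_sum => z _; rewrite ler_wpM2l// lerBlDl.
have kt x y z : rho x z <= 3 * rho x y + 3 / 2 * rho y z.
  by have := rhoT x y z; have := rho0 x y; have := rho0 y z; lra.
have [M pM cM] := @flow_plan R V q nu J rho a q0 nu0 J0 nuJ rho0 rhoxx kt H eta eta0.
exists M => //; apply: (le_trans cM); rewrite lerD2r ler_wpM2l//.
rewrite /a; under eq_bigr do rewrite Jrow.
rewrite big_split/=.
have cond (g h : E -> V) (c : E -> R) :
    \sum_y \sum_(e | g e == y) c e * rho y (h e) = \sum_e c e * rho (g e) (h e).
  rewrite (partition_big g xpredT)//=; apply: eq_bigr => y _.
  by apply: eq_bigr => e /eqP ->.
rewrite !cond -big_split/=; apply: ler_sum => e _.
by rewrite [rho (dst e) _]rhoC -mulrDl fpD.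
Qed.

End exchanges.

(** * Dyadic Haar expansion *)

Section binary_digits.
Local Open Scope nat_scope.

Definition digit k v := odd (v %/ 2 ^ k).

Definition flip_digit k v := if digit k v then v - 2 ^ k else v + 2 ^ k.

Lemma flip_digitE k v : flip_digit k v =
  (if digit k v then (v %/ 2 ^ k).-1 else (v %/ 2 ^ k).+1) * 2 ^ k + v %% 2 ^ k.
Proof.
rewrite /flip_digit; have := divn_eq v (2 ^ k); rewrite /digit.
case: ifP => h e; last by rewrite mulSn -addnA -e addnC.
have : 0 < v %/ 2 ^ k by case: (v %/ 2 ^ k) h.
rewrite {2}e; case: (v %/ 2 ^ k) => // a _.
by rewrite mulSn -addnA addKn.
Qed.

Lemma flip_digit_div k v : flip_digit k v %/ 2 ^ k =
  if digit k v then (v %/ 2 ^ k).-1 else (v %/ 2 ^ k).+1.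
Proof.
rewrite flip_digitE divnMDl ?expn_gt0// [X in _ + X]divn_small ?addn0//.
by rewrite ltn_pmod ?expn_gt0.
Qed.

Lemma flip_digit_high k m v : k < m -> flip_digit k v %/ 2 ^ m = v %/ 2 ^ m.
Proof.
move=> /subnKC <-; rewrite addSn -addnS expnD !divnMA flip_digit_div expnS !divnMA.
congr (_ %/ _); rewrite !divn2 /digit; case: ifP => h.
  by case: (v %/ 2 ^ k) h => //= a /negbTE oa; rewrite uphalf_half oa.
by rewrite /= uphalf_half h.
Qed.

Lemma digit_flip k v : digit k (flip_digit k v) = ~~ digit k v.
Proof.
rewrite {1}/digit flip_digit_div; case: ifP => h; last by rewrite /= -/(digit k v) h.
by move: h; rewrite /digit; case: (v %/ 2 ^ k) => //= a /negbTE.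
Qed.

Lemma flip_digitK k : involutive (flip_digit k).
Proof.
move=> v; rewrite {1}/flip_digit digit_flip /flip_digit.
case: (boolP (digit k v)) => /= h; last by rewrite addnK.
rewrite subnK//; move: h; rewrite /digit; case: leqP => // vk.
by rewrite divn_small.
Qed.

Lemma flip_digit_lt k K v : k < K -> v < 2 ^ K -> flip_digit k v < 2 ^ K.
Proof.
move=> kK; rewrite !ltnNge; apply: contra => h.
rewrite leqNgt; apply/negP => vK.
have := flip_digit_high v kK; rewrite (divn_small vK) => /eqP.
by rewrite -leqn0 leqNgt divn_gt0 ?expn_gt0// h.
Qed.

(* The partial sums [\sum_(j <= v) (-1) ^ digit k j]. *)
Definition tent k v :=
  if v %% 2 ^ k.+1 < 2 ^ k then (v %% 2 ^ k.+1).+1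
  else 2 ^ k.+1 - (v %% 2 ^ k.+1).+1.

Lemma tent_le k v : tent k v <= 2 ^ k.
Proof. by rewrite /tent; case: ltnP => //; rewrite expnS; lia. Qed.

Lemma digit_mod k v : digit k v = (2 ^ k <= v %% 2 ^ k.+1).
Proof.
rewrite {1}(divn_eq v (2 ^ k.+1)) /digit expnS mulnA divnMDl ?expn_gt0//.
rewrite oddD oddM /= andbF /=.
set r := v %% _; have rlt : r < 2 * 2 ^ k by rewrite /r ltn_pmod -?expnS ?expn_gt0.
case: leqP => h; last by rewrite divn_small.
have -> : r = 1 * 2 ^ k + (r - 2 ^ k) by rewrite mul1n subnKC.
by rewrite divnMDl ?expn_gt0// divn_small//; lia.
Qed.

(** The signs in a block of length [2 ^ k.+1] add up to 0, so the tent is back at 0 at the last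
    point: no mass crosses the end of a block. *)
Lemma tent_last k v : 2 ^ k.+1 %| v.+1 -> tent k v = 0.
Proof.
move=> dv; have : v %% 2 ^ k.+1 = (2 ^ k.+1).-1.
  have := ltn_pmod v (expn_gt0 2 k.+1 : 0 < 2 ^ k.+1).
  move: dv; rewrite /dvdn {1}(divn_eq v (2 ^ k.+1)) -addnS modnMDl.
  case: (ltnP (v %% 2 ^ k.+1).+1 (2 ^ k.+1)) => [/modn_small->//|].
  by move=> h _ h'; apply/eqP; rewrite -eqSS prednK ?expn_gt0// eqn_leq h h'.
rewrite /tent => ->; have := expn_gt0 2 k; rewrite expnS.
by move: (2 ^ k) => b b0; case: ltnP => h; lia.
Qed.

Lemma tent_first k v : 2 ^ k.+1 %| v -> tent k v = 1 /\ digit k v = false.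
Proof.
move=> /eqP v0; rewrite digit_mod /tent v0 expn_gt0.
by split=> //; rewrite leqn0 expn_eq0.
Qed.

(** The increment of the tent is the sign of the new digit, stated additively because the values are
    natural numbers. *)
Lemma tent_step k v : ~~ (2 ^ k.+1 %| v.+1) ->
  tent k v + ~~ digit k v.+1 = tent k v.+1 + digit k v.+1.
Proof.
move=> /negbTE dv; have mv := ltn_pmod v.+1 (expn_gt0 2 k.+1 : 0 < 2 ^ k.+1).
move: mv; rewrite digit_mod /tent modnS dv expnS.
move: (2 ^ k) (v %% _) => b r; case: ltnP => h1; case: ltnP => h2; case: leqP => h3 //=; lia.
Qed.

End binary_digits.

Section haar.
Context {R : realType} (d K : nat).
Hypothesis d0 : (0 < d)%N.

Definition cells := {ffun 'I_d -> 'I_(2 ^ K)}.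
Implicit Types (x y : cells) (Y : cells -> R) (t : nat).

(* Digit [t = k d + i] is the [k]-th binary digit of coordinate [i]; [box t x]
   consists of the cells agreeing with [x] on all the digits from [t] on. *)
Definition dir t : 'I_d := Ordinal (ltn_pmod t d0).
(** The number of [s < t] with [dir s = j], that is, of digits of coordinate [j] that [box t]
    forgets. *)
Definition shift t (j : 'I_d) : nat := ((t + (d.-1 - j)) %/ d)%N.
Definition box t x y := [forall j, x j %/ 2 ^ shift t j == y j %/ 2 ^ shift t j]%N.
Definition bit t x := digit (t %/ d) (x (dir t)).
Definition sgn t x : R := (-1) ^+ bit t x.

Let rev_lt j : (d.-1 - j < d)%N.
Proof. by rewrite (leq_ltn_trans (leq_subr _ _))// ltn_predL. Qed.

Lemma shiftS t j : shift t.+1 j = ((j == dir t) + shift t j)%N.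
Proof.
rewrite /shift addSn divnS//; congr (_ + _)%N.
have -> : (t + (d.-1 - j)).+1 = (t + (d - j))%N.
  by rewrite -addnS -subSn ?prednK// -ltnS prednK.
suff -> : (d %| t + (d - j))%N = (j == t %% d :> nat)%N by [].
rewrite -[in RHS](modn_small (ltn_ord j)) -[RHS](eqn_modDr (d - j)%N).
by rewrite subnKC ?(ltnW (ltn_ord j))// modnn eq_sym.
Qed.

Lemma shift_dir t : shift t (dir t) = (t %/ d)%N.
Proof.
have h : (t %% d <= d.-1)%N by rewrite -ltnS prednK// ltn_pmod.
rewrite /shift /= {1}(divn_eq t d) -addnA subnKC// divnMDl//.
by rewrite [(d.-1 %/ d)%N]divn_small ?ltn_predL ?addn0.
Qed.

Lemma box_sym t x y : box t x y = box t y x.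
Proof. by apply: eq_forallb => j; rewrite eq_sym. Qed.

Lemma box_trans t x y z : box t x y -> box t y z = box t x z.
Proof. by move=> /forallP xy; apply: eq_forallb => j; rewrite (eqP (xy j)). Qed.

Lemma boxS t x y : box t x y = box t.+1 x y && (bit t x == bit t y).
Proof.
apply/forallP/andP => [b|[/forallP b xy] j].
  split; last by rewrite /bit /digit -shift_dir (eqP (b _)).
  by apply/forallP => j; rewrite shiftS addnC expnD !divnMA (eqP (b j)).
have := b j; rewrite shiftS; case: (j =P dir t) => [->|_ //]; rewrite addnC addn1.
rewrite expnS mulnC !divnMA !divn2 => /eqP hh.
rewrite shift_dir in hh *.
apply/eqP; rewrite -[LHS]odd_double_half -[RHS]odd_double_half hh.
by move: xy; rewrite /bit /digit => /eqP ->.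
Qed.

Lemma box_le t s x y : (t <= s)%N -> box t x y -> box s x y.
Proof.
move=> /subnK <-; elim: (s - t)%N => // n IH b.
by have := IH b; rewrite addSn boxS => /andP[].
Qed.

Lemma box0 x y : box 0 x y = (x == y).
Proof.
have s0 j : shift 0 j = 0%N.
  by rewrite /shift add0n divn_small.
apply/forallP/eqP => [b|-> //]; apply/ffunP => j; apply/val_inj.
by have := b j; rewrite s0 expn0 !divn1 => /eqP.
Qed.

Lemma boxT x y : box (d * K) x y.
Proof.
apply/forallP => j; rewrite /shift mulnC divnMDl// [X in (K + X)%N]divn_small ?addn0.
  by rewrite !divn_small.
by rewrite -[X in (_ < X)%N](prednK d0) ltnS leq_subr.
Qed.

Lemma card_cells : #|{: cells}| = (2 ^ (d * K))%N.
Proof. by rewrite card_ffun !card_ord -expnM mulnC. Qed.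

Definition flip t x : cells :=
  [ffun j => if j == dir t then insubd (x j) (flip_digit (t %/ d) (x j)) else x j].

Lemma flipE t x j : (t < d * K)%N -> flip t x j =
  (if j == dir t then flip_digit (t %/ d) (x j) else x j) :> nat.
Proof.
move=> tK; rewrite ffunE; case: ifP => // _.
by rewrite val_insubd flip_digit_lt// ltn_divLR// mulnC.
Qed.

Lemma flipK t : (t < d * K)%N -> involutive (flip t).
Proof.
move=> tK x; apply/ffunP => j; apply/ord_inj; rewrite !flipE//.
by case: (j == dir t); rewrite ?flip_digitK.
Qed.

Lemma bit_flip t x : (t < d * K)%N -> bit t (flip t x) = ~~ bit t x.
Proof. by move=> tK; rewrite /bit flipE// eqxx digit_flip. Qed.

Lemma sgn_flip t x : (t < d * K)%N -> sgn t (flip t x) = - sgn t x.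
Proof. by move=> tK; rewrite /sgn bit_flip// signrN. Qed.

Lemma box_flip t x : (t < d * K)%N -> box t.+1 x (flip t x).
Proof.
move=> tK; apply/forallP => j; rewrite flipE//; case: (j =P dir t) => [->|_]; last by rewrite eqxx.
by rewrite shiftS eqxx add1n shift_dir flip_digit_high.
Qed.

Lemma card_box t x : (t <= d * K)%N -> #|[pred y | box t x y]| = (2 ^ t)%N.
Proof.
elim: t x => [|t IH] x tK.
  transitivity #|pred1 x|; last exact: card1.
  apply: eq_card => y; rewrite !inE box0.
  by rewrite eq_sym.
rewrite -(cardID [pred y | bit t x == bit t y]) expnS mul2n -addnn.
congr (_ + _)%N.
  by rewrite -(IH x (ltnW tK)); apply: eq_card => y; rewrite !inE [RHS]boxS andbC.
rewrite -(IH (flip t x) (ltnW tK)); apply: eq_card => y; rewrite !inE [RHS]boxS.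
rewrite (box_trans _ (_ : box t.+1 (flip t x) x)); last by rewrite box_sym box_flip.
by rewrite bit_flip// andbC; congr (_ && _); case: (bit t x); case: (bit t y).
Qed.

(** The coefficients are kept as explicit linear forms, so that a bound on a quadratic form turns
    into a bound on the squared norms of rows. *)
Definition haar_row t x y : R := (box t.+1 x y)%:R * sgn t y / 2 ^+ t.+1.

Definition haar t Y x : R := \sum_y haar_row t x y * Y y.

Definition box_mean t Y x : R := (\sum_(y | box t x y) Y y) / 2 ^+ t.

Lemma haar_const t Y x x' : box t.+1 x x' -> haar t Y x = haar t Y x'.
Proof.
move=> b; apply: eq_bigr => y _; rewrite /haar_row.
by rewrite box_sym in b; rewrite (box_trans y b).
Qed.

(** A Haar term is a martingale difference: the mean over a box minus the mean over the box twice as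
    large. Hence the expansion telescopes, from [Y] at [t = 0] to the global mean at [t = d * K]. *)
Lemma haar_mean t Y x : box_mean t Y x - box_mean t.+1 Y x = sgn t x * haar t Y x.
Proof.
rewrite /haar mulr_sumr /box_mean !mulr_suml big_mkcond.
rewrite [X in _ - X]big_mkcond -sumrB; apply: eq_bigr => y _.
rewrite /haar_row boxS; case: (box t.+1 x y) => /=; last by rewrite !mul0r mulr0 subr0.
rewrite /sgn exprS; have := expf_neq0 t (_ : 2 != 0 :> R); rewrite pnatr_eq0 => /(_ isT).
move: (2 ^+ t) => u u0; rewrite mul1r.
by case: (bit t x); case: (bit t y) => /=; rewrite ?expr0 ?expr1; field.
Qed.

Lemma haar_expansion Y x :
  Y x - (\sum_y Y y) / 2 ^+ (d * K) = \sum_(t < d * K) sgn t x * haar t Y x.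
Proof.
under [RHS]eq_bigr do rewrite -haar_mean -opprB.
rewrite sumrN -(big_mkord xpredT (fun t => box_mean t.+1 Y x - box_mean t Y x)).
rewrite telescope_sumr// opprB; congr (_ - _).
  by rewrite /box_mean expr0 divr1 (big_pred1 x)// => y; rewrite box0 eq_sym.
by rewrite /box_mean; congr (_ / _); apply: eq_bigl => y; rewrite boxT.
Qed.

Lemma haar_row_flip t x y : (t < d * K)%N ->
  haar_row t x (flip t y) = - haar_row t x y.
Proof.
move=> tK; rewrite /haar_row sgn_flip// mulrN mulNr; congr (- (_%:R * _ / _)).
have b := box_flip y tK; congr nat_of_bool; apply/idP/idP => bx.
  by rewrite -(box_trans _ bx) box_sym.
by rewrite -(box_trans _ bx).
Qed.

(** Flipping digit [t] reverses the sign of row [t] and leaves row [s] unchanged because [t < s];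
    the sum is its own opposite. *)
Lemma haar_row_orthogonal t s x : (t < s)%N -> (s < d * K)%N ->
  \sum_y haar_row t x y * haar_row s x y = 0.
Proof.
move=> ts sK; have tK := ltn_trans ts sK; set S := \sum_y _.
suff : S = - S by lra.
rewrite {1}/S (reindex_inj (can_inj (flipK tK))) -sumrN; apply: eq_bigr => y _.
rewrite haar_row_flip// mulNr; congr (- (_ * _)).
have b : box s y (flip t y) by exact: box_le ts (box_flip y tK).
have b1 : box s.+1 y (flip t y) by exact: box_le b.
rewrite /haar_row /sgn; congr (_%:R * _ / _).
  congr nat_of_bool; apply/idP/idP => bx; last by rewrite -(box_trans _ bx).
  by rewrite -(box_trans _ bx) box_sym.
by move: b; rewrite boxS => /andP[_ /eqP ->].
Qed.

Lemma haar_row_norm t x : (t < d * K)%N ->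
  \sum_y haar_row t x y ^+ 2 = (2 ^+ t.+1)^-1.
Proof.
move=> tK; transitivity (\sum_(y | box t.+1 x y) (2 ^+ t.+1) ^-2 : R).
  rewrite [RHS]big_mkcond; apply: eq_bigr => y _; rewrite /haar_row.
  case: ifP => _; last by rewrite !mul0r expr0n.
  by rewrite mul1r expr_div_n sqrr_sign mul1r.
by rewrite sumr_const card_box// -[LHS]mulr_natl natrX expr2 invfM mulrA divff ?mul1r.
Qed.

Lemma haar_rows_norm (c : nat -> R) (Q : pred nat) x :
  \sum_y (\sum_(t < d * K | Q t) c t * haar_row t x y) ^+ 2 =
  \sum_(t < d * K | Q t) c t ^+ 2 / 2 ^+ t.+1.
Proof.
under eq_bigr do rewrite expr2 mulr_suml.
rewrite exchange_big/=; apply: eq_bigr => t Qt.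
under eq_bigr do rewrite mulr_sumr.
rewrite exchange_big/= (bigD1 t)//= [X in _ + X]big1 ?addr0.
  rewrite -(haar_row_norm x (ltn_ord t)) mulr_sumr; apply: eq_bigr => y _; ring.
move=> s /andP[_ st].
transitivity (c t * c s * \sum_y haar_row t x y * haar_row s x y).
  by rewrite mulr_sumr; apply: eq_bigr => y _; ring.
have [ts|ts|/val_inj ts] := ltngtP t s.
- by rewrite haar_row_orthogonal// mulr0.
- under eq_bigr do rewrite mulrC.
  by rewrite haar_row_orthogonal// mulr0.
- by rewrite ts eqxx in st.
Qed.

End haar.

(** * Elementary inequalities *)

Lemma powRD_le {R : realType} (a b p : R) : 0 <= a -> 0 <= b -> 0 < p <= 1 ->
  (a + b) `^ p <= a `^ p + b `^ p.
Proof.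
move=> a0 b0 /andP[p0 p1].
have [->|an0] := eqVneq a 0; first by rewrite add0r lerDr powR_ge0.
have [->|bn0] := eqVneq b 0; first by rewrite addr0 lerDl powR_ge0.
have s0 : 0 < a + b by rewrite ltr_wpDr// lt_def an0.
(* The fraction [x / (a + b)] is at most its own p-th power, and the fractions of [a] and [b] add up
   to 1. *)
have frac x : 0 < x -> x <= a + b -> (a + b) `^ p * (x / (a + b)) <= x `^ p.
  move=> x0 xs.
  apply: (@le_trans _ _ ((a + b) `^ p * (x / (a + b)) `^ p)).
    by rewrite ler_wpM2l ?powR_ge0// ger1_powR// divr_gt0//= ler_pdivrMr// mul1r.
  rewrite -powRM ?(ltW s0) ?divr_ge0 ?(ltW x0) ?(ltW s0)//.
  by rewrite mulrCA divff ?mulr1// gt_eqF.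
have := lerD (frac a _ _) (frac b _ _).
rewrite -mulrDr -mulrDl divff ?gt_eqF// mulr1; apply;
  by rewrite ?lerDl ?lerDr// lt_def ?an0 ?bn0.
Qed.

(** Lagrange's identity: the difference of the two sides is half the sum of
    [c i * c j * (z i - z j) ^+ 2]. *)
Lemma sqr_wsum_le {R : realFieldType} {I : finType} (c z : I -> R) :
  (forall i, 0 <= c i) ->
  (\sum_i c i * z i) ^+ 2 <= (\sum_i c i) * \sum_i c i * z i ^+ 2.
Proof.
move=> c0; rewrite -subr_ge0.
have -> : (\sum_i c i) * (\sum_i c i * z i ^+ 2) - (\sum_i c i * z i) ^+ 2 =
    (\sum_i \sum_j c i * c j * (z i - z j) ^+ 2) / 2.
  pose A := \sum_i \sum_j c i * (c j * z j ^+ 2).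
  pose B := \sum_i \sum_j (c i * z i) * (c j * z j).
  have EA : A = (\sum_i c i) * (\sum_i c i * z i ^+ 2).
    by rewrite mulr_suml; apply: eq_bigr => i _; rewrite mulr_sumr.
  have EB : B = (\sum_i c i * z i) ^+ 2.
    by rewrite expr2 mulr_suml; apply: eq_bigr => i _; rewrite mulr_sumr.
  have EA' : A = \sum_i \sum_j c j * (c i * z i ^+ 2) by exact: exchange_big.
  rewrite -EA -EB.
  suff -> : \sum_i \sum_j c i * c j * (z i - z j) ^+ 2 = A + A - 2 * B by field.
  rewrite {1}/A EA' mulr_sumr -big_split/= -sumrB; apply: eq_bigr => i _.
  rewrite mulr_sumr -big_split/= -sumrB; apply: eq_bigr => j _; ring.
by rewrite divr_ge0//; do 2![apply: sumr_ge0 => ? _]; rewrite mulr_ge0 ?sqr_ge0// mulr_ge0.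
Qed.

Lemma sqr_sum_le {R : realFieldType} {I : finType} (z : I -> R) :
  (\sum_i z i) ^+ 2 <= #|I|%:R * \sum_i z i ^+ 2.
Proof.
have := @sqr_wsum_le R I (fun=> 1) z (fun=> ler01).
have E (u : I -> R) : \sum_i 1 * u i = \sum_i u i by apply: eq_bigr => i _; rewrite mul1r.
by rewrite /= !E sumr_const.
Qed.

(** * Flows on the dyadic grid *)

Section grid_flows.
Context {R : realType} (d K : nat).
Hypothesis d0 : (0 < d)%N.
Let C := cells d K.
Implicit Types (x y : C) (Y : C -> R).

Definition dist1 x y : R := \sum_j `|(x j)%:R - (y j)%:R|.

Lemma dist1_ge0 x y : 0 <= dist1 x y. Proof. exact: sumr_ge0. Qed.

Lemma dist1xx x : dist1 x x = 0.
Proof. by apply: big1 => j _; rewrite subrr normr0. Qed.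

Lemma dist1C x y : dist1 x y = dist1 y x.
Proof. by apply: eq_bigr => j _; rewrite distrC. Qed.

Lemma dist1_triangle x y z : dist1 x z <= dist1 x y + dist1 y z.
Proof. by rewrite -big_split; apply: ler_sum => j _; exact: ler_distD. Qed.

Lemma dist1_le x y : dist1 x y <= d%:R * 2 ^+ K.
Proof.
apply: (@le_trans _ _ (\sum_(j < d) 2 ^+ K)); last first.
  by rewrite sumr_const card_ord -[leLHS]mulr_natl.
have le z j : ((z : C) j)%:R <= 2 ^+ K :> R by rewrite -natrX ler_nat ltnW.
apply: ler_sum => j _; rewrite ler_norml.
have := le x j; have := le y j; have := ler0n R (x j); have := ler0n R (y j); lra.
Qed.

(** Cyclic, so that [prev] is an inverse; by [grid_flow_top] the edge closing the cycle carries no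
    flow, so mass never wraps around. *)
Definition next (i : 'I_d) x : C := [ffun j => if j == i then ordS (x j) else x j].
Definition prev (i : 'I_d) x : C := [ffun j => if j == i then ord_pred (x j) else x j].

Lemma nextK i : cancel (next i) (prev i).
Proof. by move=> x; apply/ffunP => j; rewrite !ffunE; case: eqP; rewrite ?ordSK. Qed.

Lemma prevK i : cancel (prev i) (next i).
Proof. by move=> x; apply/ffunP => j; rewrite !ffunE; case: eqP; rewrite ?ord_predK. Qed.

(* The mass flowing into [x] from [next i x]. *)
Definition grid_flow Y (i : 'I_d) x : R :=
  \sum_(t < d * K | dir d0 t == i) (tent (t %/ d) (x i))%:R * haar d0 t Y x.

Lemma pow2_dvd_cells t : (t < d * K)%N -> (2 ^ (t %/ d).+1 %| 2 ^ K)%N.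
Proof. by move=> tK; rewrite dvdn_exp2l// ltn_divLR// mulnC. Qed.

(** Inside a block, [prev] stays in the same box, so the Haar coefficient is unchanged and the tent
    has increment [sgn]. At the first cell of a block the previous cell may lie in another box, but
    [tent_last] removes its term. *)
Lemma grid_flow_step t Y x : (t < d * K)%N ->
  (tent (t %/ d) (x (dir d0 t)))%:R * haar d0 t Y x -
  (tent (t %/ d) (prev (dir d0 t) x (dir d0 t)))%:R * haar d0 t Y (prev (dir d0 t) x) =
  sgn d0 t x * haar d0 t Y x.
Proof.
move=> tK; set i := dir d0 t; set k := (t %/ d)%N.
have kK := pow2_dvd_cells tK.
have pE : prev i x i = ((x i + 2 ^ K).-1 %% 2 ^ K)%N :> nat by rewrite ffunE eqxx.
have xp : ((x i).-1 < 2 ^ K)%N by rewrite (leq_ltn_trans (leq_pred _)).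
have [dv|ndv] := boolP (2 ^ k.+1 %| x i)%N.
  have [t1 b0] := tent_first dv; rewrite t1 /sgn /bit b0 expr0 tent_last ?mul0r ?subr0//.
  (* For [x i = 0] the previous index wraps to [2 ^ K - 1], again the last of a block since
     [2 ^ k.+1] divides [2 ^ K]. *)
  rewrite pE; case: (posnP (x i)) => [->|x0].
    by rewrite add0n modn_small prednK ?expn_gt0.
  by rewrite -[X in (X + _)%N](prednK x0) addSn /= modnDr (modn_small xp) prednK.
have x0 : (0 < x i)%N by rewrite lt0n; apply: contraNneq ndv => ->; rewrite dvdn0.
have {}pE : prev i x i = (x i).-1 :> nat.
  by rewrite pE -[X in (X + _)%N](prednK x0) addSn /= modnDr (modn_small xp).
have -> : haar d0 t Y (prev i x) = haar d0 t Y x.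
  apply: haar_const; apply/forallP => j.
  have [->|ji] := eqVneq j i; last by rewrite ffunE (negbTE ji).
  rewrite (shiftS d0) eqxx add1n (shift_dir d0) pE.
  by rewrite -[in X in _ == X](prednK x0) divnS ?expn_gt0// prednK// (negbTE ndv).
rewrite -mulrBl; congr (_ * _); rewrite pE /sgn /bit -/i -/k.
have := @tent_step k (x i).-1; rewrite prednK// => /(_ ndv) /(congr1 (fun n => n%:R : R)).
by rewrite !natrD; case: (digit k (x i)); rewrite /= ?expr0 ?expr1; lra.
Qed.

Lemma grid_flow_div Y x : \sum_i (grid_flow Y i x - grid_flow Y i (prev i x)) =
  Y x - (\sum_y Y y) / 2 ^+ (d * K).
Proof.
rewrite haar_expansion; under eq_bigr do rewrite -sumrB.
rewrite (exchange_big_dep xpredT)//=; apply: eq_bigr => t _.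
by rewrite (big_pred1 (dir d0 t))//= grid_flow_step.
Qed.

Lemma grid_flow_top Y i x : (x i).+1 = (2 ^ K)%N -> grid_flow Y i x = 0.
Proof.
move=> xK; apply: big1 => t _; rewrite tent_last ?mul0r// xK.
exact: pow2_dvd_cells.
Qed.

Definition flow_row (i : 'I_d) x y : R :=
  \sum_(t < d * K | dir d0 t == i) (tent (t %/ d) (x i))%:R * haar_row d0 t x y.

Lemma grid_flowE Y i x : grid_flow Y i x = \sum_y flow_row i x y * Y y.
Proof.
under eq_bigr do rewrite mulr_suml; rewrite exchange_big; apply: eq_bigr => t _.
by rewrite mulr_sumr; apply: eq_bigr => y _; rewrite mulrA.
Qed.

(** Orthogonality of the Haar rows leaves only squares; each [t] contributes to the single direction
    [dir t], with a tent of height at most [2 ^ (t %/ d)]. *)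
Lemma flow_rows_norm x : \sum_i \sum_y flow_row i x y ^+ 2 <=
  \sum_(t < d * K) 4 ^+ (t %/ d) / 2 ^+ t.+1.
Proof.
under eq_bigr do rewrite (haar_rows_norm d0 (fun t => (tent (t %/ d) (x _))%:R)
  (fun t => dir d0 t == _)).
rewrite (exchange_big_dep xpredT)//=; apply: ler_sum => t _.
rewrite (big_pred1 (dir d0 t))//=; rewrite ler_wpM2r ?invr_ge0 ?exprn_ge0//.
by rewrite -!natrX ler_nat -[4%N]/(2 ^ 2)%N expnAC leq_sqr tent_le.
Qed.

Section plans.
Variables (q theta : R) (nu Y : C -> R).
Hypothesis q1 : 1 <= q.
Hypothesis theta01 : 0 <= theta <= 1.
Hypothesis nu0 : forall x, 0 <= nu x.
Hypothesis nuE : forall x, nu x = q + theta * (Y x - (\sum_y Y y) / 2 ^+ (d * K)).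

Let theta0 : 0 <= theta. Proof. by case/andP: theta01. Qed.
Let theta1 : theta <= 1. Proof. by case/andP: theta01. Qed.

Lemma grid_plan_sqr : exists2 M, is_plan (fun=> q) nu M &
  plan_cost (fun x y => dist1 x y ^+ 2) M <=
  13 * (2 ^+ (d * K) + 12 * d%:R * \sum_x \sum_i grid_flow Y i x ^+ 2).
Proof.
pose src (e : 'I_d * C) := next e.1 e.2.
pose dst (e : 'I_d * C) := e.2.
pose f (e : 'I_d * C) := theta * grid_flow Y e.1 e.2.
have srcE (g : 'I_d * C -> R) y :
    \sum_(e | src e == y) g e = \sum_i g (i, prev i y).
  rewrite big_mkcond; transitivity (\sum_i \sum_x if src (i, x) == y then g (i, x) else 0).
    by rewrite pair_big; apply: eq_bigr => -[].
  apply: eq_bigr => i _; rewrite -big_mkcond/= (big_pred1 (prev i y))// => x /=.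
  by rewrite /src /= (can2_eq (@nextK i) (@prevK i)).
have dstE (g : 'I_d * C -> R) y : \sum_(e | dst e == y) g e = \sum_i g (i, y).
  rewrite big_mkcond; transitivity (\sum_i \sum_x if dst (i, x) == y then g (i, x) else 0).
    by rewrite pair_big; apply: eq_bigr => -[].
  by apply: eq_bigr => i _; rewrite -big_mkcond/= (big_pred1 y).
have nuE' y : nu y = q + net_flow src dst f y.
  rewrite nuE -grid_flow_div /net_flow srcE dstE -sumrB mulr_sumr; congr (_ + _).
  by apply: eq_bigr => i _; rewrite /f /= mulrBr.
have f1 e : f e != 0 -> dist1 (src e) (dst e) <= 1.
  case: e => i x fn0; rewrite /dist1 (bigD1 i)//= big1 ?addr0; last first.
    by move=> j ji; rewrite ffunE (negbTE ji) subrr normr0.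
  rewrite ffunE eqxx /=; have xK : ((x i).+1 < 2 ^ K)%N.
    rewrite ltn_neqAle ltn_ord andbT; apply: contra_neq fn0 => xK.
    by rewrite /f /= grid_flow_top ?mulr0.
  by rewrite modn_small// -natr1 addrAC subrr add0r normr1.
have [M pM cM] := exchange_plan_sqr (lt_le_trans ltr01 q1) nu0 nuE' dist1_ge0
  dist1xx dist1C dist1_triangle q1 f1.
exists M => //; apply: (le_trans cM); rewrite ler_wpM2l// big_split/=.
rewrite sumr_const card_cells natrX lerD2l -mulr_sumr.
(* Cauchy-Schwarz over the directions and over the two edges in each gives [2 * d]. Summing over [y]
   counts every edge at both ends, and the factor 3 of [exchange_plan_sqr] then makes [12 * d]. *)
have thr y : throughput src dst f y ^+ 2 <=
    2 * d%:R * (\sum_i grid_flow Y i (prev i y) ^+ 2 + \sum_i grid_flow Y i y ^+ 2).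
  rewrite /throughput srcE dstE -big_split/=.
  apply: (le_trans (sqr_sum_le _)); rewrite card_ord -mulrA mulrCA ler_wpM2l//.
  rewrite -big_split/= mulr_sumr; apply: ler_sum => i _.
  have fF z : `|f (i, z)| ^+ 2 <= grid_flow Y i z ^+ 2.
    rewrite real_normK ?num_real// /f /= exprMn ler_piMl ?sqr_ge0//.
    by rewrite expr_le1.
  have := fF y; have := fF (prev i y).
  by have := sqr_ge0 (`|f (i, prev i y)| - `|f (i, y)|); nra.
have sumF : \sum_y \sum_i grid_flow Y i (prev i y) ^+ 2 = \sum_y \sum_i grid_flow Y i y ^+ 2.
  rewrite exchange_big [RHS]exchange_big; apply: eq_bigr => i _ /=.
  by rewrite [RHS](reindex_inj (can_inj (@prevK i))).
apply: (@le_trans _ _ (3 * \sum_y (2 * d%:R * (\sum_i grid_flow Y i (prev i y) ^+ 2 + \sum_i grid_flow Y i y ^+ 2)))).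
  by rewrite ler_wpM2l// ler_sum.
by rewrite -mulr_sumr big_split/= sumF; set S := \sum_y _; lra.
Qed.

(** Mass jumps directly between [x] and [flip t x], whose distance is exactly [2 ^ (t %/ d)]. *)
Lemma grid_plan_powR (p : R) : 0 < p <= 1 -> exists2 M, is_plan (fun=> q) nu M &
  plan_cost (fun x y => dist1 x y `^ p) M <=
  12 * \sum_(t < d * K) \sum_x (2 ^+ (t %/ d)) `^ p * `|haar d0 t Y x| + 1.
Proof.
move=> p01; have /andP[p0 _] := p01.
pose src (e : 'I_(d * K) * C) := flip d0 e.1 e.2.
pose dst (e : 'I_(d * K) * C) := e.2.
(* The cells [x] and [flip t x] are joined by two edges, one indexed by each of them, hence the
   factor 1/2. *)
pose f (e : 'I_(d * K) * C) := theta / 2 * (sgn d0 e.1 e.2 * haar d0 e.1 Y e.2).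
have srcE (g : 'I_(d * K) * C -> R) y :
    \sum_(e | src e == y) g e = \sum_(t < d * K) g (t, flip d0 t y).
  rewrite big_mkcond; transitivity (\sum_i \sum_x if src (i, x) == y then g (i, x) else 0).
    by rewrite pair_big; apply: eq_bigr => -[].
  apply: eq_bigr => t _; rewrite -big_mkcond/= (big_pred1 (flip d0 t y))// => x /=.
  by rewrite /src /= (can2_eq (flipK d0 (ltn_ord t)) (flipK d0 (ltn_ord t))).
have dstE (g : 'I_(d * K) * C -> R) y : \sum_(e | dst e == y) g e = \sum_t g (t, y).
  rewrite big_mkcond; transitivity (\sum_i \sum_x if dst (i, x) == y then g (i, x) else 0).
    by rewrite pair_big; apply: eq_bigr => -[].
  by apply: eq_bigr => i _; rewrite -big_mkcond/= (big_pred1 y).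
have nuE' y : nu y = q + net_flow src dst f y.
  rewrite nuE (haar_expansion d0) /net_flow srcE dstE -sumrB mulr_sumr; congr (_ + _).
  apply: eq_bigr => t _; rewrite /f /= sgn_flip//.
  by rewrite (haar_const d0 Y (box_flip d0 y (ltn_ord t))); field.
pose k x y := dist1 x y `^ p.
have kxx x : k x x = 0 by rewrite /k dist1xx powR0// gt_eqF.
have kC x y : k x y = k y x by rewrite /k dist1C.
have kT x y z : k x z <= k x y + k y z.
  apply: (@le_trans _ _ ((dist1 x y + dist1 y z) `^ p)).
    by rewrite ge0_ler_powR ?nnegrE ?addr_ge0 ?dist1_ge0 ?dist1_triangle// ltW.
  exact: powRD_le (dist1_ge0 _ _) (dist1_ge0 _ _) p01.
have [M pM cM] := exchange_plan_metric (lt_le_trans ltr01 q1) nu0 nuE'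
  (fun x y => powR_ge0 _ _ : 0 <= k x y) kxx kC kT ltr01.
exists M => //; apply: (le_trans cM); rewrite lerD2r ler_wpM2l//.
rewrite pair_big/=; apply: ler_sum => -[t x] _ /=.
have -> : k (src (t, x)) (dst (t, x)) = (2 ^+ (t %/ d)) `^ p.
  rewrite /k /dist1 (bigD1 (dir d0 t))//= big1 ?addr0; last first.
    by move=> j jt; rewrite flipE// (negbTE jt) subrr normr0.
  rewrite flipE// eqxx; congr (_ `^ _); rewrite /flip_digit; case: ifP => h.
    rewrite natrB ?natrX; last first.
      by move: h; rewrite /digit; case: leqP => // /divn_small ->.
    by rewrite addrAC subrr add0r normrN ger0_norm// exprn_ge0.
  by rewrite natrD natrX addrAC subrr add0r ger0_norm// exprn_ge0.
rewrite mulrC ler_wpM2l ?powR_ge0// /f /= (normrM (theta / 2)) (normrM (sgn _ _ _)) normr_sign mul1r.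
rewrite ler_piMl// ger0_norm ?divr_ge0//.
by rewrite ler_pdivrMr// mul1r (le_trans theta1)// ler1n.
Qed.

End plans.
End grid_flows.

(** * Normalisation by the random total mass *)

Section normalised_plans.
Context {R : realType} (d K : nat).
Hypothesis d0 : (0 < d)%N.
Let C := cells d K.
Variables (n v q : R) (m nu : C -> R).
Hypothesis v2 : 2 <= v.
Hypothesis q1 : 1 <= q.
Hypothesis qE : n = q * 2 ^+ (d * K).
Hypothesis m0 : forall x, 0 <= m x.
Hypothesis nu0 : forall x, 0 <= nu x.
Hypothesis sum_nu : \sum_x nu x = n.
Hypothesis nuE : \sum_x m x != 0 -> forall x, nu x = n / (\sum_x m x) * m x.

Let X x := m x - v * q.
Let S := \sum_x X x.

Let n0 : 0 < n.
Proof. by rewrite qE mulr_gt0 ?exprn_gt0// (lt_le_trans ltr01). Qed.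

Let SE : S = \sum_x m x - v * n.
Proof.
by rewrite /S sumrB sumr_const card_cells -[X in _ - X]mulr_natr natrX -mulrA -qE.
Qed.

(** The factor is [theta = n / N] for the total mass N, at most 1 because [2 <= v]. Subtracting the
    mean of [X] accounts exactly for the fluctuation of N. *)
Let good : v * n / 2 <= \sum_x m x -> exists2 theta, 0 <= theta <= 1 &
  forall x, nu x = q + theta * (X x - (\sum_y X y) / 2 ^+ (d * K)).
Proof.
move=> h; have N0 : 0 < \sum_x m x.
  by apply: lt_le_trans h; rewrite divr_gt0// mulr_gt0// (lt_le_trans _ v2).
exists (n / (\sum_x m x)) => [|x].
  rewrite divr_ge0 ?(ltW n0) ?(ltW N0)//= ler_pdivrMr// mul1r (le_trans _ h)//.
  by rewrite ler_pdivlMr// mulrC ler_wpM2r// ltW.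
rewrite nuE ?gt_eqF// -/S SE /X qE; field.
by rewrite expf_neq0 ?pnatr_eq0//= gt_eqF.
Qed.

(** If the costs are at most D, any plan costs at most n D; here this is below both D S^2 / n and D
    |S|, so the product plan is good enough. *)
Let bad : \sum_x m x < v * n / 2 -> n <= `|S|.
Proof.
move=> h; rewrite SE ler_normr; apply/orP; right.
have ? : 0 <= (v - 2) * n by rewrite mulr_ge0 ?subr_ge0// ltW.
by have := n0; move: h; rewrite ltr_pdivlMr// opprB; lra.
Qed.

Let product_plan (k : C -> C -> R) D : (forall x y, k x y <= D) ->
  exists2 M, is_plan (fun=> q) nu M & plan_cost k M <= n * D.
Proof.
move=> kD; have c0 : 2 ^+ (d * K) != 0 :> R by rewrite expf_neq0// pnatr_eq0.
have p : is_plan (fun=> q) nu (fun _ y => nu y / 2 ^+ (d * K)).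
  split=> [x y|x|y]; first by rewrite divr_ge0// exprn_ge0.
    by rewrite -mulr_suml sum_nu qE mulfK.
  by rewrite sumr_const card_cells -[LHS]mulr_natr natrX divfK.
eexists; first exact: p.
apply: (@le_trans _ _ (\sum_(x : C) \sum_y nu y / 2 ^+ (d * K) * D)).
  do 2![apply: ler_sum => ? _].
  by rewrite ler_wpM2l// divr_ge0// exprn_ge0.
under eq_bigr do rewrite -!mulr_suml sum_nu.
by rewrite sumr_const card_cells -[leLHS]mulr_natr natrX mulrAC divfK.
Qed.

Lemma normalised_plan_sqr : exists2 M, is_plan (fun=> q) nu M &
  plan_cost (fun x y => dist1 x y ^+ 2) M <=
  13 * (2 ^+ (d * K) + 12 * d%:R * \sum_x \sum_i grid_flow d0 X i x ^+ 2)
  + (d%:R * 2 ^+ K) ^+ 2 * (S ^+ 2 / n).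
Proof.
have F0 : 0 <= 13 * (2 ^+ (d * K) + 12 * d%:R * \sum_x \sum_i grid_flow d0 X i x ^+ 2).
  rewrite mulr_ge0// addr_ge0 ?exprn_ge0// mulr_ge0 ?mulr_ge0//.
  by do 2![apply: sumr_ge0 => ? _]; rewrite sqr_ge0.
have [/good[theta theta01 nuE']|/bad nS] := leP (v * n / 2) (\sum_x m x).
  have [M pM cM] := grid_plan_sqr d0 q1 theta01 nu0 nuE'.
  exists M => //; apply: (le_trans cM); rewrite lerDl.
  by rewrite mulr_ge0 ?sqr_ge0// divr_ge0 ?sqr_ge0// ltW.
have [x y|M pM cM] := @product_plan (fun x y => dist1 x y ^+ 2) ((d%:R * 2 ^+ K) ^+ 2).
  by rewrite ler_sqr ?nnegrE ?dist1_ge0 ?dist1_le// mulr_ge0 ?exprn_ge0.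
exists M => //; apply: (le_trans cM); rewrite -[leLHS]add0r; apply: lerD => //.
rewrite mulrC ler_wpM2l ?sqr_ge0// ler_pdivlMr// -expr2 -[X in _ <= X]real_normK ?num_real//.
by rewrite ler_sqr ?nnegrE// ltW.
Qed.

Lemma normalised_plan_powR (p : R) : 0 < p <= 1 -> exists2 M, is_plan (fun=> q) nu M &
  plan_cost (fun x y => dist1 x y `^ p) M <=
  1 + 12 * (\sum_(t < d * K) \sum_x (2 ^+ (t %/ d)) `^ p * `|haar d0 t X x|)
  + (d%:R * 2 ^+ K) `^ p * `|S|.
Proof.
move=> p01; have /andP[p0 _] := p01.
have F0 : 0 <= 12 * (\sum_(t < d * K) \sum_x (2 ^+ (t %/ d)) `^ p * `|haar d0 t X x|).
  rewrite mulr_ge0//.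
  by do 2![apply: sumr_ge0 => ? _]; rewrite mulr_ge0// powR_ge0.
have [/good[theta theta01 nuE']|/bad nS] := leP (v * n / 2) (\sum_x m x).
  have [M pM cM] := grid_plan_powR d0 q1 theta01 nu0 nuE' p01.
  exists M => //; apply: (le_trans cM); rewrite addrC lerDl.
  by rewrite mulr_ge0// powR_ge0.
have [x y|M pM cM] := @product_plan (fun x y => dist1 x y `^ p) ((d%:R * 2 ^+ K) `^ p).
  by rewrite ge0_ler_powR ?nnegrE ?dist1_ge0 ?dist1_le ?(ltW p0)// mulr_ge0 ?exprn_ge0.
exists M => //; apply: (le_trans cM); rewrite -[leLHS]add0r; apply: lerD.
  by rewrite addr_ge0.
by rewrite mulrC ler_wpM2l ?powR_ge0.
Qed.

End normalised_plans.

(** * Finite sums, comparison and partitions for measures *)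

Section measure_tools.
Context {R : realType}.
Local Open Scope ereal_scope.
Import HBNNSimple.

Lemma exists_measure_sum d (T : measurableType d) (I : finType)
    (m : I -> {measure set T -> \bar R}) :
  exists M : {measure set T -> \bar R}, forall A, M A = \sum_i m i A.
Proof.
suff H (s : seq I) : exists M : {measure set T -> \bar R},
    forall A, M A = \sum_(i <- s) m i A by exact: H.
elim: s => [|i s [M ME]].
  by exists [the {measure set T -> \bar R} of mzero] => A; rewrite big_nil.
exists [the {measure set T -> \bar R} of measure_add (m i) M] => A.
by rewrite [LHS]measure_addE big_cons ME.
Qed.

(* Neither function has to be measurable: the integral of a non-negative
   function is a supremum over the simple functions below it. *)
Lemma le_integral_nonneg d (T : measurableType d) (mu : {measure set T -> \bar R})
    (D : set T) (f g : T -> \bar R) :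
  (forall x, D x -> 0 <= f x) -> (forall x, D x -> f x <= g x) ->
  \int[mu]_(x in D) f x <= \int[mu]_(x in D) g x.
Proof.
move=> f0 fg; rewrite !ge0_integralE//; last first.
  by move=> x Dx; exact: le_trans (f0 _ Dx) (fg _ Dx).
apply: ge_ereal_sup => _ [h hf <-]; apply: ereal_sup_ubound.
exists h => // x; apply: (le_trans (hf x)).
by rewrite /patch; case: ifPn => [/set_mem /fg|].
Qed.

Lemma measure_partition d (T : measurableType d) (I : finType)
    (mu : {measure set T -> \bar R}) (Q : I -> set T) (A : set T) :
  (forall i, measurable (Q i)) -> measurable A ->
  (forall i j x, Q i x -> Q j x -> i = j) -> (A `<=` \bigcup_i Q i)%classic ->
  mu A = \sum_i mu (A `&` Q i).
Proof.
move=> mQ mA tQ AQ.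
have AE : A = \bigcup_(i in [set: I]) (A `&` Q i).
  apply/seteqP; split => [x Ax|x [i _ []//]].
  by have [i _ Qx] := AQ x Ax; exists i.
rewrite {1}AE measure_fin_bigcup//.
- rewrite [RHS]fsbig_seq ?index_enum_uniq//.
  rewrite (_ : [set` _] = setT); last by apply/seteqP; split => // i _ /=; rewrite mem_index_enum.
  reflexivity.
- exact: finite_finset.
- by move=> i j _ _ [x [[_ Qi] [_ Qj]]]; exact: tQ Qi Qj.
- by move=> i _; exact: measurableI.
Qed.

End measure_tools.

(** * From cell plans to couplings of measures *)

Section boxes.
Context {R : realType} {d : nat}.

Definition obox (a b : 'I_d -> R) : set 'rV[R]_d :=
  [set x | forall i, a i < x ord0 i <= b i].

Lemma measurable_obox a b : measurable (obox a b).
Proof.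
have -> : obox a b = \bigcap_(i in [set: 'I_d]) (rV_coord i @^-1` `]a i, b i]).
  apply/seteqP; split => [x Bx i _ /=|x Bx i]; first by rewrite in_itv; exact: Bx.
  by have /= := Bx i I; rewrite in_itv.
apply: fin_bigcap_measurable; first exact: finite_finset.
move=> i _; rewrite -[X in measurable X]setTI.
by apply: measurable_rV_coord => //; exact: measurable_itv.
Qed.

Lemma bounded_obox a b : bounded_set (obox a b).
Proof.
pose M := \sum_i (`|a i| + `|b i|); exists M; split; first exact: num_real.
move=> x Mx y yb; apply: le_trans (ltW Mx).
have M0 : 0 <= M by apply: sumr_ge0 => i _; rewrite addr_ge0.
rewrite /Num.norm/= mx_normrE; apply/bigmax_leP; split => // -[i j] _ /=.
rewrite (ord1 i) /M (bigD1 j)//=; have /andP[l u] := yb j.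
apply: (@le_trans _ _ (`|a j| + `|b j|)); last first.
  by rewrite lerDl sumr_ge0// => k _; rewrite addr_ge0.
rewrite ler_norml; apply/andP; split.
  by rewrite (le_trans _ (ltW l))// lerNl (le_trans (ler_norm _))// normrN lerDl.
by rewrite (le_trans u)// (le_trans (ler_norm _))// lerDr.
Qed.

End boxes.

Section cells_geometry.
Context {R : realType} (d K n : nat).
Hypothesis d0 : (0 < d)%N.
Hypothesis n0 : (0 < n)%N.
Let C := cells d K.
Implicit Types (x y : C).

Definition mesh : R := 2 * pi * @side R d n / 2 ^+ K.

Let half : R := pi * @side R d n.

Lemma side_gt0 : 0 < @side R d n :> R.
Proof. by rewrite powR_gt0// ltr0n. Qed.

Lemma side_exp : @side R d n ^+ d = n%:R :> R.
Proof.
rewrite -powR_mulrn ?(ltW side_gt0)// /side -powRrM mulVf ?powRr1//.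
by rewrite pnatr_eq0 -lt0n.
Qed.

Lemma mesh_gt0 : 0 < mesh.
Proof. by rewrite divr_gt0 ?exprn_gt0// mulr_gt0 ?side_gt0// mulr_gt0 ?pi_gt0. Qed.

Let mesh_half : mesh * 2 ^+ K = half + half.
Proof.
rewrite /mesh divfK ?expf_neq0 ?pnatr_eq0// /half; ring.
Qed.

Definition lo x (i : 'I_d) : R := - half + mesh * (x i)%:R.
Definition cell x : set 'rV[R]_d := obox (lo x) (fun i => lo x i + mesh).

Lemma measurable_cell x : measurable (cell x).
Proof. exact: measurable_obox. Qed.

Lemma LambdaE : @Lambda R d n = obox (fun=> - half) (fun=> half).
Proof. by []. Qed.

Lemma measurable_Lambda : measurable (@Lambda R d n).
Proof. by rewrite LambdaE; exact: measurable_obox. Qed.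

Lemma bounded_Lambda : bounded_set (@Lambda R d n).
Proof. by rewrite LambdaE; exact: bounded_obox. Qed.

Lemma cell_sub x : cell x `<=` Lambda n.
Proof.
move=> u ux i; have /andP[l r] := ux i; apply/andP; split.
  by apply: le_lt_trans l; rewrite lerDl mulr_ge0 ?(ltW mesh_gt0).
apply: (le_trans r); rewrite /lo -addrA -[X in _ * _ + X]mulr1 -mulrDr natr1.
rewrite addrC lerBlDr -/half -mesh_half ler_wpM2l ?(ltW mesh_gt0)//.
by rewrite -natrX ler_nat.
Qed.

Let sub_cell (t h : R) N : 0 < h -> 0 < t <= h * N%:R ->
  exists2 k, (k < N)%N & h * k%:R < t <= h * k%:R + h.
Proof.
move=> h0; elim: N => [|N IH /andP[t0 tN]].
  by rewrite mulr0 => /andP[t0 /(lt_le_trans t0)]; rewrite ltxx.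
have [tN'|tN'] := leP t (h * N%:R).
  have [|k kN kt] := IH; first by rewrite t0.
  by exists k => //; rewrite ltnS ltnW.
by exists N => //; rewrite tN' (le_trans tN)// -natr1 mulrDr mulr1.
Qed.

Lemma Lambda_cells : Lambda n `<=` \bigcup_x cell x.
Proof.
move=> u uL; have H i : exists k : 'I_(2 ^ K),
    - half + mesh * k%:R < u ord0 i <= - half + mesh * k%:R + mesh.
  have /andP[l r] := uL i.
  have [|k kK /andP[kl kr]] := @sub_cell (u ord0 i + half) mesh (2 ^ K) mesh_gt0.
    by rewrite natrX mesh_half -ltrBlDr sub0r l lerD2r.
  by exists (Ordinal kK) => /=; apply/andP; split; rewrite /=; lra.
have [f fP] := choice H.
by exists [ffun i => f i] => // i; rewrite /lo ffunE; exact: fP.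
Qed.

Lemma cell_inj x y u : cell x u -> cell y u -> x = y.
Proof.
have le z z' : cell z u -> cell z' u -> forall i, (z i <= z' i)%N.
  move=> zu z'u i; have /andP[l _] := zu i; have /andP[_ r] := z'u i.
  have := lt_le_trans l r; rewrite /lo -[X in _ < _ + X]mulr1 -addrA ltrD2l.
  by rewrite -mulrDr natr1 ltr_pM2l ?mesh_gt0// ltr_nat ltnS.
by move=> xu yu; apply/ffunP => i; apply/val_inj/eqP; rewrite eqn_leq !le.
Qed.

Lemma leb_cell x : leb (cell x) = (mesh ^+ d)%:E.
Proof.
rewrite leb_box => [|i]; last by rewrite lerDl ltW ?mesh_gt0.
under eq_bigr do rewrite addrAC subrr add0r.
by rewrite prodr_const card_ord.
Qed.

Lemma mesh_exp : mesh ^+ d = (2 * pi) ^+ d * (n%:R / 2 ^+ (d * K)).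
Proof. by rewrite /mesh expr_div_n exprMn side_exp -exprM mulnC mulrA. Qed.

Lemma toric_dist_ge0 (u v : 'rV[R]_d) : 0 <= toric_dist n u v :> R.
Proof.
by apply: lb_le_inf => [|_ [z _ <-]]; [eexists; exists 0; reflexivity|exact: sqrtr_ge0].
Qed.

Lemma enorm_le (u : 'rV[R]_d) : enorm u <= \sum_i `|u ord0 i|.
Proof.
have S0 : 0 <= \sum_i `|u ord0 i| by exact: sumr_ge0.
rewrite /enorm -[leRHS](ger0_norm S0) -sqrtr_sqr ler_wsqrtr// expr2 mulr_suml.
apply: ler_sum => i _; rewrite -[leLHS]real_normK ?num_real// expr2 ler_wpM2l//.
by rewrite (bigD1 i)//= lerDl sumr_ge0.
Qed.

(** The representative [z = 0] in the infimum suffices, which reduces the toric distance to the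
    Euclidean one. *)
Lemma toric_dist_cells x y (u v : 'rV[R]_d) : cell x u -> cell y v ->
  toric_dist n u v <= mesh * (dist1 x y + d%:R).
Proof.
move=> xu yv; apply: (@le_trans _ _ (enorm (u - v))).
  apply: ge_inf; first by exists 0 => _ [z _ <-]; exact: sqrtr_ge0.
  exists 0 => //; congr enorm; rewrite (_ : map_mx _ _ = 0) ?scaler0 ?addr0//.
  by apply/matrixP => i j; rewrite !mxE.
apply: (le_trans (enorm_le _)); rewrite /dist1.
rewrite -[d in _ + d%:R]card_ord -sumr_const -big_split/= mulr_sumr.
apply: ler_sum => i _; rewrite !mxE.
have /andP[l1 r1] := xu i; have /andP[l2 r2] := yv i.
have : `|u ord0 i - lo x i| <= mesh by rewrite ler_norml; move: mesh_gt0; lra.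
have -> : u ord0 i - v ord0 i = mesh * ((x i)%:R - (y i)%:R) +
  ((u ord0 i - lo x i) - (v ord0 i - lo y i)) by rewrite /lo; ring.
move=> _; apply: (le_trans (ler_normD _ _)); rewrite [leRHS]mulrDr mulr1 lerD//.
  by rewrite normrM ger0_norm// ltW ?mesh_gt0.
by rewrite ler_norml; lra.
Qed.

End cells_geometry.

Section lift_plan.
Context {R : realType} (d K n : nat).
Hypothesis d0 : (0 < d)%N.
Hypothesis n0 : (0 < n)%N.
Let C := cells d K.
Let T := 'rV[R]_d.
Let Q : C -> set T := @cell R d K n.
Let h : R := @mesh R d K n.
Variables (m' : set T -> \bar R) (m : {measure set T -> \bar R}).
Variables (nu : C -> R) (M : C -> C -> R).
Hypothesis mE : forall A, measurable A -> A `<=` Lambda n -> m' A = m A.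
Hypothesis nuE : forall x, m (Q x) = (nu x)%:E.
Let q : R := n%:R / 2 ^+ (d * K).
Hypothesis pM : is_plan (fun=> q) nu M.

Let mQ x : measurable (Q x) := @measurable_cell R d K n x.
Let hd0 : 0 < h ^+ d. Proof. by rewrite exprn_gt0// mesh_gt0. Qed.
Let nu0 x : 0 <= nu x.
Proof. by rewrite -lee_fin -nuE. Qed.
Let M0 x y : 0 <= M x y. Proof. by have [] := pM. Qed.

(** The density of the lifted coupling on [Q x] times [Q y] with respect to the product of [m] and
    Lebesgue measure. The indices of [M] are exchanged because cell plans start from the uniform
    masses, while [coupling] lists [m'] first. *)
Let c (x y : C) : R := M y x / (nu x * h ^+ d).
Let c0 x y : 0 <= c x y.
Proof. by rewrite divr_ge0// mulr_ge0// ltW. Qed.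

Let cE x y : c x y * (nu x * h ^+ d) = M y x.
Proof.
have [nux|nux] := eqVneq (nu x) 0.
  by rewrite nux mul0r mulr0 (plan_col0 _ pM nux).
by rewrite divfK// mulf_neq0// gt_eqF.
Qed.

Let lebQoo x : (leb (Q x) < +oo)%E.
Proof. by rewrite leb_cell// ltry. Qed.

Let pairM (p : C * C) : {measure set (T * T) -> \bar R} :=
  mscale (NngNum (c0 p.1 p.2))
    (mrestr m (mQ p.1) \x mfrestr (mQ p.2) (lebQoo p.2))%E.

Let fin_leb A x : measurable A -> leb (A `&` Q x) = (fine (leb (A `&` Q x)))%:E.
Proof.
move=> mA; rewrite fineK// ge0_fin_numE// (le_lt_trans _ (lebQoo x))//.
by rewrite le_measure ?inE//; exact: measurableI.
Qed.

Let fin_m A x : measurable A -> m (A `&` Q x) = (fine (m (A `&` Q x)))%:E.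
Proof.
move=> mA; rewrite fineK// ge0_fin_numE//.
apply: (@le_lt_trans _ _ (m (Q x))); last by rewrite nuE ltry.
by rewrite le_measure ?inE//; exact: measurableI.
Qed.

Lemma lifted_plan : exists N : {measure set (T * T) -> \bar R},
  forall A B, measurable A -> measurable B ->
    N (A `*` B) = (\sum_x \sum_y (c x y * fine (m (A `&` Q x)) * fine (leb (B `&` Q y)))%:E)%E.
Proof.
have [N NE] := exists_measure_sum pairM.
exists N => A B mA mB; rewrite NE.
rewrite [RHS]pair_big/=; apply: eq_bigr => -[x y] _ /=.
rewrite /mscale/= product_measure1E//.
transitivity ((c x y)%:E * (m (A `&` Q x) * leb (B `&` Q y)))%E; first by [].
by rewrite fin_m// fin_leb// -!EFinM mulrA.
Qed.

Let partition (mu : {measure set T -> \bar R}) A : measurable A -> A `<=` Lambda n ->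
  mu A = (\sum_x mu (A `&` Q x))%E.
Proof.
move=> mA AL; apply: measure_partition => //.
- by move=> x y u; exact: cell_inj.
- by move=> u /AL; exact: Lambda_cells.
Qed.

Let LQ x : Lambda n `&` Q x = Q x.
Proof. by apply/setIidr/cell_sub. Qed.

(** Each mass of the cell plan is spread over a pair of cells as a product measure, which restores
    [m] inside every cell and not only its count. *)
Lemma toric_cost_le_plan (w : R -> R) :
  (forall t, 0 <= t -> 0 <= w t) -> (forall t u, 0 <= t -> t <= u -> w t <= w u) ->
  (toric_cost n w m' (tilde_L n) <=
   (plan_cost (fun x y => w (h * (dist1 x y + d%:R))) M)%:E)%E.
Proof.
move=> w0 wle; have [N NE] := lifted_plan.
have mL := @measurable_Lambda R d n.
have coup : coupling n m' (tilde_L n) N.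
  move=> A mA AL; split.
    rewrite NE// mE// (partition m mA AL); apply: eq_bigr => x _.
    under eq_bigr do rewrite LQ leb_cell//= -/h.
    have := fin_m x mA; set a := fine (m (A `&` Q x)) => mAx.
    rewrite mAx sumEFin; congr EFin.
    transitivity ((\sum_y M y x) * (a / nu x)).
      rewrite mulr_suml; apply: eq_bigr => y _; rewrite -cE.
      have [nux|nux] := eqVneq (nu x) 0; last by field.
      have -> : a = 0; last by rewrite !(mul0r, mulr0).
      apply/eqP; rewrite -eqe -mAx eq_le measure_ge0 andbT -nux -nuE.
      by rewrite le_measure ?inE//; exact: measurableI.
    have [_ _ ->] := pM; have [nux|nux] := eqVneq (nu x) 0; last by field.
    rewrite nux mul0r; apply/esym/eqP; rewrite -eqe -mAx eq_le measure_ge0 andbT -nux -nuE.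
    by rewrite le_measure ?inE//; exact: measurableI.
  rewrite NE// exchange_big/= /tilde_L (setIidl AL) (partition (@leb R d) mA AL).
  rewrite ge0_sume_distrr => [|y _]; last exact: measure_ge0.
  apply: eq_bigr => y _; under eq_bigr do rewrite LQ nuE/=.
  have := fin_leb y mA; set b := fine (leb (A `&` Q y)) => lAy.
  rewrite [X in _ = (_ * X)%E]lAy sumEFin -EFinM; congr EFin.
  transitivity ((\sum_x M y x) * (b / h ^+ d)).
    rewrite mulr_suml; apply: eq_bigr => x _; rewrite -cE; field.
    by rewrite gt_eqF.
  have [_ -> _] := pM; rewrite /h mesh_exp// /q; field.
  have n1 : n%:R != 0 :> R by rewrite pnatr_eq0 -lt0n.
  have p1 : 2 * pi != 0 :> R by rewrite gt_eqF// mulr_gt0 ?pi_gt0.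
  by rewrite n1 !expf_neq0// pnatr_eq0.
have massN x y : N (Q x `*` Q y) = (M y x)%:E.
  rewrite NE// (bigD1 x)//= (bigD1 y)//= !setIid nuE leb_cell//= big1 => [|y' yy']; last first.
    rewrite (_ : Q y `&` Q y' = set0) ?measure0 ?mulr0//.
    apply/seteqP; split => // u [Qu Q'u]; move: yy'.
    by rewrite (cell_inj n0 Q'u Qu) eqxx.
  rewrite adde0 big1 => [|x' xx'].
    by rewrite adde0 -mulrA -/h cE.
  rewrite (_ : Q x `&` Q x' = set0).
    by apply: big1 => y' _; rewrite measure0 mulr0 mul0r.
  apply/seteqP; split => // u [Qu Q'u]; move: xx'.
  by rewrite (cell_inj n0 Q'u Qu) eqxx.
pose W (x y : C) : R := w (h * (dist1 x y + d%:R)).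
have W0 x y : 0 <= W x y.
  by apply: w0; rewrite mulr_ge0 ?(ltW (mesh_gt0 _ _ _))// addr_ge0 ?dist1_ge0.
(* The cost is dominated by a step function, constant on pairs of cells, whose integral follows from
   [massN]; [le_integral_nonneg] permits this without measurability of [toric_dist]. *)
pose G (z : T * T) : \bar R :=
  (\sum_(p : C * C) (W p.2 p.1)%:E * (\1_(Q p.1 `*` Q p.2) z)%:E)%E.
apply: (@le_trans _ _ (\int[N]_(z in Lambda n `*` Lambda n)
    (w (toric_dist n z.1 z.2))%:E)%E).
  by apply: ereal_inf_lbound; exists N.
apply: (@le_trans _ _ (\int[N]_(z in Lambda n `*` Lambda n) G z)%E).
  apply: le_integral_nonneg => [z _|[u v] [/= uL vL]].
    by rewrite lee_fin w0// toric_dist_ge0.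
  have [x _ xu] := @Lambda_cells R d K n n0 _ uL.
  have [y _ yv] := @Lambda_cells R d K n n0 _ vL.
  rewrite /G (bigD1 (x, y))//= indicE mem_set//= mule1.
  rewrite -[leLHS]adde0; apply: leeD.
    rewrite lee_fin; apply: wle; first exact: toric_dist_ge0.
    by rewrite dist1C; exact: toric_dist_cells.
  by apply: sume_ge0 => p _; rewrite mule_ge0// lee_fin.
have mLL : measurable (Lambda n `*` Lambda n : set (T * T)) by exact: measurableX.
have mQQ x y : measurable (Q x `*` Q y : set (T * T)) by exact: measurableX.
have mI x y : measurable_fun (Lambda n `*` Lambda n)
    (fun z : T * T => (\1_(Q x `*` Q y) z)%:E : \bar R).
  by apply/measurable_EFinP; exact: measurable_indic.
rewrite ge0_integral_sum//; last 2 first.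
- by move=> p; apply: measurable_funeM.
- by move=> p z _; rewrite mule_ge0// lee_fin.
rewrite /plan_cost [X in (_ <= X%:E)%E](_ : _ = \sum_x \sum_y M y x * W y x).
  rewrite pair_big/= -sumEFin; apply: lee_sum => -[x y] _ /=.
  rewrite ge0_integralZl//; last by rewrite lee_fin.
  rewrite integral_indic//.
  rewrite setIidl; last by move=> [u v] [Qu Qv]; split; apply: (cell_sub n0); eassumption.
  by rewrite massN -EFinM mulrC.
by rewrite exchange_big.
Qed.

End lift_plan.

(** * Pair correlations of cell counts *)

Section charge_bounds.
Context {R : realType} {d : nat}.
Implicit Types (beta : set 'rV[R]_d -> \bar R) (A B : set 'rV[R]_d).
Local Open Scope ereal_scope.
Import HBNNSimple.

(** A consequence of [local_charge] that is stable under change of sign, so that every bound on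
    [pos_part] also serves for [neg_part]. *)
Definition locally_additive beta :=
  [/\ beta set0 = 0,
    forall A, measurable A -> bounded_set A -> beta A \is a fin_num &
    forall A B, measurable A -> bounded_set A -> measurable B -> bounded_set B ->
      A `&` B = set0 -> beta (A `|` B) = beta A + beta B].

Lemma bounded_setU A B : bounded_set A -> bounded_set B -> bounded_set (A `|` B).
Proof.
move=> [M [Mr MA]] [N [Nr NB]]; exists (Num.max M N); split; first exact: num_real.
move=> x; rewrite gt_max => /andP[Mx Nx] y [/(MA _ Mx)//|/(NB _ Nx)//].
Qed.

Lemma bounded_set_empty : bounded_set (set0 : set 'rV[R]_d).
Proof. by exists 0%R; split; [exact: num_real|move=> x _ y]. Qed.

Lemma local_charge_additive beta : local_charge beta -> locally_additive beta.
Proof.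
move=> lc; split.
- have [nu nuE] := lc set0 measurable0 bounded_set_empty.
  by rewrite -(setI0 set0) -nuE// charge0.
- move=> A mA bA; have [nu nuE] := lc A mA bA.
  by rewrite -[A]setIid -nuE//; exact: fin_num_measure.
- move=> A B mA bA mB bB AB.
  have [nu nuE] := lc (A `|` B) (measurableU _ _ mA mB) (bounded_setU bA bB).
  rewrite -[in LHS](setIid (A `|` B)) -nuE ?chargeU//; last exact: measurableU.
  rewrite !nuE//; congr (beta _ + beta _); apply: setIidl.
    exact: subsetUl.
  exact: subsetUr.
Qed.

Lemma locally_additiveN beta : locally_additive beta ->
  locally_additive (fun A => - beta A).
Proof.
move=> [b0 bf bU]; split.
- by rewrite b0 oppe0.
- by move=> A mA bA; rewrite fin_numN bf.
- by move=> A B mA bA mB bB AB; rewrite bU// fin_num_oppeD// bf.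
Qed.

Section pos_part.
Variable beta : set 'rV[R]_d -> \bar R.
Hypothesis addb : locally_additive beta.

Lemma pos_part_ge0 A : 0 <= pos_part beta A.
Proof.
apply: ereal_sup_ubound; exists set0; last by case: addb.
by split => //; exact: bounded_set_empty.
Qed.

Lemma le_pos_part A B : A `<=` B -> pos_part beta A <= pos_part beta B.
Proof.
move=> AB; apply: ge_ereal_sup => _ [D [mD bD DA] <-].
by apply: ereal_sup_ubound; exists D => //; split => //; exact: subset_trans AB.
Qed.

Lemma pos_part0 : pos_part beta set0 = 0.
Proof.
apply/eqP; rewrite eq_le pos_part_ge0 andbT; apply: ge_ereal_sup => _ [D [_ _ D0] <-].
by move: D0; rewrite subset0 => ->; case: addb => ->.
Qed.

(** Subsets of disjoint sets can be united. The two suprema are taken one after the other by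
    subtraction, which requires finite values; hence the separate infinite case. *)
Lemma pos_part_superadditive A B : A `&` B = set0 ->
  pos_part beta A + pos_part beta B <= pos_part beta (A `|` B).
Proof.
move=> AB.
have [->|Aoo] := eqVneq (pos_part beta (A `|` B)) +oo; first by rewrite leey.
have fin D : D `<=` A `|` B -> pos_part beta D \is a fin_num.
  move=> DAB; rewrite ge0_fin_numE ?pos_part_ge0//.
  by rewrite (le_lt_trans (le_pos_part DAB))// ltey.
have fA := fin A (@subsetUl _ _ _); have fB := fin B (@subsetUr _ _ _).
apply: (@le_trans _ _ (ereal_sup [set pos_part beta A + beta B' | B' in
    [set B' : set 'rV[R]_d | [/\ measurable B', bounded_set B' & B' `<=` B]]])).
  rewrite addeC -leeBrDr//; apply: ge_ereal_sup => _ [B' [mB' bB' B'B] <-].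
  rewrite leeBrDr// addeC; apply: ereal_sup_ubound; by exists B'.
apply: ge_ereal_sup => _ [B' [mB' bB' B'B] <-].
have fB' : beta B' \is a fin_num by case: addb => _ + _; apply.
rewrite -leeBrDr//; apply: ge_ereal_sup => _ [A' [mA' bA' A'A] <-].
rewrite leeBrDr//; case: addb => _ _ <-//; last first.
  by apply/seteqP; split => // x [/A'A Ax /B'B Bx]; rewrite -AB.
apply: ereal_sup_ubound; exists (A' `|` B') => //; split.
- exact: measurableU.
- exact: bounded_setU.
- exact: setUSS.
Qed.

Lemma pos_part_bigU (I : choiceType) (s : seq I) (F : I -> set 'rV[R]_d) : uniq s ->
  (forall i j x, F i x -> F j x -> i = j) ->
  \sum_(i <- s) pos_part beta (F i) <= pos_part beta (\big[setU/set0]_(i <- s) F i).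
Proof.
move=> us tF; elim: s us => [|i s IH] /=; first by rewrite !big_nil pos_part0.
move=> /andP[si us]; rewrite !big_cons.
apply: le_trans (pos_part_superadditive _); first by apply: leeD => //; exact: IH.
apply/seteqP; split => // x [Fi]; rewrite -classical_sets.bigcup_seq => -[j /= js Fj].
by rewrite (tF _ _ _ Fi Fj) js in si.
Qed.

(* [pos_part beta] is not known to be a measure here; superadditivity is enough
   to control the lower sums defining the integral. *)
Lemma integral_pos_part_le (F : 'rV[R]_d -> \bar R) A (c : R) :
  (0 <= c)%R -> (forall x, 0 <= F x) -> (forall x, A x -> F x <= c%:E) ->
  (forall x, ~ A x -> F x = 0) ->
  0 <= \int[pos_part beta]_x F x <= c%:E * pos_part beta A.
Proof.
move=> c0 F0 Fc FA; set m := pos_part beta.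
have m0 : m set0 = 0 by exact: pos_part0.
have mge0 B : 0 <= m B by exact: pos_part_ge0.
(* Values outside the range of [h] contribute 0 by [m0], which leaves a finite sum. *)
have sE (h : {nnsfun 'rV[R]_d >-> R}) : sintegral m h =
    \sum_(x <- finmap.enum_fset (fset_set (range h))) x%:E * m (h @^-1` [set x]).
  rewrite /sintegral -(fsbig_widen (range h) setT)//=.
    by rewrite fsbig_finite.
  by move=> x [_ Nfx] /=; rewrite preimage10// m0 mule0.
have s0 (h : {nnsfun 'rV[R]_d >-> R}) : 0 <= sintegral m h.
  rewrite sE big_seq; apply: sume_ge0 => x; rewrite in_fset_set// inE => -[t _ <-].
  by rewrite mule_ge0// lee_fin.
have n0 : ereal_sup [set sintegral m h | h in [set h : {nnsfun 'rV[R]_d >-> R} |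
    forall x, (h x)%:E <= (F \_ setT)^\- x]] = 0.
  rewrite patch_setT; apply/eqP; rewrite eq_le; apply/andP; split.
    apply: ge_ereal_sup => _ [h hF <-]; rewrite sE big_seq big1// => x.
    rewrite in_fset_set// inE => -[t _ <-].
    have h0 : (h t)%:E <= 0.
      apply: (le_trans (hF t)); rewrite funenegE.
      have Ft : - F t <= 0 by rewrite leeNl oppe0.
      by rewrite ge_max Ft lexx.
    have -> : (h t)%:E = 0 by apply/eqP; rewrite eq_le h0 lee_fin fun_ge0.
    by rewrite mul0e.
  apply: le_trans (s0 nnsfun0) _; apply: ereal_sup_ubound; exists nnsfun0 => // x.
  by rewrite funeneg_ge0.
rewrite /integral n0 sube0 patch_setT; apply/andP; split.
  apply: le_trans (s0 nnsfun0) _; apply: ereal_sup_ubound; exists nnsfun0 => // x.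
  by rewrite funepos_ge0.
apply: ge_ereal_sup => _ [h hF <-]; rewrite sE.
have {}hF x : (h x)%:E <= F x.
  by apply: (le_trans (hF x)); rewrite funeposE ge_max lexx F0.
apply: (@le_trans _ _ (c%:E * \sum_(x <- finmap.enum_fset (fset_set (range h)) | x != 0%R) m (h @^-1` [set x]))).
  rewrite ge0_sume_distrr// [leRHS]big_mkcond big_seq [leRHS]big_seq.
  apply: lee_sum => x; rewrite in_fset_set// inE => -[t _ htx].
  have [->|x0] := eqVneq x 0%R; first by rewrite mul0e.
  rewrite lee_wpmul2r//; have := hF t; rewrite htx => /le_trans; apply.
  have [/Fc//|/FA Ft] := pselect (A t).
  by rewrite Ft lee_fin.
rewrite lee_wpmul2l ?lee_fin// -big_filter.
(* The level sets of the nonzero values are disjoint and contained in [A]. *)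
apply: le_trans (pos_part_bigU _ _) _.
- by rewrite filter_uniq.
- by move=> i j x /= <- <-.
apply: le_pos_part => x; rewrite -classical_sets.bigcup_seq => -[y /=].
rewrite mem_filter => /andP[y0 _] hy; apply: contrapT => /FA Fx.
have := hF x; rewrite Fx lee_fin hy => yle0.
have yge0 : (0 <= y)%R by rewrite -hy; exact: fun_ge0.
by move: y0; rewrite eq_le yle0 yge0.
Qed.

End pos_part.

Lemma charge_integral_bound beta (F : 'rV[R]_d -> \bar R) A (c : R) :
  locally_additive beta -> Defs.total_variation beta A < +oo ->
  (0 <= c)%R -> (forall x, 0 <= F x) -> (forall x, A x -> F x <= c%:E) ->
  (forall x, ~ A x -> F x = 0) ->
  `| charge_integral beta F | <= c%:E * Defs.total_variation beta A.
Proof.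
move=> addb TV c0 F0 Fc FA.
have /andP[p0 pc] := integral_pos_part_le addb c0 F0 Fc FA.
have /andP[n0 nc] := integral_pos_part_le (locally_additiveN addb) c0 F0 Fc FA.
have P0 := pos_part_ge0 addb A; have N0 := pos_part_ge0 (locally_additiveN addb) A.
rewrite /charge_integral /Defs.total_variation ge0_muleDr//.
apply: (le_trans (lee_abs_sub _ _)); rewrite !gee0_abs//.
exact: leeD.
Qed.

End charge_bounds.

(** * Test functions adapted to boxes *)

Section bump_functions.
Context {R : realType} {d : nat}.
Implicit Types (a b : 'I_d -> R) (x : 'rV[R]_d) (e : R).

Lemma test_function_in_box (f : 'rV[R]_d -> R) a b : (forall x, 0 <= f x) ->
  continuous f -> (forall x, ~ obox a b x -> f x = 0) -> test_function f.
Proof.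
move=> f0 cf fab; split => //.
pose B := [set v : 'rV[R]_d | forall i, `[a i, b i]%classic (v ord0 i)].
have cB : compact B 
  by apply: (@rV_compact R d (fun i => `[a i, b i]%classic)) => i; exact: segment_compact.
have clB : closed B by apply: compact_closed => //; exact: norm_hausdorff.
apply: (subclosed_compact _ cB); first exact: closed_closure.
rewrite (closure_id B).1//; apply: closureS => x /= fx i.
have xab : obox a b x by apply: contrapT => /fab fx0; rewrite fx0 eqxx in fx.
by have /andP[l r] := xab i; rewrite /= in_itv/= (ltW l) r.
Qed.

Definition ramp (a b e t : R) : R :=
  Num.max 0 (Num.min 1 (Num.min ((t - a) / e) ((b - t) / e))).

Lemma ramp01 (a b e t : R) : 0 <= ramp a b e t <= 1.
Proof. by rewrite /ramp le_max lexx/= ge_max ler01 ge_min lexx. Qed.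

Lemma ramp_in (a b e t : R) : 0 < e -> a + e <= t <= b - e -> ramp a b e t = 1.
Proof.
move=> e0 /andP[at_ tb]; rewrite /ramp [Num.min 1 _]min_l ?max_r//.
by rewrite le_min !ler_pdivlMr// mul1r; apply/andP; split; lra.
Qed.

Lemma ramp_out (a b e t : R) : 0 < e -> t <= a \/ b <= t -> ramp a b e t = 0.
Proof.
move=> e0 tab; rewrite /ramp max_l// ge_min; apply/orP; right.
rewrite ge_min !ler_pdivrMr// !mul0r.
by case: tab => h; apply/orP; [left|right]; lra.
Qed.

Lemma ramp_continuous (a b e : R) : continuous (ramp a b e).
Proof.
move=> t.
have c1 : {for t, continuous (fun u : R => (u - a) / e : R^o)}.
  apply: (@cvgM _ _ (nbhs t)); last exact: cvg_cst.
  by apply: cvgB; [exact: cvg_id|exact: cvg_cst].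
have c2 : {for t, continuous (fun u : R => (b - u) / e : R^o)}.
  apply: (@cvgM _ _ (nbhs t)); last exact: cvg_cst.
  by apply: cvgB; [exact: cvg_cst|exact: cvg_id].
have c k : {for t, continuous (fun=> k : R^o)} by exact: cvg_cst.
exact: (continuous_max (c 0) (continuous_min (c 1) (continuous_min c1 c2))).
Qed.

Lemma continuous_bigsum (T : topologicalType) (I : Type) (s : seq I) (Q : pred I)
    (f : I -> T -> R) : (forall i, continuous (f i)) ->
  continuous (fun u => \sum_(i <- s | Q i) f i u).
Proof.
move=> cf; elim: s => [|i s IH] x.
  by under eq_fun do rewrite big_nil; exact: cst_continuous.
under eq_fun do rewrite big_cons; case: (Q i); last exact: IH.
by apply: cvgD; [exact: cf|exact: IH].
Qed.

Lemma continuous_bigprod (T : topologicalType) (I : Type) (s : seq I) (Q : pred I)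
    (f : I -> T -> R) : (forall i, continuous (f i)) ->
  continuous (fun u => \prod_(i <- s | Q i) f i u).
Proof.
move=> cf; elim: s => [|i s IH] x.
  by under eq_fun do rewrite big_nil; exact: cst_continuous.
under eq_fun do rewrite big_cons; case: (Q i); last exact: IH.
by apply: cvgM; [exact: cf|exact: IH].
Qed.

Definition bump a b e x : R := \prod_i ramp (a i) (b i) e (x ord0 i).

Lemma bump_continuous a b e : continuous (bump a b e).
Proof.
apply: continuous_bigprod => i x.
apply: (@continuous_comp _ _ _ (fun x : 'rV[R]_d => x ord0 i)).
  exact: coord_continuous.
exact: ramp_continuous.
Qed.

Lemma bump01 a b e x : 0 <= bump a b e x <= 1.
Proof.
rewrite /bump prodr_ge0 => [|i _]; last by case/andP: (ramp01 (a i) (b i) e (x ord0 i)).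
by rewrite prodr_ile1// => i _; exact: ramp01.
Qed.

Lemma bump_in a b e x : 0 < e ->
  obox (fun i => a i + e) (fun i => b i - e) x -> bump a b e x = 1.
Proof.
move=> e0 xab; apply: big1 => i _; apply: ramp_in => //.
by have /andP[/ltW-> ->] := xab i.
Qed.

Lemma bump_out a b e x : 0 < e -> ~ obox a b x -> bump a b e x = 0.
Proof.
move=> e0 xab; have [i xi] : exists i, ~ (a i < x ord0 i <= b i).
  by apply/existsNP => h; exact: xab.
rewrite /bump (bigD1 i)//= ramp_out ?mul0r//.
move/negP: xi; rewrite negb_and -leNgt -ltNge => /orP[|/ltW]; by [left|right].
Qed.

End bump_functions.

Lemma integral_rectangles {R : realType} d0 (T : measurableType d0) (I : Type)
    (m : {measure set T -> \bar R}) (A : set T) (s : seq I) (B : I -> set T) :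
  measurable A -> (forall i, measurable (B i)) ->
  (\int[m]_u \int[m]_v (\1_A u * \sum_(i <- s) \1_(B i) v)%:E =
   m A * \sum_(i <- s) m (B i))%E.
Proof.
move=> mA mB.
have S0 : (0 <= \sum_(i <- s) m (B i))%E by exact: sume_ge0.
transitivity (\int[m]_u ((\1_A u)%:E * \sum_(i <- s) m (B i)))%E.
  apply: eq_integral => u _; under eq_integral do rewrite EFinM -sumEFin.
  rewrite ge0_integralZl//; last 2 first.
  - apply: emeasurable_sum => i; exact/measurable_EFinP/measurable_indic.
  - by move=> v _; apply: sume_ge0 => i _; rewrite lee_fin.
  congr (_ * _)%E; rewrite ge0_integral_sum//; last first.
    by move=> i; exact/measurable_EFinP/measurable_indic.
  by apply: eq_bigr => i _; rewrite integral_indic// setIT.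
rewrite ge0_integralZr//; last exact/measurable_EFinP/measurable_indic.
by rewrite integral_indic// setIT.
Qed.

(** Stated for any measure, since it serves for Lebesgue measure and for every realisation [mu w];
    [g] will be a product of bumps lying between indicators of shrunk and full cells. *)
Lemma integral_rectangles_sandwich {R : realType} d0 (T : measurableType d0)
    (I : Type) (m : {measure set T -> \bar R}) (A A' : set T) (s : seq I)
    (B B' : I -> set T) (g : T -> T -> R) :
  measurable A -> (forall i, measurable (B i)) ->
  measurable A' -> (forall i, measurable (B' i)) ->
  (forall u v, \1_A u * \sum_(i <- s) \1_(B i) v <= g u v) ->
  (forall u v, g u v <= \1_A' u * \sum_(i <- s) \1_(B' i) v) ->
  (m A * \sum_(i <- s) m (B i) <= \int[m]_u \int[m]_v (g u v)%:E
    <= m A' * \sum_(i <- s) m (B' i))%E.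
Proof.
move=> mA mB mA' mB' gl gu.
have I0 u v : 0 <= \1_A u * \sum_(i <- s) \1_(B i) v :> R.
  by rewrite mulr_ge0// sumr_ge0.
rewrite -!integral_rectangles//; apply/andP; split.
  apply: le_integral_nonneg => u _.
    by apply: integral_ge0 => v _; rewrite lee_fin.
  by apply: le_integral_nonneg => v _; rewrite lee_fin.
apply: le_integral_nonneg => u _.
  by apply: integral_ge0 => v _; rewrite lee_fin (le_trans (I0 u v)).
by apply: le_integral_nonneg => v _; rewrite lee_fin// (le_trans (I0 u v)).
Qed.

Section cell_bumps.
Context {R : realType} (d K n : nat).
Hypothesis d0 : (0 < d)%N.
Hypothesis n0 : (0 < n)%N.
Let C := cells d K.
Let T := 'rV[R]_d.
Let Q : C -> set T := @cell R d K n.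
Let h : R := @mesh R d K n.
Variables (e : R) (x : C) (s : seq C).
Hypothesis e0 : 0 < e.
Hypothesis eh : 2 * e < h.
Hypothesis us : uniq s.
Hypothesis xs : x \notin s.

Definition shrunk_cell (y : C) : set T :=
  obox (fun i => @lo R d K n y i + e) (fun i => @lo R d K n y i + h - e).

Let phi (y : C) : T -> R := bump (@lo R d K n y) (fun i => @lo R d K n y i + h) e.
Let psi (u : T) : R := \sum_(y <- s) phi y u.

Let phi_in y u : shrunk_cell y u -> phi y u = 1.
Proof. exact: bump_in. Qed.

Let phi_out y u : ~ Q y u -> phi y u = 0.
Proof. exact: bump_out. Qed.

Let phi_lb y u : \1_(shrunk_cell y) u <= phi y u.
Proof.
rewrite indicE; case: (boolP (u \in _)) => [/set_mem/phi_in -> //|_].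
by case/andP: (bump01 (@lo R d K n y) (fun i => @lo R d K n y i + h) e u).
Qed.

Let phi_ub y u : phi y u <= \1_(Q y) u.
Proof.
rewrite indicE; case: (boolP (u \in _)) => [_|].
  by case/andP: (bump01 (@lo R d K n y) (fun i => @lo R d K n y i + h) e u).
by move=> /negP uQ; rewrite phi_out// => Qu; apply: uQ; exact: mem_set.
Qed.

Let phi0 y u : 0 <= phi y u.
Proof. by case/andP: (bump01 (@lo R d K n y) (fun i => @lo R d K n y i + h) e u). Qed.

Let psi0 u : 0 <= psi u. Proof. by apply: sumr_ge0. Qed.

Let psi1 u : psi u <= 1.
Proof.
rewrite /psi; have [[y ys yu]|H] := pselect (exists2 y, y \in s & Q y u).
  rewrite (bigD1_seq y)//= big1 ?addr0 => [|z zy].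
    by apply: (le_trans (phi_ub y u)); rewrite indicE lern1 leq_b1.
  apply: phi_out => zu; move: zy.
  by rewrite (cell_inj n0 zu yu) eqxx.
rewrite big_seq big1// => y ys; apply: phi_out => yu; apply: H; by exists y.
Qed.

Let Lam : set T := @Lambda R d n.
Let LL : set T := [set u + v | u in Lam & v in Lam].

(** The charge is tested on differences of points, whereas [bn] involves a sum of two copies of the
    box; half of the difference lies in each copy. *)
Let diff_LL u v : Lam u -> Lam v -> LL (v - u).
Proof.
move=> uL vL; exists (2^-1 *: (v - u)); last first.
  exists (2^-1 *: (v - u)); last by rewrite -scalerDl -[RHS]scale1r [in RHS](splitr 1) mul1r.
  by move=> i; have /andP[? ?] := uL i; have /andP[? ?] := vL i; rewrite !mxE; lra.
by move=> i; have /andP[? ?] := uL i; have /andP[? ?] := vL i; rewrite !mxE; lra.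
Qed.

Lemma measurable_shrunk_cell y : measurable (shrunk_cell y).
Proof. exact: measurable_obox. Qed.

Lemma leb_shrunk_cell y : leb (shrunk_cell y) = ((h - 2 * e) ^+ d)%:E.
Proof.
rewrite leb_box => [|i]; last by rewrite /=; move: eh; lra.
rewrite (eq_bigr (fun=> h - 2 * e)) => [|i _]; last by ring.
by rewrite prodr_const card_ord.
Qed.

Lemma sub_shrunk_cell y : shrunk_cell y `<=` Q y.
Proof.
move=> u uy i; have /andP[/= l r] := uy i; move: e0 l r => ? l r.
by apply/andP; split; rewrite /= -?/h; lra.
Qed.

Section covariance_bound.
Context (dO : measure_display) (O : measurableType dO) (P : probability O R)
  (mu : R.-ker O ~> 'rV[R]_d) (beta : set 'rV[R]_d -> \bar R).
Hypothesis rpcm : is_rpcm P mu beta.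

Let tv : R := fine (Defs.total_variation beta LL).

Lemma total_variation_LambdaD : Defs.total_variation beta LL = tv%:E /\ 0 <= tv.
Proof.
have [lc tvoo _] := rpcm; have addb := local_charge_additive lc.
have TV0 : (0 <= Defs.total_variation beta LL)%E.
  rewrite adde_ge0 ?pos_part_ge0//; exact: locally_additiveN.
split; last exact: fine_ge0.
rewrite fineK// ge0_fin_numE// /LL /Lam LambdaD// tvoo//.
  exact: measurable_Lambda.
exact: bounded_Lambda.
Qed.

(* The test functions are bumps equal to 1 on the shrunk cells and vanishing outside
   the cells. The cells of [s] are disjoint, so that the bumps add up to at most 1
   and the charge integral is at most [h ^+ d] times the total variation. *)
Lemma covariance_sandwich :
  (\int[P]_w (mu w (shrunk_cell x) * \sum_(y <- s) mu w (shrunk_cell y))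
    <= (h ^+ d * ((size s)%:R * h ^+ d) + h ^+ d * tv)%:E)%E /\
  (((h - 2 * e) ^+ d * ((size s)%:R * (h - 2 * e) ^+ d) - h ^+ d * tv)%:E <=
    \int[P]_w (mu w (Q x) * \sum_(y <- s) mu w (Q y)))%E.
Proof.
have [lc tvoo eqn] := rpcm; have addb := local_charge_additive lc.
have [tvE' tv0] := total_variation_LambdaD.
have cphi y : continuous (phi y) by exact: bump_continuous.
have tphi : test_function (phi x).
  by apply: test_function_in_box; [exact: phi0|exact: cphi|exact: phi_out].
have tpsi : test_function psi.
  apply: (@test_function_in_box _ _ _ (fun=> - (pi * @side R d n)) (fun=> pi * @side R d n)).
  - exact: psi0.
  - exact: continuous_bigsum.
  - move=> u uL; apply: big1 => y _; apply: phi_out => yu; apply: uL.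
    exact: (cell_sub n0 yu).
have {eqn} := eqn _ _ tphi tpsi.
set Lhs := (X in X = _ -> _); set A := (X in _ = (X + _)%E -> _).
set G := fun u => _; move=> eqn.
have gl u v : \1_(shrunk_cell x) u * \sum_(y <- s) \1_(shrunk_cell y) v <= phi x u * psi v.
  by apply: ler_pM => //; [exact: sumr_ge0|exact: ler_sum].
have gu u v : phi x u * psi v <= \1_(Q x) u * \sum_(y <- s) \1_(Q y) v.
  by apply: ler_pM => //; exact: ler_sum.
have neq u v : (u != v)%:R * (phi x u * psi v) = phi x u * psi v.
  have [<-|_] := eqVneq u v; last by rewrite mul1r.
  rewrite mul0r; have [xu|/phi_out ->] := pselect (Q x u); last by rewrite mul0r.
  rewrite [psi u]big_seq big1 ?mulr0// => y ys; apply: phi_out => yu.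
  by move: xs; rewrite (cell_inj n0 xu yu) ys.
have mS := measurable_shrunk_cell.
have mQ y : measurable (Q y) by exact: measurable_cell.
have G0 u : (0 <= G u)%E by apply: integral_ge0 => z _; rewrite lee_fin mulr_ge0.
(* [G u] is the overlap of the bump of [x] with a translate of [psi <= 1], so the volume of a cell
   bounds it; it vanishes unless [u] is a difference of two points of the box. *)
have Gub u : (G u <= (h ^+ d)%:E)%E.
  have -> : (h ^+ d)%:E = (\int[@leb R d]_z (\1_(Q x) z)%:E)%E.
    by rewrite integral_indic// setIT; apply/esym/leb_cell.
  apply: le_integral_nonneg => z _; rewrite lee_fin ?mulr_ge0//.
  by rewrite -[leRHS]mulr1; apply: ler_pM.
have Gout u : ~ LL u -> G u = 0%E.
  move=> uLL; apply: integral0_eq => z _; congr EFin.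
  have [xz|/phi_out ->] := pselect (Q x z); last by rewrite mul0r.
  rewrite [psi _]big1 ?mulr0// => y _; apply: phi_out => yuz; apply: uLL.
  rewrite (_ : u = (u + z) - z); last by rewrite addrK.
  by apply: diff_LL; exact: (@cell_sub R d K n n0 _ _ _).
have hd0 : 0 <= h ^+ d by rewrite exprn_ge0// ltW// mesh_gt0.
have ci := charge_integral_bound addb (_ : (_ < +oo)%E) hd0 G0 (fun u _ => Gub u) Gout.
have {}ci : (`|charge_integral beta G| <= (h ^+ d * tv)%:E)%E.
  by rewrite EFinM -tvE'; apply: ci; rewrite tvE' ltry.
have cifin : charge_integral beta G \is a fin_num.
  by rewrite fin_num_abs (le_lt_trans ci)// ltry.
have [cil' ciu'] : ((- (h ^+ d * tv))%:E <= charge_integral beta G)%E /\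
    (charge_integral beta G <= (h ^+ d * tv)%:E)%E.
  move: ci; rewrite -(fineK cifin) lee_fin ler_norml => /andP[cil ciu].
  by rewrite !lee_fin.
have /andP[Al Au] := integral_rectangles_sandwich (@leb R d) (mS x) mS (mQ x) mQ gl gu.
have sumv (k : R) : (\sum_(y <- s) k%:E = ((size s)%:R * k)%:E)%E.
  by rewrite sumEFin big_const_seq count_predT iter_addr_0 mulr_natl.
have lebS y : (@leb R d : {measure set T -> \bar R}) (shrunk_cell y) =
  ((h - 2 * e) ^+ d)%:E by exact: leb_shrunk_cell.
have lebQ y : (@leb R d : {measure set T -> \bar R}) (Q y) = (h ^+ d)%:E.
  exact: leb_cell.
rewrite lebS (eq_bigr _ (fun y _ => lebS y)) in Al.
rewrite lebQ (eq_bigr _ (fun y _ => lebQ y)) in Au.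
rewrite sumv -EFinM in Al; rewrite sumv -EFinM in Au.
have Lw w := integral_rectangles_sandwich (mu w) (mS x) mS (mQ x) mQ gl gu.
have LhsE : Lhs = (\int[P]_w \int[mu w]_u \int[mu w]_v (phi x u * psi v)%:E)%E.
  apply: eq_integral => w _; apply: eq_integral => u _; apply: eq_integral => v _.
  by rewrite neq.
rewrite LhsE in eqn.
have p0 w B : (0 <= mu w B * \sum_(y <- s) mu w (shrunk_cell y))%E.
  by apply: mule_ge0; [exact: measure_ge0|apply: sume_ge0 => y _; exact: measure_ge0].
split.
  apply: (@le_trans _ _ Lhs).
    rewrite LhsE; apply: le_integral_nonneg => w _; first exact: p0.
    by case/andP: (Lw w).
  by rewrite LhsE eqn [leRHS]EFinD; exact: leeD Au ciu'.
apply: (@le_trans _ _ Lhs).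
  by rewrite LhsE eqn [leLHS]EFinD; exact: leeD Al cil'.
rewrite LhsE; apply: le_integral_nonneg => w _; last by case/andP: (Lw w).
by case/andP: (Lw w) => l _; exact: le_trans (p0 w _) l.
Qed.

End covariance_bound.
End cell_bumps.

Lemma bernoulli_sub {R : realDomainType} (t : R) m : 0 <= t <= 1 ->
  1 - m%:R * t <= (1 - t) ^+ m.
Proof.
move=> /andP[t0 t1]; elim: m => [|m IH]; first by rewrite mul0r subr0 expr0.
rewrite exprS -[m.+1%:R]natr1; have t1' : 0 <= 1 - t by rewrite subr_ge0.
apply: le_trans (ler_wpM2l t1' IH).
have : 0 <= m%:R * t * t by rewrite !mulr_ge0.
by move: (m%:R) => c; nra.
Qed.

Lemma sub_bounded_set {R : realType} d (A B : set 'rV[R]_d) :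
  A `<=` B -> bounded_set B -> bounded_set A.
Proof.
by move=> AB [M [Mr MB]]; exists M; split => // x Mx y Ay; apply: (MB x Mx); exact: AB.
Qed.

Lemma measure_gap {R : realType} d0 (T : measurableType d0)
    (m : {measure set T -> \bar R}) (A B : set T) (a b : R) :
  measurable A -> measurable B -> B `<=` A -> m A = a%:E -> m B = b%:E ->
  m (A `\` B) = (a - b)%:E.
Proof.
move=> mA mB BA mAa mBb; transitivity (m A - m (A `&` B))%E.
  by apply: measureD => //; rewrite [X in (X < _)%E]mAa ltry.
by rewrite setIidr// mAa mBb.
Qed.

(** * From bumps to cells: vanishing margins *)

Section covariance.
Context {R : realType} (d K n : nat).
Hypothesis d0 : (0 < d)%N.
Hypothesis n0 : (0 < n)%N.
Let C := cells d K.
Let T := 'rV[R]_d.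
Let Q : C -> set T := @cell R d K n.
Let h : R := @mesh R d K n.
Let LL : set T := [set u + v | u in @Lambda R d n & v in @Lambda R d n].
Context (dO : measure_display) (O : measurableType dO) (P : probability O R)
  (mu : R.-ker O ~> 'rV[R]_d) (beta : set 'rV[R]_d -> \bar R).
Hypothesis mu_pp : point_process mu.
Hypothesis mu_intensity : unit_intensity P mu.
Hypothesis mu_square : locally_square_integrable P mu.
Hypothesis rpcm : is_rpcm P mu beta.

Let tv : R := fine (Defs.total_variation beta LL).
Let h0 : 0 < h. Proof. exact: mesh_gt0. Qed.

(** The shift by 3 keeps [2 * eps k] below [h] for every [k]. *)
Let eps (k : nat) : R := h / k.+3%:R.
Let eps0 k : 0 < eps k. Proof. by rewrite divr_gt0. Qed.
Let epsh k : 2 * eps k < h.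
Proof. by rewrite mulrCA gtr_pMr// ltr_pdivrMr// mul1r ltr_nat. Qed.
Let epsE k : h - 2 * eps k = h * (1 - 2 / k.+3%:R).
Proof. by rewrite /eps; field. Qed.

Let epsX k : (h - 2 * eps k) ^+ d = h ^+ d * (1 - 2 / k.+3%:R) ^+ d.
Proof. by rewrite epsE exprMn. Qed.

Let inner k (y : C) : set T := shrunk_cell n (eps k) y.
(** The open cell. *)
Let core y : set T := \bigcup_k inner k y.

Let minner k y : measurable (inner k y). Proof. exact: measurable_shrunk_cell. Qed.
Let mcore y : measurable (core y). Proof. by apply: bigcup_measurable. Qed.
Let mQ y : measurable (Q y). Proof. exact: measurable_cell. Qed.
Let bQ y : bounded_set (Q y). Proof. exact: bounded_obox. Qed.

Let inner_sub k y : inner k y `<=` Q y. Proof. exact: sub_shrunk_cell. Qed.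
Let core_sub y : core y `<=` Q y. Proof. by move=> u [k _ /inner_sub]. Qed.

Let inner_nd y : nondecreasing_seq (fun k => inner k y).
Proof.
move=> k l kl; apply/subsetPset => u uy i; have /andP[/= lu ru] := uy i.
have el : eps l <= eps k.
  by rewrite ler_wpM2l ?(ltW h0)// lef_pV2 ?posrE ?ltr0n// ler_nat !ltnS.
by apply/andP; split => /=; lra.
Qed.

Let leb_gap y : leb (Q y `\` core y) = 0%E.
Proof.
apply/eqP; rewrite eq_le measure_ge0 andbT; apply/lee_addgt0Pr => e e0; rewrite add0e.
have hd : 0 < h ^+ d by rewrite exprn_gt0.
pose k := Num.bound (h ^+ d * d%:R * 2 / e).
apply: (@le_trans _ _ (leb (Q y `\` inner k y))).
  apply: le_measure; rewrite ?inE; try exact: measurableD.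
  by apply: setDS => u uk; exists k.
have gap := @measure_gap R _ _ (@leb R d) (Q y) (inner k y) _ _ (mQ y) (minner k y)
  (@inner_sub k y) (@leb_cell R d K n n0 y) (@leb_shrunk_cell R d K n (eps k) (epsh k) y).
apply: (@le_trans _ _ (h ^+ d - (h - 2 * eps k) ^+ d)%:E).
  by rewrite -gap; exact: lexx.
rewrite lee_fin epsX.
have t01 : 0 <= (2 / k.+3%:R : R) <= 1.
  by rewrite divr_ge0//= ler_pdivrMr// mul1r ler_nat.
have be := @bernoulli_sub R _ d t01.
have ke : h ^+ d * (d%:R * (2 / k.+3%:R)) <= e.
  have b0 : 0 <= h ^+ d * d%:R * 2 / e by rewrite divr_ge0 ?(ltW e0)// !mulr_ge0// ltW.
  rewrite !mulrA ler_pdivrMr// [e * _]mulrC -ler_pdivrMr//.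
  by rewrite (le_trans (ltW (archi_boundP b0)))// ler_nat -addn3 leq_addr.
have := ler_wpM2l (ltW hd) be; rewrite mulrBr mulr1 => hb.
by apply: le_trans ke; rewrite lerBlDr addrC -lerBlDr.
Qed.

Let mu_fin w (A : set T) : measurable A -> bounded_set A -> mu w A \is a fin_num.
Proof. by move=> mA bA; rewrite ge0_fin_numE//; case: mu_pp => + _; apply. Qed.

Let bcore y : bounded_set (core y).
Proof. by apply: (@sub_bounded_set R d _ (Q y)); [exact: core_sub|exact: bQ]. Qed.

Let mmu (A : set T) : measurable A -> measurable_fun setT (fun w => mu w A).
Proof. by move=> mA; exact: measurable_kernel. Qed.

Let msum_mu (s : seq C) (B : C -> set T) : (forall y, measurable (B y)) ->
  measurable_fun setT (fun w => \sum_(y <- s) mu w (B y))%E.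
Proof. by move=> mB; apply: emeasurable_sum => y; exact: mmu. Qed.

(** The removed faces are Lebesgue null, hence have zero expected mass by unit intensity. *)
Let ae_core : {ae P, forall w, forall y : C, mu w (Q y) = mu w (core y)}.
Proof.
apply: filter_forall => y.
have mD : measurable (Q y `\` core y) by exact: measurableD.
have : (\int[P]_w `|mu w (Q y `\` core y)|)%E = 0%E.
  under eq_integral do rewrite gee0_abs//.
  by rewrite mu_intensity// leb_gap.
move=> /(ae_eq_integral_abs P measurableT (mmu mD)).1.
apply: filterS => w /(_ I) D0.
by rewrite (measureDI _ (mQ y) (mcore y)) [X in (X + _)%E]D0 add0e setIidr.
Qed.

Variables (x : C) (s : seq C).
Hypothesis us : uniq s.
Hypothesis xs : x \notin s.
Let v : R := h ^+ d.
Let EE := (\int[P]_w (mu w (Q x) * \sum_(y <- s) mu w (Q y)))%E.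

(** [covariance_sandwich] gives upper bounds for shrunk cells only: monotone convergence reaches the
    open cells, and [ae_core] the full ones. The lower bound already concerns full cells. *)
Let EE_le : (EE <= (v * ((size s)%:R * v) + v * tv)%:E)%E.
Proof.
pose f k w := (mu w (inner k x) * \sum_(y <- s) mu w (inner k y))%E.
have f_cvg w : (f k w @[k --> \oo] --> mu w (core x) * \sum_(y <- s) mu w (core y))%E.
  have c y : (mu w (inner k y) @[k --> \oo] --> mu w (core y))%E.
    apply: nondecreasing_cvg_mu; [by move=> i; exact: minner|exact: mcore|exact: inner_nd].
  apply: cvgeM; last 2 first.
  - exact: c.
  - by apply: cvg_nnesum => y _; [exact: nearW|exact: c].
  apply: mule_def_fin; first exact: mu_fin.
  by apply/sum_fin_numP => y _ _; exact: mu_fin.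
have -> : EE = (\int[P]_w limn (f ^~ w))%E.
  have fE w : limn (f ^~ w) = (mu w (core x) * \sum_(y <- s) mu w (core y))%E.
    by apply/cvg_lim => //; exact: f_cvg.
  under [RHS]eq_integral do rewrite fE.
  apply: ge0_ae_eq_integral => //.
  - by apply: emeasurable_funM; [exact: mmu|exact: msum_mu].
  - by apply: emeasurable_funM; [exact: mmu|exact: msum_mu].
  - by move=> w _; rewrite mule_ge0// sume_ge0.
  - by move=> w _; rewrite mule_ge0// sume_ge0.
  - apply: filterS ae_core => w wE _; rewrite wE; congr (_ * _)%E.
    by apply: eq_bigr => y _; rewrite wE.
have f0 k w : (0 <= f k w)%E.
  by apply: mule_ge0 => //; apply: sume_ge0 => y _; exact: measure_ge0.
have fnd w : nondecreasing_seq (f ^~ w).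
  move=> k l kl; have le y : (mu w (inner k y) <= mu w (inner l y))%E.
    by apply: le_measure; rewrite ?inE//; exact/subsetPset/inner_nd.
  apply: lee_pmul => //; first by apply: sume_ge0 => y _; exact: measure_ge0.
  by apply: lee_sum => y _; exact: le.
rewrite monotone_convergence//; last first.
  by move=> k; apply: emeasurable_funM; [exact: mmu|exact: msum_mu].
apply: lime_le.
  apply: ereal_nondecreasing_is_cvgn => k l kl; apply: le_integral_nonneg => w _ //.
  exact: fnd.
apply: nearW => k.
by have [] := covariance_sandwich d0 n0 (eps0 k) (epsh k) us xs rpcm.
Qed.

Let EE_ge : ((v * ((size s)%:R * v) - v * tv)%:E <= EE)%E.
Proof.
have v0 : 0 < v by rewrite exprn_gt0.
apply/lee_addgt0Pr => e e0.
pose c := v * (size s)%:R * v * (2 * d)%:R * 2.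
have c0 : 0 <= c by rewrite !mulr_ge0 ?(ltW v0).
pose k := Num.bound (c / e).
have [_ H] := covariance_sandwich d0 n0 (eps0 k) (epsh k) us xs rpcm.
apply: (@le_trans _ _ (((h - 2 * eps k) ^+ d * ((size s)%:R * (h - 2 * eps k) ^+ d) -
  h ^+ d * tv)%:E + e%:E)%E); last by rewrite leeD2r.
rewrite -EFinD lee_fin epsX.
have t01 : 0 <= (2 / k.+3%:R : R) <= 1.
  by rewrite divr_ge0//= ler_pdivrMr// mul1r ler_nat.
have be := @bernoulli_sub R _ (2 * d) t01.
have ke : c / k.+3%:R <= e.
  have b0 : 0 <= c / e by rewrite divr_ge0// ltW.
  rewrite ler_pdivrMr// mulrC -ler_pdivrMr//.
  by rewrite (le_trans (ltW (archi_boundP b0)))// ler_nat -addn3 leq_addr.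
have vs : 0 <= v * (size s)%:R * v by rewrite !mulr_ge0 ?(ltW v0).
have := ler_wpM2l vs be; rewrite mulrBr mulr1.
have -> : v * (size s)%:R * v * ((2 * d)%:R * (2 / k.+3%:R)) = c / k.+3%:R.
  by rewrite /c; ring.
rewrite mul2n -addnn exprD -/v.
move: ((1 - _) ^+ d) (c / _) ke => a b ke hb; lra.
Qed.

(* [covariance_sandwich] in the limit of a vanishing margin. *)
Lemma expected_products :
  (\int[P]_w (mu w (Q x) * \sum_(y <- s) mu w (Q y))
     <= ((h ^+ d) ^+ 2 * (size s)%:R + h ^+ d * tv)%:E)%E /\
  (((h ^+ d) ^+ 2 * (size s)%:R - h ^+ d * tv)%:E <=
     \int[P]_w (mu w (Q x) * \sum_(y <- s) mu w (Q y)))%E.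
Proof. by rewrite expr2 -mulrA [h ^+ d * (size s)%:R]mulrC. Qed.

End covariance.

(** * Second moments of linear forms in the counts *)

Lemma integral_lincomb {R : realType} d0 (O : measurableType d0)
    (P : probability O R) (I : finType) (g : I -> O -> R) (c e : I -> R) (k : R) :
  (forall i, P.-integrable setT (fun w => (g i w)%:E)) ->
  (forall i, (\int[P]_w (g i w)%:E = (e i)%:E)%E) ->
  (\int[P]_w (\sum_i c i * g i w + k)%:E = (\sum_i c i * e i + k)%:E)%E.
Proof.
move=> ig Eg.
have ig' i : P.-integrable setT (fun w => ((c i)%:E * (g i w)%:E)%E) by exact: integrableZl.
under eq_integral do rewrite EFinD -sumEFin.
rewrite integralD//=; last 2 first.
- by apply: integrable_sum => // i _; exact: ig'.
- exact: finite_measure_integrable_cst.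
rewrite integral_cst// [X in (_ * X)%E]probability_setT mule1 EFinD; congr (_ + _)%E.
under eq_integral do under eq_bigr do rewrite EFinM.
rewrite integral_sum//; rewrite -sumEFin; apply: eq_bigr => i _.
by rewrite integralZl// Eg.
Qed.

(** Schur's test: each product [a x * a y] is split into two half squares, and symmetry turns column
    sums into row sums. *)
Lemma quadratic_form_le {R : realFieldType} (I : finType) (c : I -> I -> R) (D : R) :
  (forall x y, c x y = c y x) -> (forall x, \sum_y `|c x y| <= D) ->
  forall a : I -> R, \sum_x \sum_y a x * a y * c x y <= D * \sum_x a x ^+ 2.
Proof.
move=> cC cD a.
apply: (@le_trans _ _ (\sum_x \sum_y (a x ^+ 2 / 2 * `|c x y| + a y ^+ 2 / 2 * `|c x y|))).
  apply: ler_sum => x _; apply: ler_sum => y _; apply: (le_trans (ler_norm _)).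
  rewrite normrM -mulrDl ler_wpM2r// ler_norml.
  by have := sqr_ge0 (a x - a y); have := sqr_ge0 (a x + a y); nra.
under eq_bigr do rewrite big_split/=; rewrite big_split/= [X in _ + X]exchange_big/=.
rewrite [X in _ + X](eq_bigr (fun x => \sum_y a x ^+ 2 / 2 * `|c x y|)); last first.
  by move=> x _; apply: eq_bigr => y _; rewrite cC.
rewrite -big_split mulr_sumr; apply: ler_sum => x _ /=.
rewrite -mulr_sumr -mulrDl -splitr mulrC ler_wpM2r ?sqr_ge0//.
Qed.

Section quadratic_form.
Context {R : realType} (d K n : nat).
Hypothesis d0 : (0 < d)%N.
Hypothesis n0 : (0 < n)%N.
Let C := cells d K.
Let T := 'rV[R]_d.
Let Q : C -> set T := @cell R d K n.
Let h : R := @mesh R d K n.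
Let LL : set T := [set u + v | u in @Lambda R d n & v in @Lambda R d n].
Context (dO : measure_display) (O : measurableType dO) (P : probability O R)
  (mu : R.-ker O ~> 'rV[R]_d) (beta : set 'rV[R]_d -> \bar R).
Hypothesis mu_pp : point_process mu.
Hypothesis mu_intensity : unit_intensity P mu.
Hypothesis mu_square : locally_square_integrable P mu.
Hypothesis rpcm : is_rpcm P mu beta.
Variable M2 : R.
Hypothesis M2P : forall y, (\int[P]_w (mu w (Q y)) ^+ 2 <= M2%:E)%E.

Let tv : R := fine (Defs.total_variation beta LL).
Let v : R := h ^+ d.
Let v0 : 0 < v. Proof. by rewrite exprn_gt0// mesh_gt0. Qed.
Let mQ y : measurable (Q y). Proof. exact: measurable_cell. Qed.
Let bQ y : bounded_set (Q y). Proof. exact: bounded_obox. Qed.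

Definition count (y : C) w : R := fine (mu w (Q y)).

Let mu_count w y : mu w (Q y) = (count y w)%:E.
Proof.
by rewrite /count fineK// ge0_fin_numE//; case: mu_pp => + _; apply.
Qed.

Let count0 y w : 0 <= count y w.
Proof. by rewrite -lee_fin -mu_count. Qed.

Lemma measurable_count y : measurable_fun setT (count y).
Proof.
apply/measurable_EFinP; rewrite (_ : _ \o _ = fun w => mu w (Q y)).
  exact: measurable_kernel.
by apply/funext => w; rewrite /= mu_count.
Qed.

Let m x y : R := fine (\int[P]_w (count x w * count y w)%:E)%E.

Let int2 x : (\int[P]_w (count x w ^+ 2)%:E <= M2%:E)%E.
Proof. by under eq_integral do rewrite EFin_expe -mu_count; exact: M2P. Qed.

Let integrable_count2 x y : P.-integrable setT (fun w => (count x w * count y w)%:E).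
Proof.
have i2 z : P.-integrable setT (fun w => (count z w ^+ 2)%:E).
  apply/integrableP; split.
    by apply/measurable_EFinP; apply: measurable_funX; exact: measurable_count.
  under eq_integral do rewrite gee0_abs ?lee_fin ?sqr_ge0//.
  by rewrite (le_lt_trans (int2 z))// ltry.
apply: (@le_integrable _ _ _ _ _ measurableT _ (fun w => (count x w ^+ 2)%:E + (count y w ^+ 2)%:E)%E).
- by apply/measurable_EFinP; apply: measurable_funM; exact: measurable_count.
- move=> w _; rewrite -EFinD /= lee_fin !ger0_norm ?mulr_ge0 ?addr_ge0 ?sqr_ge0//.
  by have := sqr_ge0 (count x w - count y w); have := mulr_ge0 (count0 x w) (count0 y w); nra.
- exact: integrableD.
Qed.

Let mE x y : (\int[P]_w (count x w * count y w)%:E = (m x y)%:E)%E.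
Proof. by rewrite fineK//; exact: integrable_fin_num. Qed.

Let mC x y : m x y = m y x.
Proof. by rewrite /m; under eq_integral do rewrite mulrC. Qed.

Let mxx x : 0 <= m x x <= M2.
Proof.
rewrite -!lee_fin -mE; apply/andP; split.
  by apply: integral_ge0 => w _; rewrite lee_fin mulr_ge0.
exact: int2.
Qed.

Let Ecount y : (\int[P]_w (count y w)%:E = v%:E)%E.
Proof.
by under eq_integral do rewrite -mu_count; rewrite mu_intensity// leb_cell.
Qed.

Let integrable_count y : P.-integrable setT (fun w => (count y w)%:E).
Proof.
apply/integrableP; split; first exact/measurable_EFinP/measurable_count.
under eq_integral do rewrite gee0_abs ?lee_fin//.
by rewrite Ecount ltry.
Qed.

(** The bound does not depend on the size of [s]: this is the gain from testing against a sum of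
    bumps. *)
Let row x (s : seq C) : uniq s -> x \notin s ->
  `|\sum_(y <- s) (m x y - v ^+ 2)| <= v * tv.
Proof.
move=> us xs.
have [u l] := expected_products d0 n0 mu_pp mu_intensity rpcm us xs.
have EE : (\int[P]_w (mu w (Q x) * \sum_(y <- s) mu w (Q y)) =
    (\sum_(y <- s) m x y)%:E)%E.
  under eq_integral do rewrite ge0_sume_distrr//.
  rewrite ge0_integral_sum//; last first.
    by move=> y; apply: emeasurable_funM; exact: measurable_kernel.
  rewrite -sumEFin; apply: eq_bigr => y _; rewrite -mE.
  by apply: eq_integral => w _; rewrite !mu_count.
move: u l; rewrite EE !lee_fin -/h -/v -/LL -/tv => u l.
rewrite sumrB big_const_seq count_predT iter_addr_0 ler_norml -mulr_natr.
by apply/andP; split; lra.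
Qed.

(** [row] is applied once to the cells of nonnegative covariance and once to the others, hence the
    factor 2. The diagonal term is bounded separately. *)
Let row_abs x : \sum_y `|m x y - v ^+ 2| <= M2 + v ^+ 2 + 2 * (v * tv).
Proof.
pose c y := m x y - v ^+ 2.
rewrite (bigD1 x)//=; apply: lerD.
  apply: (le_trans (ler_normB _ _)); have /andP[m0 m1] := mxx x.
  by rewrite !ger0_norm ?sqr_ge0// lerD2r.
rewrite (bigID (fun y => 0 <= c y))/= mulr2n mulrDl mul1r; apply: lerD.
  rewrite (eq_bigr c) => [|y /andP[_ cy]]; last by rewrite ger0_norm.
  rewrite -big_filter; apply: (le_trans (ler_norm _)); apply: row.
    by rewrite filter_uniq// index_enum_uniq.
  by rewrite mem_filter eqxx.
rewrite (eq_bigr (fun y => - c y)) => [|y /andP[_]]; last first.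
  by rewrite -ltNge => cy; rewrite ltr0_norm.
rewrite sumrN -big_filter; apply: (le_trans (ler_norm _)); rewrite normrN; apply: row.
  by rewrite filter_uniq// index_enum_uniq.
by rewrite mem_filter eqxx.
Qed.

Lemma second_moment_le (a : C -> R) :
  (\int[P]_w ((\sum_y a y * (count y w - v)) ^+ 2)%:E <=
   ((M2 + v ^+ 2 + 2 * (v * tv)) * \sum_y a y ^+ 2)%:E)%E.
Proof.
pose A := \sum_y a y.
(* Products of two counts and single counts form one finite family, so the expanded square is a
   linear combination plus a constant. *)
pose g (i : C * C + C) w := match i with inl p => count p.1 w * count p.2 w
  | inr y => count y w end.
pose c (i : C * C + C) := match i with inl p => a p.1 * a p.2
  | inr y => - 2 * v * A * a y end.
pose e (i : C * C + C) := match i with inl p => m p.1 p.2 | inr y => v end.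
have split_sum (f : (C * C + C)%type -> R) : \sum_i f i = \sum_x \sum_y f (inl (x, y)) + \sum_y f (inr y).
  by rewrite big_sumType pair_big/=; congr (_ + _); apply: eq_bigr => -[x y] _.
have expand w : (\sum_y a y * (count y w - v)) ^+ 2 = \sum_i c i * g i w + (v * A) ^+ 2.
  have -> : \sum_y a y * (count y w - v) = \sum_y a y * count y w - v * A.
    by rewrite /A mulr_sumr -sumrB; apply: eq_bigr => y _; ring.
  rewrite split_sum/=.
  have -> : \sum_x \sum_y a x * a y * (count x w * count y w) = (\sum_y a y * count y w) ^+ 2.
    rewrite expr2 mulr_suml; apply: eq_bigr => x _; rewrite mulr_sumr.
    by apply: eq_bigr => y _; ring.
  have -> : \sum_y - 2 * v * A * a y * count y w = - 2 * v * A * \sum_y a y * count y w.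
    by rewrite [RHS]mulr_sumr; apply: eq_bigr => y _; ring.
  by ring.
under eq_integral do rewrite expand.
rewrite (@integral_lincomb R _ O P _ g c e); last 2 first.
- by case=> [[x y]|y] /=; [exact: integrable_count2|exact: integrable_count].
- by case=> [[x y]|y] /=; [exact: mE|exact: Ecount].
rewrite lee_fin split_sum/=.
have -> : \sum_y - 2 * v * A * a y * v = - 2 * v ^+ 2 * A ^+ 2.
  by rewrite -mulr_suml -mulr_sumr -/A; ring.
have -> : \sum_x \sum_y a x * a y * m x y =
    \sum_x \sum_y a x * a y * (m x y - v ^+ 2) + v ^+ 2 * A ^+ 2.
  have -> : A ^+ 2 = \sum_x \sum_y a x * a y.
    by rewrite expr2 /A mulr_suml; apply: eq_bigr => x _; rewrite mulr_sumr.
  rewrite mulr_sumr -big_split/=; apply: eq_bigr => x _.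
  by rewrite mulr_sumr -big_split/=; apply: eq_bigr => y _; ring.
have := @quadratic_form_le R C (fun x y => m x y - v ^+ 2) _
  (fun x y => congr1 (fun z => z - v ^+ 2) (mC x y)) row_abs a.
by move: (\sum_x _) => S; rewrite exprMn; lra.
Qed.

End quadratic_form.

(** * Equality of laws and stationarity *)

Lemma eq_law_integral {R : realType} d1 d2 (X : measurableType d1)
    (Y : measurableType d2) (m : {measure set X -> \bar R}) (f g : X -> Y)
    (phi : Y -> \bar R) : measurable_fun setT f -> measurable_fun setT g ->
  measurable_fun setT phi -> (forall y, 0 <= phi y)%E ->
  (forall B, measurable B -> m (f @^-1` B) = m (g @^-1` B)) ->
  (\int[m]_x phi (f x) = \int[m]_x phi (g x))%E.
Proof.
move=> mf mg mphi phi0 fg.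
have E h : measurable_fun setT h ->
    (\int[pushforward m h]_y phi y = \int[m]_x phi (h x))%E.
  by move=> mh; rewrite ge0_integral_pushforward.
rewrite -(E f mf) -(E g mg).
pose mF := measure_function_pushforward__canonical__measure_function_Measure m mf.
pose mG := measure_function_pushforward__canonical__measure_function_Measure m mg.
by apply: (@eq_measure_integral _ _ _ _ mG mF) => B mB _; exact: fg.
Qed.

Section stationarity.
Context {R : realType} (d : nat) (dO : measure_display) (O : measurableType dO)
  (P : probability O R) (mu : R.-ker O ~> 'rV[R]_d).
Hypothesis mu_stationary : stationary P mu.

Lemma stationary_second_moment (x : 'rV[R]_d) (A : set 'rV[R]_d) : measurable A ->
  measurable ((+%R x) @^-1` A) ->
  (\int[P]_w (mu w ((+%R x) @^-1` A)) ^+ 2 = \int[P]_w (mu w A) ^+ 2)%E.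
Proof.
move=> mA mxA; have mf B : measurable B -> measurable_fun setT (fun w => mu w B).
  by move=> mB; exact: measurable_kernel.
have msq : measurable_fun setT (fun y : \bar R => y ^+ 2)%E.
  rewrite (_ : (fun y => _) = (fun y : \bar R => y * y)%E).
    by apply: emeasurable_funM; exact: measurable_id.
  by apply/funext => y; rewrite expe2.
apply: (eq_law_integral (mf _ mxA) (mf _ mA) msq) => [y|B mB]; first exact: sqre_ge0.
have := mu_stationary x (S := [set m | B (m A)]); apply.
by apply: sub_sigma_algebra; exists A, B.
Qed.

(** Every cell lies in a translate of one fixed box of side [H], so the bound is uniform in the cell
    and in [n]. *)
Lemma cell_second_moment n K (H : R) : (0 < n)%N ->
  locally_square_integrable P mu -> @mesh R d K n <= H -> forall y : cells d K,
  (\int[P]_w (mu w (cell n y)) ^+ 2 <=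
   (fine (\int[P]_w (mu w (obox (fun=> 0%R) (fun=> H))) ^+ 2))%:E)%E.
Proof.
move=> n0 sq hH y; set A := obox _ _.
have mA : measurable A by exact: measurable_obox.
have I0 : (0 <= \int[P]_w (mu w A) ^+ 2)%E.
  by apply: integral_ge0 => w _; exact: sqre_ge0.
rewrite fineK; last first.
  by rewrite ge0_fin_numE//; apply: sq => //; exact: bounded_obox.
pose x : 'rV[R]_d := - \row_i @lo R d K n y i.
have xA : (+%R x) @^-1` A = obox (@lo R d K n y) (fun i => @lo R d K n y i + H).
  apply/seteqP; split => u uA i; have /andP[l r] := uA i; move: l r; rewrite /x.
    by rewrite !mxE => l r; apply/andP; split; lra.
  by move=> /= l r; rewrite !mxE; apply/andP; split; lra.
rewrite -(@stationary_second_moment x A mA) xA; last exact: measurable_obox.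
apply: le_integral_nonneg => w _; first exact: sqre_ge0.
pose b (i : 'I_d) : R := @lo R d K n y i + H.
rewrite !expe2; have le : (mu w (cell n y) <= mu w (obox (@lo R d K n y) b))%E.
  apply: le_measure; rewrite ?inE; [exact: measurable_cell|exact: measurable_obox|].
  by move=> u uy i; have /andP[l /= r] := uy i; rewrite /b l (le_trans r)//= lerD2l.
by apply: lee_pmul.
Qed.

End stationarity.

(** The cost [F], an infimum over couplings, enters by pointwise comparison with squares whose
    measurability is clear. *)
Lemma integral_quadratic_le {R : realType} d0 (O : measurableType d0)
    (P : probability O R) (I J : finType) (X : I -> O -> R) (B k : R)
    (c : J -> R) (a : J -> I -> R) (F : O -> \bar R) :
  (forall i, measurable_fun setT (X i)) ->
  (forall b : I -> R, \int[P]_w ((\sum_i b i * X i w) ^+ 2)%:E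
      <= (B * \sum_i b i ^+ 2)%:E)%E ->
  0 <= k -> (forall j, 0 <= c j) -> (forall w, 0 <= F w)%E ->
  (forall w, F w <= (k + \sum_j c j * (\sum_i a j i * X i w) ^+ 2)%:E)%E ->
  (\int[P]_w F w <= (k + B * \sum_j c j * \sum_i a j i ^+ 2)%:E)%E.
Proof.
move=> mX XB k0 c0 F0 FE.
have mL j : measurable_fun setT (fun w => ((\sum_i a j i * X i w) ^+ 2)%:E).
  apply/measurable_EFinP; apply: measurable_funX; apply: measurable_sum => i.
  by apply: measurable_funM; [exact: measurable_cst|exact: mX].
have L0 j w : (0 <= ((\sum_i a j i * X i w) ^+ 2)%:E)%E by rewrite lee_fin sqr_ge0.
apply: le_trans (le_integral_nonneg _ (fun w _ => F0 w) (fun w _ => FE w)) _.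
under eq_integral do rewrite EFinD -sumEFin.
have mS : measurable_fun setT (fun w => \sum_j (c j * (\sum_i a j i * X i w) ^+ 2)%:E)%E.
  by apply: emeasurable_sum => j; under eq_fun do rewrite EFinM; exact: measurable_funeM.
have S0 w : (0 <= \sum_j (c j * (\sum_i a j i * X i w) ^+ 2)%:E)%E.
  by apply: sume_ge0 => j _; rewrite lee_fin mulr_ge0 ?sqr_ge0.
rewrite ge0_integralD//=.
rewrite integral_cst// [X in (_ * X)%E]probability_setT mule1 EFinD leeD2l//.
have mJ j : measurable_fun setT (fun w => (c j * (\sum_i a j i * X i w) ^+ 2)%:E).
  by under eq_fun do rewrite EFinM; exact: measurable_funeM.
have J0 j w : setT w -> (0 <= (c j * (\sum_i a j i * X i w) ^+ 2)%:E)%E.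
  by move=> _; rewrite lee_fin mulr_ge0 ?sqr_ge0.
rewrite (ge0_integral_sum P measurableT mJ J0).
rewrite mulr_sumr -sumEFin; apply: lee_sum => j _.
under eq_integral do rewrite EFinM; rewrite ge0_integralZl//.
  by rewrite mulrCA EFinM lee_wpmul2l ?lee_fin.
by rewrite lee_fin.
Qed.

(** Like [powR_le_D], this stands in for Jensen's inequality: at a well chosen scale, the power is
    dominated by an expression that can be summed against a plan or integrated. *)
Lemma powR_le_Dsqr {R : realType} (t A p : R) : 0 <= t -> 0 < A -> 0 < p <= 2 ->
  t `^ p <= A `^ p * (1 + (t / A) ^+ 2).
Proof.
move=> t0 A0 /andP[p0 p2]; have u0 : 0 <= t / A by rewrite divr_ge0// ltW.
have -> : t `^ p = A `^ p * (t / A) `^ p.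
  by rewrite -powRM ?(ltW A0)// mulrC divfK// gt_eqF.
rewrite ler_wpM2l ?powR_ge0//; have [u1|u1] := leP (t / A) 1.
  rewrite -[leLHS]addr0 lerD ?sqr_ge0//.
  apply: (@le_trans _ _ (1 `^ p)); last by rewrite powR1.
  by rewrite ge0_ler_powR ?nnegrE ?(ltW p0).
rewrite -[leLHS]add0r lerD// -powR_mulrn//.
by rewrite ler_powR// ltW.
Qed.

Lemma powR_le_D {R : realType} (x a p : R) : 0 <= x -> 0 < a -> 0 < p <= 1 ->
  x `^ p <= a `^ p * (1 + x / a).
Proof.
move=> x0 a0 /andP[p0 p1]; have u0 : 0 <= x / a by rewrite divr_ge0// ltW.
have -> : x `^ p = a `^ p * (x / a) `^ p.
  by rewrite -powRM ?(ltW a0)// mulrC divfK// gt_eqF.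
rewrite ler_wpM2l ?powR_ge0//; have [u1|u1] := leP (x / a) 1.
  rewrite -[leLHS]addr0 lerD//.
  apply: (@le_trans _ _ (1 `^ p)); last by rewrite powR1.
  by rewrite ge0_ler_powR ?nnegrE ?(ltW p0).
by rewrite -[leLHS]add0r lerD// ler1_powR// ltW.
Qed.

Lemma toric_Wp_ge0 {R : realType} d n (p : R) (mu nu : set 'rV[R]_d -> \bar R) :
  (0 <= toric_Wp n p mu nu)%E.
Proof.
apply: le_ereal_inf_tmp => _ [N _ <-]; apply: integral_ge0 => z _.
by rewrite lee_fin powR_ge0.
Qed.

(** * Cost of a realisation *)

Section pointwise.
Context {R : realType} (d K n : nat).
Hypothesis d0 : (0 < d)%N.
Hypothesis n0 : (0 < n)%N.
Hypothesis Kn : (2 ^ (d * K) <= n)%N.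
Let C := cells d K.
Let T := 'rV[R]_d.
Let Q : C -> set T := @cell R d K n.
Let h : R := @mesh R d K n.
Variable m : {measure set T -> \bar R}.
Hypothesis moo : (m (Lambda n) < +oo)%E.

Let cnt x := fine (m (Q x)).
Let mQ x : measurable (Q x). Proof. exact: measurable_cell. Qed.
Let mL : measurable (@Lambda R d n). Proof. exact: measurable_Lambda. Qed.
Let h0 : 0 < h. Proof. exact: mesh_gt0. Qed.

Lemma sum_cells (m' : {measure set T -> \bar R}) : (m' (Lambda n) < +oo)%E ->
  (forall x, m' (Q x) = (fine (m' (Q x)))%:E) /\
  m' (Lambda n) = (\sum_x fine (m' (Q x)))%:E.
Proof.
move=> m'oo; have H x : m' (Q x) = (fine (m' (Q x)))%:E.
  rewrite fineK// ge0_fin_numE// (le_lt_trans _ m'oo)//.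
  by apply: le_measure; rewrite ?inE//; exact: cell_sub.
split => //; rewrite -sumEFin.
rewrite (@measure_partition _ _ _ C m' Q) //.
- by apply: eq_bigr => x _; rewrite setIidr; [exact: H|exact: cell_sub].
- by move=> x y u; exact: cell_inj.
- exact: Lambda_cells.
Qed.

Let Lambda0 : @Lambda R d n 0.
Proof.
have s0 : 0 < pi * @side R d n by rewrite mulr_gt0 ?pi_gt0 ?side_gt0.
by move=> i; rewrite mxE oppr_lt0 s0 ltW.
Qed.

Lemma tilde_mu_measure : exists m' : {measure set T -> \bar R},
  [/\ forall A, measurable A -> A `<=` Lambda n -> tilde_mu n m A = m' A,
      m' (Lambda n) = n%:R%:E &
      \sum_x cnt x != 0 -> forall x, m' (Q x) = (n%:R / (\sum_x cnt x) * cnt x)%:E].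
Proof.
have [mQE mLE] := sum_cells moo.
have [mL0|mL0] := eqVneq (m (Lambda n)) 0%E.
  exists (mscale (NngNum (ler0n R n)) (dirac (0 : T))); split.
  - by move=> A mA AL; rewrite /tilde_mu mL0 eqxx.
  - transitivity (n%:R%:E * \d_(0%R : T) (@Lambda R d n) : \bar R)%E; first by [].
    by rewrite diracE mem_set ?mule1.
  - by move: mLE; rewrite mL0 => -[] <-; rewrite eqxx.
have N0 : 0 <= n%:R / fine (m (Lambda n)) by rewrite divr_ge0// fine_ge0.
exists (mscale (NngNum N0) (mrestr m mL)); split.
- by move=> A mA AL; rewrite /tilde_mu (negbTE mL0).
- transitivity ((n%:R / fine (m (Lambda n)))%:E * m (Lambda n `&` Lambda n))%E.
    by [].
  rewrite setIid [X in (_ * X)%E]mLE mLE/= -EFinM divfK//.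
  by move: mL0; rewrite mLE eqe.
- move=> _ x.
  transitivity ((n%:R / fine (m (Lambda n)))%:E * m (Q x `&` Lambda n))%E.
    by [].
  rewrite setIidl; last exact: cell_sub.
  by rewrite mQE mLE -EFinM.
Qed.

Let v : R := h ^+ d.
Let X x : R := cnt x - v.

(** The factor 2 and the last term come from splitting [dist1 x y + d%:R]: all the mass [n] may also
    move within its cell. The term in the squared sum of [X] covers a small total mass. *)
Definition sqr_cost : R :=
  2 * h ^+ 2 * (13 * (2 ^+ (d * K) + 12 * d%:R * \sum_x \sum_i grid_flow d0 X i x ^+ 2)
    + (d%:R * 2 ^+ K) ^+ 2 * ((\sum_x X x) ^+ 2 / n%:R) + d%:R ^+ 2 * n%:R).

Definition pow_cost (p : R) : R :=
  h `^ p * (1 + 12 * (\sum_(t < d * K) \sum_x (2 ^+ (t %/ d)) `^ p * `|haar d0 t X x|)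
    + (d%:R * 2 ^+ K) `^ p * `|\sum_x X x| + d%:R `^ p * n%:R).

Let n0' : 0 < n%:R :> R. Proof. by rewrite ltr0n. Qed.
Let q : R := n%:R / 2 ^+ (d * K).
Let q1 : 1 <= q.
Proof. by rewrite ler_pdivlMr ?exprn_gt0// mul1r -natrX ler_nat. Qed.
Let qE : n%:R = q * 2 ^+ (d * K).
Proof. by rewrite divfK// expf_neq0// pnatr_eq0. Qed.

Let vE : v = (2 * pi) ^+ d * q. Proof. exact: mesh_exp. Qed.
Let u2 : 2 <= (2 * pi) ^+ d :> R.
Proof.
have p1 : 1 <= 2 * pi :> R by have := @pi_ge2 R; lra.
apply: (@le_trans _ _ (2 * pi)); first by have := @pi_ge2 R; lra.
by rewrite -{1}(expr1 (2 * pi)) ler_weXn2l.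
Qed.

Let plan_mass nu M : is_plan (fun=> q) nu M -> \sum_x \sum_(y : C) M x y = n%:R.
Proof.
move=> [_ Mq _]; under eq_bigr do rewrite Mq.
by rewrite sumr_const card_cells -[LHS]mulr_natr natrX -qE.
Qed.

(** The plan itself is returned, with a bound for every nondecreasing [w], so that a plan built for
    the squared distance can be evaluated at another power. *)
Let exists_plan (k : C -> C -> R) (B : R) :
  (forall nu : C -> R, (forall x, 0 <= nu x) -> \sum_x nu x = n%:R ->
    (\sum_x cnt x != 0 -> forall x, nu x = n%:R / (\sum_x cnt x) * cnt x) ->
    exists2 M, is_plan (fun=> q) nu M & plan_cost k M <= B) ->
  exists M : C -> C -> R, [/\ forall x y, 0 <= M x y, \sum_x \sum_y M x y = n%:R,
    plan_cost k M <= B &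
    forall w : R -> R, (forall t, 0 <= t -> 0 <= w t) ->
      (forall t u, 0 <= t -> t <= u -> w t <= w u) ->
      (toric_cost n w (tilde_mu n m) (tilde_L n) <=
        (plan_cost (fun x y => w (h * (dist1 x y + d%:R))) M)%:E)%E].
Proof.
move=> H; have [m' [m'E m'L m'Q]] := tilde_mu_measure.
have m'oo : (m' (Lambda n) < +oo)%E by rewrite m'L ltry.
have [m'QE] := sum_cells m'oo; rewrite m'L => -[m'LE].
have [||| M pM cM] := H (fun x => fine (m' (Q x))).
- by move=> x; exact: fine_ge0.
- by rewrite -m'LE.
- by move=> N0 x; rewrite m'Q.
exists M; split => //.
- by case: pM.
- exact: plan_mass pM.
- by move=> w w0 wle; exact: (toric_cost_le_plan d0 n0 m'E m'QE pM).
Qed.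

Let powR_mono (p : R) : 0 < p -> (forall t, 0 <= t -> 0 <= t `^ p) /\
  (forall t u : R, 0 <= t -> t <= u -> t `^ p <= u `^ p).
Proof.
move=> p0; split=> [t _|t u t0 tu]; first exact: powR_ge0.
by rewrite ge0_ler_powR ?nnegrE ?(ltW p0)// (le_trans t0).
Qed.

Let sqr_plan : exists M : C -> C -> R, [/\ forall x y, 0 <= M x y,
    \sum_x \sum_y M x y = n%:R,
    plan_cost (fun x y => (h * (dist1 x y + d%:R)) ^+ 2) M <= sqr_cost &
    forall w : R -> R, (forall t, 0 <= t -> 0 <= w t) ->
      (forall t u, 0 <= t -> t <= u -> w t <= w u) ->
      (toric_cost n w (tilde_mu n m) (tilde_L n) <=
        (plan_cost (fun x y => w (h * (dist1 x y + d%:R))) M)%:E)%E].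
Proof.
have [|M [M0 Mn cM MW]] := @exists_plan (fun x y => dist1 x y ^+ 2)
  (13 * (2 ^+ (d * K) + 12 * d%:R * \sum_x \sum_i grid_flow d0 X i x ^+ 2)
    + (d%:R * 2 ^+ K) ^+ 2 * ((\sum_x X x) ^+ 2 / n%:R)).
  move=> nu nu0 nun nuE; have XE : X = (fun x => cnt x - (2 * pi) ^+ d * q).
    by apply/funext => x; rewrite /X vE.
  rewrite XE; apply: normalised_plan_sqr => // x; exact: fine_ge0.
exists M; split => //.
apply: (@le_trans _ _ (2 * h ^+ 2 * (plan_cost (fun x y => dist1 x y ^+ 2) M + d%:R ^+ 2 * n%:R))).
  rewrite -Mn [d%:R ^+ 2 * _]mulr_sumr -big_split mulr_sumr; apply: ler_sum => x _ /=.
  rewrite mulr_sumr -big_split mulr_sumr; apply: ler_sum => y _ /=.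
  have key : (h * (dist1 x y + d%:R)) ^+ 2 <= 2 * h ^+ 2 * (@dist1 R d K x y ^+ 2 + d%:R ^+ 2).
    rewrite -subr_ge0; have -> : 2 * h ^+ 2 * (@dist1 R d K x y ^+ 2 + d%:R ^+ 2)
      - (h * (dist1 x y + d%:R)) ^+ 2 = (h * (@dist1 R d K x y - d%:R)) ^+ 2 by ring.
    exact: sqr_ge0.
  apply: (le_trans (ler_wpM2l (M0 x y) key)).
  by rewrite le_eqVlt; apply/orP; left; apply/eqP; ring.
rewrite /sqr_cost; apply: ler_wpM2l; first by rewrite mulr_ge0// sqr_ge0.
by rewrite lerD2r.
Qed.

Lemma toric_W2_le : (toric_Wp n 2 (tilde_mu n m) (tilde_L n) <= sqr_cost%:E)%E.
Proof.
have [M [M0 Mn cM MW]] := sqr_plan; have [w0 wle] := powR_mono (ltr0n R 2).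
apply: (le_trans (MW _ w0 wle)); rewrite lee_fin (le_trans _ cM)// le_eqVlt.
apply/orP; left; apply/eqP; apply: eq_bigr => x _; apply: eq_bigr => y _.
by rewrite powR_mulrn// mulr_ge0 ?(ltW h0)// addr_ge0 ?dist1_ge0.
Qed.

Lemma toric_Wp_sqr_le (p a : R) : 0 < p <= 1 -> 0 < a ->
  (toric_Wp n p (tilde_mu n m) (tilde_L n) ^+ 2 <=
   (4 * n%:R ^+ 2 * a `^ p * (1 + sqr_cost / n%:R / a))%:E)%E.
Proof.
move=> p01 a0; have /andP[p0 p1] := p01.
have [M [M0 Mn cM MW]] := sqr_plan; have [w0 wle] := powR_mono p0.
pose D x y : R := h * (@dist1 R d K x y + d%:R).
have D0 x y : 0 <= D x y by rewrite mulr_ge0 ?(ltW h0)// addr_ge0 ?dist1_ge0.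
have G0 : 0 < sqr_cost.
  have S0 : 0 <= \sum_x \sum_i grid_flow d0 X i x ^+ 2.
    by apply: sumr_ge0 => x _; apply: sumr_ge0 => i _; exact: sqr_ge0.
  have T0 : 0 < 2 ^+ (d * K) :> R by rewrite exprn_gt0.
  rewrite /sqr_cost; apply: mulr_gt0; first by rewrite mulr_gt0// exprn_gt0.
  apply: ltr_wpDr; first by rewrite mulr_ge0// sqr_ge0.
  apply: ltr_wpDr; first by rewrite mulr_ge0 ?sqr_ge0// divr_ge0// sqr_ge0.
  by rewrite mulr_gt0// ltr_wpDr// !mulr_ge0.
(* [A ^+ 2] bounds the mean squared displacement; at this scale both terms of [powR_le_Dsqr]
   contribute at most [n] times the p-th power of [A]. *)
pose A := Num.sqrt (sqr_cost / n%:R).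
have A0 : 0 < A by rewrite sqrtr_gt0 divr_gt0.
have A2 : A ^+ 2 = sqr_cost / n%:R by rewrite sqr_sqrtr// divr_ge0// ltW.
have W_le : (toric_Wp n p (tilde_mu n m) (tilde_L n) <= (2 * n%:R * A `^ p)%:E)%E.
  apply: (le_trans (MW _ w0 wle)); rewrite lee_fin.
  apply: (@le_trans _ _ (\sum_x \sum_y M x y * (A `^ p * (1 + (D x y / A) ^+ 2)))).
    apply: ler_sum => x _; apply: ler_sum => y _; rewrite ler_wpM2l//.
    have p2 : 0 < p <= 2 by apply/andP; split => //; lra.
    exact: (powR_le_Dsqr (D0 x y) A0 p2).
  have -> : \sum_x \sum_y M x y * (A `^ p * (1 + (D x y / A) ^+ 2)) =
      A `^ p * (\sum_x \sum_y M x y + plan_cost (fun x y => D x y ^+ 2) M / A ^+ 2).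
    rewrite mulr_suml -big_split mulr_sumr; apply: eq_bigr => x _ /=.
    rewrite mulr_suml -big_split mulr_sumr; apply: eq_bigr => y _ /=.
    by field; rewrite gt_eqF.
  rewrite mulrC ler_wpM2r ?powR_ge0// Mn mulr2n mulrDl mul1r lerD2l.
  rewrite ler_pdivrMr ?exprn_gt0// A2 mulrCA divff ?mulr1// gt_eqF//.
have W0 := toric_Wp_ge0 n p (tilde_mu n m) (tilde_L n).
apply: (@le_trans _ _ ((2 * n%:R * A `^ p) ^+ 2)%:E).
  rewrite expe2 EFin_expe expe2; exact: lee_pmul.
rewrite lee_fin (_ : (2 * _ * _) ^+ 2 = 4 * n%:R ^+ 2 * (A `^ p) ^+ 2); last by ring.
rewrite -[leRHS]mulrA; apply: ler_wpM2l; first by rewrite mulr_ge0// sqr_ge0.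
(* The scale [a] stays free, to be set to the expected order of [A ^+ 2]. *)
rewrite expr2 -powRM ?(ltW A0)// -expr2 A2; apply: powR_le_D => //.
by rewrite divr_ge0// ltW.
Qed.

Lemma toric_Wp_le (p : R) : 0 < p <= 1 ->
  (toric_Wp n p (tilde_mu n m) (tilde_L n) <= (pow_cost p)%:E)%E.
Proof.
move=> p01; have /andP[p0 p1] := p01.
have [|M [M0 Mn cM MW]] := @exists_plan (fun x y => dist1 x y `^ p)
  (1 + 12 * (\sum_(t < d * K) \sum_x (2 ^+ (t %/ d)) `^ p * `|haar d0 t X x|)
    + (d%:R * 2 ^+ K) `^ p * `|\sum_x X x|).
  move=> nu nu0 nun nuE; have XE : X = (fun x => cnt x - (2 * pi) ^+ d * q).
    by apply/funext => x; rewrite /X vE.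
  rewrite XE; exact: (normalised_plan_powR d0 u2 q1 qE nu0 nun nuE p01).
have [w0 wle] := powR_mono p0.
apply: (le_trans (MW _ w0 wle)); rewrite lee_fin.
apply: (@le_trans _ _ (h `^ p * (plan_cost (fun x y => dist1 x y `^ p) M + d%:R `^ p * n%:R))).
  rewrite -Mn [d%:R `^ p * _]mulr_sumr -big_split mulr_sumr; apply: ler_sum => x _ /=.
  rewrite mulr_sumr -big_split mulr_sumr; apply: ler_sum => y _ /=.
  have key : (h * (dist1 x y + d%:R)) `^ p <= h `^ p * (@dist1 R d K x y `^ p + d%:R `^ p).
    rewrite powRM ?(ltW h0) ?addr_ge0 ?dist1_ge0// ler_wpM2l ?powR_ge0//.
    exact: powRD_le (dist1_ge0 _ _) (ler0n _ _) p01.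
  apply: (le_trans (ler_wpM2l (M0 x y) key)).
  by rewrite le_eqVlt; apply/orP; left; apply/eqP; ring.
rewrite /pow_cost; apply: ler_wpM2l; first exact: powR_ge0.
by rewrite lerD2r.
Qed.

End pointwise.

(** * Growth rates and expectations *)

Definition level (d n : nat) : nat := trunc_log (2 ^ d) n.

Section growth.
Context {R : realType}.

Lemma level_bounds d n : (0 < d)%N -> (0 < n)%N ->
  (2 ^ (d * level d n) <= n)%N /\ (n < 2 ^ (d * (level d n).+1))%N.
Proof.
move=> d0 n0; have d2 : (1 < 2 ^ d)%N by rewrite -{1}(expn0 2) ltn_exp2l.
by have /andP[] := trunc_log_bounds d2 n0; rewrite -!expnM.
Qed.

Lemma mesh_le d n : (0 < d)%N -> (0 < n)%N -> @mesh R d (level d n) n <= 4 * pi.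
Proof.
move=> d0 n0; have [_ nK] := level_bounds d0 n0.
have pi0 := @pi_gt0 R.
rewrite -(@ler_pXn2r _ d)//; last 2 first.
- by rewrite nnegrE ltW// mesh_gt0.
- by rewrite nnegrE mulr_ge0// ltW.
rewrite mesh_exp//; have -> : 4 * pi = 2 * pi * 2 :> R by ring.
rewrite [leRHS]exprMn ler_wpM2l ?exprn_ge0 ?mulr_ge0 ?(ltW pi0)//.
rewrite ler_pdivrMr ?exprn_gt0// -exprD -mulnS -natrX ler_nat ltnW//.
Qed.

Lemma expn_level d n : (0 < d)%N -> (0 < n)%N -> (2 ^ level d n <= n)%N.
Proof.
move=> d0 n0; have [Kn _] := level_bounds d0 n0; apply: leq_trans Kn.
by rewrite leq_exp2l// leq_pmull.
Qed.

Lemma level_ln d n : (0 < d)%N -> (0 < n)%N -> (level d n)%:R * ln 2 <= ln n%:R :> R.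
Proof.
move=> d0 n0; rewrite mulr_natl -lnXn// ler_ln ?posrE ?exprn_gt0 ?ltr0n//.
by rewrite -natrX ler_nat expn_level.
Qed.

Definition flow_weight (d K : nat) : R :=
  \sum_(t < d * K) 4 ^+ (t %/ d) / 2 ^+ t.+1.

Lemma flow_weight_le d K : (0 < d)%N ->
  flow_weight d K <= d%:R * \sum_(k < K) (4 / 2 ^+ d) ^+ k.
Proof.
move=> d0; rewrite /flow_weight; elim: K => [|K IH].
  by rewrite muln0 !big_ord0 mulr0.
rewrite mulnS addnC big_split_ord big_ord_recr mulrDr lerD//=.
apply: (@le_trans _ _ (\sum_(j < d) (4 / 2 ^+ d) ^+ K)).
  apply: ler_sum => j _.
  rewrite mulnC divnMDl// divn_small// addn0 expr_div_n -exprM mulnC.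
  rewrite ler_wpM2l ?exprn_ge0// lef_pV2 ?posrE ?exprn_gt0//.
  by rewrite ler_weXn2l ?ler1n// leqW// leq_addr.
by rewrite sumr_const card_ord -[leLHS]mulr_natl.
Qed.

Definition rate2 (d n : nat) : R :=
  if d == 1%N then n%:R ^+ 2 else if d == 2%N then n%:R * ln n%:R else n%:R.

Let ln2 : 0 < ln 2 :> R. Proof. by rewrite ln_gt0// ltr1n. Qed.
Let ln2_le n : (2 <= n)%N -> ln 2 <= ln n%:R :> R.
Proof. by move=> n2; rewrite ler_ln ?posrE ?ltr0n ?ler_nat// (leq_trans _ n2). Qed.

Lemma rate2_ge d : exists2 c : R, 0 < c & forall n, (2 <= n)%N -> n%:R <= c * rate2 d n.
Proof.
rewrite /rate2; have [_|d1] := eqVneq d 1%N.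
  exists 1 => // n n2; rewrite mul1r expr2 ler_peMl// ler1n; lia.
have [_|d2] := eqVneq d 2%N; last by exists 1 => // n; rewrite mul1r.
exists (ln 2)^-1; rewrite ?invr_gt0// => n n2.
by rewrite ler_pdivlMl// mulrC ler_wpM2l// ln2_le.
Qed.

(** Controls the squared diameter of the grid, paid when the total mass is small; for [d >= 2] it is
    at most the number of cells. *)
Lemma sqr_expn_level_le d : (0 < d)%N ->
  exists2 c : R, 0 < c & forall n, (2 <= n)%N -> (2 ^+ level d n) ^+ 2 <= c * rate2 d n.
Proof.
move=> d0; have [c c0 cP] := rate2_ge d; have [d1|d1] := eqVneq d 1%N.
  exists 1 => // n n2; rewrite /rate2 d1/= mul1r -natrX ler_sqr ?nnegrE// ler_nat.
  by rewrite expn_level// (leq_trans _ n2).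
exists c => // n n2; apply: le_trans (cP n n2).
have n0 : (0 < n)%N by rewrite (leq_trans _ n2).
have [Kn _] := level_bounds d0 n0.
rewrite -exprM -natrX ler_nat (leq_trans _ Kn)// leq_exp2l// mulnC leq_mul2r.
by rewrite orbC; lia.
Qed.

Lemma geometric_le (x : R) k : 0 <= x < 1 -> \sum_(i < k) x ^+ i <= (1 - x)^-1.
Proof.
move=> /andP[x0 x1]; have x10 : 0 < 1 - x by rewrite subr_gt0.
rewrite -[leRHS]mul1r ler_pdivlMr// mulrC -[leLHS]opprK -mulNr opprB -subrX1.
by rewrite opprB gerBl exprn_ge0.
Qed.

Lemma geometric_le_last (x : R) k : 1 < x ->
  \sum_(i < k.+1) x ^+ i <= x / (x - 1) * x ^+ k.
Proof.
move=> x1; have x10 : 0 < x - 1 by rewrite subr_gt0.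
rewrite mulrAC ler_pdivlMr// mulrC -subrX1 exprS gerBl//.
Qed.

(** The ratio [4 / 2 ^+ d] is 2, 1 or at most 1/2: the last level dominates, all levels weigh the
    same, or the series converges. *)
Lemma flow_weight_rate d : (0 < d)%N ->
  exists2 c : R, 0 < c & forall n, (2 <= n)%N ->
    n%:R * flow_weight d (level d n) <= c * rate2 d n.
Proof.
move=> d0.
suff [c c0 cP] : exists2 c : R, 0 < c & forall n, (2 <= n)%N ->
    n%:R * \sum_(k < level d n) (4 / 2 ^+ d) ^+ k <= c * rate2 d n.
  exists (d%:R * c); first by rewrite mulr_gt0// ltr0n.
  move=> n n2; rewrite -mulrA; apply: le_trans (ler_wpM2l (ler0n R d) (cP n n2)).
  by rewrite mulrCA; apply: ler_wpM2l => //; exact: flow_weight_le.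
rewrite /rate2; have [->|d1] := eqVneq d 1%N.
  exists 2 => // n n2; have -> : 4 / 2 ^+ 1 = 2 :> R by field.
  have n0 : (0 < n)%N by rewrite (leq_trans _ n2).
  rewrite expr2 mulrCA ler_wpM2l//.
  have := expn_level (ltn0Sn 0) n0; case: (level 1 n) => [_|k kn].
    by rewrite big_ord0 mulr_ge0.
  apply: le_trans (geometric_le_last k _) _; first by rewrite ltr1n.
  have -> : 2 / (2 - 1) * 2 ^+ k = 2 ^+ k.+1 :> R by rewrite exprS; field.
  rewrite -natrX; apply: (@le_trans _ _ n%:R); first by rewrite ler_nat.
  by rewrite ler_peMl// ler1n.
have [->|d2] := eqVneq d 2%N.
  exists (ln 2)^-1; first by rewrite invr_gt0.
  move=> n n2; have -> : 4 / 2 ^+ 2 = 1 :> R by field.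
  rewrite mulrCA ler_wpM2l// ler_pdivlMl//.
  under eq_bigr do rewrite expr1n.
  by rewrite sumr_const card_ord mulrC level_ln// (leq_trans _ n2).
exists 2 => // n n2; rewrite mulrC ler_wpM2r//.
have r1 : 4 / 2 ^+ d <= 2^-1 :> R.
  rewrite ler_pdivrMr ?exprn_gt0// mulrC ler_pdivlMr//.
  have -> : 4 * 2 = 2 ^+ 3 :> R by ring.
  by rewrite ler_weXn2l ?ler1n//; lia.
apply: (@le_trans _ _ (\sum_(k < level d n) 2^-1 ^+ k)).
  apply: ler_sum => k _; apply: lerXn2r => //; rewrite nnegrE ?divr_ge0 ?exprn_ge0//.
have h2 : 0 <= (2^-1 : R) < 1 by lra.
apply: le_trans (geometric_le _ h2) _.
by rewrite le_eqVlt; apply/orP; left; apply/eqP; field.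
Qed.

Lemma powRX (a p : R) k : 0 <= a -> (a ^+ k) `^ p = (a `^ p) ^+ k.
Proof. move=> a0; rewrite -[LHS]/((a ^+ k) `^ p) -(powR_mulrn k a0).
by rewrite -(powR_mulrn k (powR_ge0 a p)) -[LHS]powRrM -[RHS]powRrM mulrC. Qed.

(* [alpha 1 n b p] without its factor [Num.sqrt b * n]. *)
Definition rate (p : R) (n : nat) : R :=
  if 2^-1 < p then n%:R `^ (p - 2^-1)
  else if p == 2^-1 then ln n%:R else Num.sqrt (ln n%:R).

(** The ratio is above, equal to or below 1 as [p] is with respect to 1/2. Below, the sum is
    bounded, and [2 <= n] compares a constant with the square root of the logarithm. The extra term
    [t = level 1 n] will account for the total mass. *)
Lemma sum_powR_rate (p : R) :
  exists2 c : R, 0 < c & forall n, (2 <= n)%N ->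
    \sum_(t < (level 1 n).+1) (2 `^ (p - 2^-1)) ^+ t <= c * rate p n.
Proof.
rewrite /rate; set r := 2 `^ (p - 2^-1); have [p2|p2] := ltP 2^-1 p.
  have r1 : 1 < r by rewrite /r /powR pnatr_eq0 expR_gt1 mulr_gt0// subr_gt0.
  exists (r / (r - 1)); first by rewrite divr_gt0 ?subr_gt0// (lt_trans _ r1).
  move=> n n2; apply: le_trans (geometric_le_last _ r1) _.
  rewrite ler_wpM2l ?divr_ge0 ?subr_ge0 ?(ltW r1) ?powR_ge0//.
  rewrite -powRX// ge0_ler_powR ?nnegrE ?subr_ge0 ?(ltW p2) ?exprn_ge0//.
  by rewrite -natrX ler_nat expn_level// (leq_trans _ n2).
have [pE|pN] := eqVneq p 2^-1.
  exists (2 / ln 2); first by rewrite divr_gt0.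
  move=> n n2; have r1 : r = 1 by rewrite /r pE subrr powRr0.
  under eq_bigr do rewrite r1 expr1n.
  rewrite sumr_const card_ord mulrAC ler_pdivlMr//.
  have -> : (level 1 n).+1%:R = (level 1 n)%:R + 1 :> R by rewrite -natr1.
  have k1 := @level_ln 1 n (ltn0Sn 0) (leq_trans (ltn0Sn 1) n2); have k2 := ln2_le n2.
  by rewrite mulrDl mul1r mulr2n mulrDl mul1r lerD.
have r1 : r < 1 by rewrite /r /powR pnatr_eq0 expR_lt1 pmulr_llt0// subr_lt0 lt_neqAle pN.
exists ((1 - r)^-1 / Num.sqrt (ln 2)).
  by rewrite divr_gt0 ?invr_gt0 ?subr_gt0 ?sqrtr_gt0.
move=> n n2; apply: (@le_trans _ _ (1 - r)^-1).
  by apply: geometric_le; rewrite powR_ge0.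
rewrite -mulrA ler_peMr ?invr_ge0 ?subr_ge0 ?(ltW r1)//.
by rewrite ler_pdivlMl ?sqrtr_gt0// mulr1 ler_wsqrtr// ln2_le.
Qed.

End growth.

Lemma poweR_half_le {R : realType} (x : \bar R) (y : R) :
  (0 <= x)%E -> (x <= y%:E)%E -> (x `^ 2^-1 <= (Num.sqrt y)%:E)%E.
Proof.
move=> x0 xy; have y0 : 0 <= y by rewrite -lee_fin (le_trans x0).
rewrite -powR12_sqrt// -poweR_EFin; apply: gt0_ler_poweR => //.
- by rewrite in_itv/= x0 leey.
- by rewrite in_itv/= lee_fin y0 leey.
Qed.

(** * Expected quadratic cost and its consequences *)

Section assembly.
Context {R : realType} (d : nat) (dO : measure_display) (O : measurableType dO)
  (P : probability O R) (mu : R.-ker O ~> 'rV[R]_d) (beta : set 'rV[R]_d -> \bar R).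
Hypothesis d0 : (0 < d)%N.
Hypothesis mu_pp : point_process mu.
Hypothesis mu_stationary : stationary P mu.
Hypothesis mu_intensity : unit_intensity P mu.
Hypothesis mu_square : locally_square_integrable P mu.
Hypothesis rpcm : is_rpcm P mu beta.

Let H : R := 4 * pi.
Let H0 : 0 < H. Proof. by rewrite mulr_gt0// pi_gt0. Qed.

Lemma bn_ge1 n : (0 < n)%N -> 1 <= bn beta n.
Proof.
move=> n0; have [_ tv0] := total_variation_LambdaD n d0 rpcm.
by rewrite /bn lerDl.
Qed.

Lemma count_quadratic_le : exists2 B : R, 0 < B & forall n, (2 <= n)%N ->
  let K := level d n in forall a : cells d K -> R,
  (\int[P]_w ((\sum_y a y * (count n mu y w - @mesh R d K n ^+ d)) ^+ 2)%:E <=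
    (B * bn beta n * \sum_y a y ^+ 2)%:E)%E.
Proof.
pose M := fine (\int[P]_w (mu w (obox (fun=> 0%R) (fun=> H))) ^+ 2)%E.
have M0 : 0 <= M by apply: fine_ge0; apply: integral_ge0 => w _; exact: sqre_ge0.
have Hd : 0 < H ^+ d by rewrite exprn_gt0.
(* The terms come from the diagonal second moments, the squared cell volume and the off-diagonal
   rows, the mesh being at most [H] for every [n]. *)
exists (M + (H ^+ d) ^+ 2 + 2 * H ^+ d).
  by rewrite ltr_wpDl ?addr_ge0 ?sqr_ge0// mulr_gt0.
move=> n n2 K a; have n0 : (0 < n)%N by rewrite (leq_trans _ n2).
have hH : @mesh R d K n <= H by exact: mesh_le.
have M2P := cell_second_moment mu_stationary n0 mu_square hH.
have h0 : 0 < @mesh R d K n by exact: mesh_gt0.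
apply: le_trans (second_moment_le d0 n0 mu_pp mu_intensity rpcm M2P a) _.
rewrite lee_fin; apply: ler_wpM2r; first by apply: sumr_ge0 => y _; exact: sqr_ge0.
have [_ tv0] := total_variation_LambdaD n d0 rpcm; rewrite -/M /bn.
set tv := fine _ in tv0 *.
have v0 : 0 <= @mesh R d K n ^+ d by rewrite exprn_ge0// ltW.
have vH : @mesh R d K n ^+ d <= H ^+ d by rewrite lerXn2r ?nnegrE ?(ltW h0) ?(ltW H0).
move: v0 vH Hd; move: (mesh _ _ _ ^+ d) (H ^+ d) => v u v0 vu u0.
have : v ^+ 2 <= u ^+ 2 by rewrite ler_sqr ?nnegrE// ltW.
have : v * tv <= u * tv by rewrite ler_wpM2r.
have : 0 <= M * tv by rewrite mulr_ge0.
have : 0 <= u ^+ 2 * tv by rewrite mulr_ge0// sqr_ge0.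
nra.
Qed.

(** Affine functions of [sqr_cost] are allowed because the exponents [p <= 1] use a linearised
    power; the quadratic cost itself is the case [k = 0], [e = 1]. *)
Lemma integral_sqr_cost_le : exists2 c : R, 0 < c & forall n, (2 <= n)%N ->
  forall (k e : R) (F : O -> \bar R), 0 <= k -> 0 <= e -> (forall w, 0 <= F w)%E ->
  (forall w, F w <= (k + e * sqr_cost (level d n) n d0 (mu w))%:E)%E ->
  (\int[P]_w F w <= (k + e * (c * (bn beta n * rate2 d n)))%:E)%E.
Proof.
have [B B0 BP] := count_quadratic_le.
have [c1 c10 c1P] := @rate2_ge R d.
have [c2 c20 c2P] := @sqr_expn_level_le R _ d0.
have [c3 c30 c3P] := @flow_weight_rate R _ d0.
pose D : R := d%:R; have D0 : 0 < D by rewrite ltr0n.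
exists (2 * H ^+ 2 * ((13 + D ^+ 2) * c1 + B * (156 * D * c3 + D ^+ 2 * c2))).
  have D2 : 0 < D ^+ 2 by rewrite exprn_gt0.
  apply: mulr_gt0; first by rewrite mulr_gt0// exprn_gt0.
  apply: addr_gt0; apply: mulr_gt0 => //; apply: addr_gt0 => //; last exact: mulr_gt0.
  by apply: mulr_gt0 => //; exact: mulr_gt0.
move=> n n2 k e F k0 e0 F0; have n0 : (0 < n)%N by rewrite (leq_trans _ n2).
set K := level d n => FE; set h : R := @mesh R d K n.
have h0 : 0 < h by exact: mesh_gt0.
have hH : h <= H by exact: mesh_le.
pose X (y : cells d K) w : R := count n mu y w - h ^+ d.
pose T : R := 2 ^+ (d * K); have T0 : 0 < T by rewrite exprn_gt0.
have TE : (#|{: cells d K}|)%:R = T by rewrite card_cells natrX.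
have N0 : 0 < n%:R :> R by rewrite ltr0n.
have Tn : T <= n%:R by rewrite /T -natrX ler_nat; have [] := level_bounds d0 n0.
pose p : R := 2 * h ^+ 2 * (156 * D); pose q : R := 2 * h ^+ 2 * (D * 2 ^+ K) ^+ 2 / n%:R.
have p0 : 0 <= p by apply: mulr_ge0; apply: mulr_ge0 => //; exact: sqr_ge0.
have q0 : 0 <= q.
  by apply: divr_ge0 => //; apply: mulr_ge0; [apply: mulr_ge0 => //|]; exact: sqr_ge0.
pose k' := k + e * (2 * h ^+ 2 * (13 * T + D ^+ 2 * n%:R)).
(* The squares in [sqr_cost] are indexed by the flow rows, with weight [p] where 156 is 13 times 12,
   and by the total mass, with weight [q]. *)
pose c (j : ('I_d * cells d K) + unit) := e * (if j is inl _ then p else q).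
pose a (j : ('I_d * cells d K) + unit) (y : cells d K) : R :=
  if j is inl ix then flow_row d0 ix.1 ix.2 y else 1.
have sum_J (G : ('I_d * cells d K) + unit -> R) :
    \sum_j G j = \sum_x \sum_i G (inl (i, x)) + G (inr tt).
  rewrite big_sumType/= [X in _ + X](big_pred1 tt); last by case.
  by rewrite exchange_big pair_big; congr (_ + _); apply: eq_bigr => -[i x].
have mX y : measurable_fun setT (X y).
  by apply: measurable_funB; [exact: measurable_count|exact: measurable_cst].
have k'0 : 0 <= k'.
  apply: addr_ge0 => //; apply: mulr_ge0 => //; apply: mulr_ge0.
    by apply: mulr_ge0 => //; exact: sqr_ge0.
  by apply: addr_ge0; apply: mulr_ge0; rewrite ?sqr_ge0// ltW.
have c0 j : 0 <= c j by rewrite /c mulr_ge0//; case: j.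
have FE' w : (F w <= (k' + \sum_j c j * (\sum_y a j y * X y w) ^+ 2)%:E)%E.
  apply: (le_trans (FE w)); rewrite lee_fin le_eqVlt; apply/orP; left; apply/eqP.
  rewrite sum_J.
  have -> : \sum_x \sum_i c (inl (i, x)) * (\sum_y a (inl (i, x)) y * X y w) ^+ 2 =
      e * p * \sum_x \sum_i grid_flow d0 (X^~ w) i x ^+ 2.
    rewrite mulr_sumr; apply: eq_bigr => x _; rewrite mulr_sumr.
    by apply: eq_bigr => i _; rewrite grid_flowE.
  have -> : \sum_y a (inr tt) y * X y w = \sum_y X y w.
    by apply: eq_bigr => y _; rewrite mul1r.
  rewrite /sqr_cost -/h -/T -/D /k' /c /p /q.
  have -> : (fun x => fine (mu w (cell n x)) - h ^+ d) = X^~ w by [].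
  set S1 := \sum_x \sum_i _; set S2 := \sum_x _.
  by ring.
have := integral_quadratic_le mX (BP n n2) k'0 c0 F0 FE'.
move/le_trans; apply; rewrite lee_fin sum_J; set b := bn beta n.
have b1 : 1 <= b by exact: bn_ge1.
have A0 : 0 < rate2 d n :> R.
  by rewrite -(pmulr_rgt0 _ c10); apply: lt_le_trans N0 (c1P n n2).
have SX : \sum_x \sum_i c (inl (i, x)) * \sum_y a (inl (i, x)) y ^+ 2 <=
    e * p * (T * flow_weight d K).
  rewrite -TE -sum1_card natr_sum mulr_suml mulr_sumr; apply: ler_sum => x _.
  rewrite (_ : \sum_i _ = e * p * \sum_i \sum_y flow_row d0 i x y ^+ 2); last first.
    by rewrite mulr_sumr.
  rewrite mul1r; apply: ler_wpM2l; first exact: mulr_ge0.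
  exact: flow_rows_norm.
have ST : c (inr tt) * \sum_y a (inr tt) y ^+ 2 = e * q * T.
  under eq_bigr do rewrite expr1n.
  by rewrite sumr_const -TE.
have W0 : 0 <= flow_weight d K :> R.
  by apply: sumr_ge0 => t _; rewrite divr_ge0// exprn_ge0.
have h2 : 2 * h ^+ 2 <= 2 * H ^+ 2 by rewrite ler_wpM2l// lerXn2r ?nnegrE// ltW.
have h20 : 0 <= 2 * h ^+ 2 by apply: mulr_ge0 => //; exact: sqr_ge0.
have ePk : 2 * h ^+ 2 * (13 * T + D ^+ 2 * n%:R) <=
    2 * H ^+ 2 * ((13 + D ^+ 2) * (c1 * rate2 d n)).
  have T13 : 0 <= 13 * T by apply: mulr_ge0 => //; exact: ltW.
  apply: ler_pM => //; first by apply: addr_ge0 => //; apply: mulr_ge0 => //; exact: sqr_ge0.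
  rewrite [leRHS]mulrDl; apply: lerD; apply: ler_wpM2l; rewrite ?sqr_ge0//.
  - exact: le_trans Tn (c1P n n2).
  - exact: c1P.
have ePp : p * (T * flow_weight d K) <= 2 * H ^+ 2 * (156 * D) * (c3 * rate2 d n).
  apply: ler_pM => //; first by rewrite mulr_ge0// ltW.
    by rewrite ler_wpM2r// mulr_ge0// ltW.
  apply: le_trans (c3P n n2); exact: ler_wpM2r.
have ePq : q * T <= 2 * H ^+ 2 * D ^+ 2 * (c2 * rate2 d n).
  have -> : q * T = 2 * h ^+ 2 * D ^+ 2 * ((2 ^+ K) ^+ 2 * (T / n%:R)) by rewrite /q; ring.
  have T1 : T / n%:R <= 1 by rewrite ler_pdivrMr// mul1r.
  apply: ler_pM.
  - by rewrite mulr_ge0// sqr_ge0.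
  - by rewrite mulr_ge0 ?sqr_ge0// divr_ge0// ltW.
  - by rewrite ler_wpM2r// sqr_ge0.
  - by apply: le_trans (c2P n n2); rewrite ler_piMr// sqr_ge0.
have Bb0 : 0 <= B * b by rewrite mulr_ge0 ?(ltW B0)// (le_trans _ b1).
move: (rate2 d n) A0 ePk ePp ePq SX => A A0 ePk ePp ePq SX.
apply: (@le_trans _ _ (k + e * (2 * H ^+ 2 * ((13 + D ^+ 2) * (c1 * A))) +
    B * b * (e * (2 * H ^+ 2 * (156 * D) * (c3 * A)) + e * (2 * H ^+ 2 * D ^+ 2 * (c2 * A))))).
  apply: lerD; first by rewrite /k' lerD2l ler_wpM2l.
  apply: ler_wpM2l => //; apply: lerD.
    by apply: (le_trans SX); rewrite -mulrA ler_wpM2l.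
  by rewrite ST -mulrA ler_wpM2l.
set U := 2 * H ^+ 2 * ((13 + D ^+ 2) * (c1 * A)).
have U0 : 0 <= U.
  apply: mulr_ge0; first by apply: mulr_ge0 => //; exact: sqr_ge0.
  apply: mulr_ge0; first by apply: addr_ge0 => //; exact: sqr_ge0.
  by apply: mulr_ge0; exact: ltW.
apply: (@le_trans _ _ (k + e * (U * b) +
    B * b * (e * (2 * H ^+ 2 * (156 * D) * (c3 * A)) + e * (2 * H ^+ 2 * D ^+ 2 * (c2 * A))))).
  by rewrite lerD2r lerD2l ler_wpM2l// ler_peMr.
by rewrite le_eqVlt; apply/orP; left; apply/eqP; rewrite /U; ring.
Qed.

Let Lambda_fin n w : (mu w (Lambda n) < +oo)%E.
Proof. by case: mu_pp => + _; apply; [exact: measurable_Lambda|exact: bounded_Lambda]. Qed.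

Lemma integral_toric_W2_le : exists c : R, forall n, (2 <= n)%N ->
  (\int[P]_w toric_Wp n 2 (tilde_mu n (mu w)) (tilde_L n) <=
    (c * alpha2 d n (bn beta n))%:E)%E.
Proof.
have [c c0 cP] := integral_sqr_cost_le; exists c => n n2.
have n0 : (0 < n)%N by rewrite (leq_trans _ n2).
have [Kn _] := level_bounds d0 n0.
have := cP n n2 0 1 (fun w => toric_Wp n 2 (tilde_mu n (mu w)) (tilde_L n)).
rewrite add0r mul1r; apply=> // w; first exact: toric_Wp_ge0.
by rewrite add0r mul1r; exact: toric_W2_le.
Qed.

Lemma integral_toric_Wp_sqr_le (p : R) : d != 1%N -> 0 < p <= 1 ->
  exists c : R, forall n, (2 <= n)%N ->
    ((\int[P]_w (toric_Wp n p (tilde_mu n (mu w)) (tilde_L n)) ^+ 2) `^ 2^-1 <=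
      (c * alpha d n (bn beta n) p)%:E)%E.
Proof.
move=> d1 p01; have [c c0 cP] := integral_sqr_cost_le.
exists (2 * Num.sqrt (1 + c)) => n n2.
have n0 : (0 < n)%N by rewrite (leq_trans _ n2).
have [Kn _] := level_bounds d0 n0; have N0 : 0 < n%:R :> R by rewrite ltr0n.
pose L : R := if d == 2%N then ln n%:R else 1.
have L0 : 0 < L by rewrite /L; case: ifP => // _; rewrite ln_gt0// ltr1n.
have rateE : rate2 d n = n%:R * L.
  by rewrite /rate2 /L (negbTE d1); case: ifP => // _; rewrite mulr1.
set b := bn beta n; have b0 : 0 < b by rewrite (lt_le_trans _ (bn_ge1 n0)).
(* [b * L] is the order bounding the expected mean squared displacement; it is the scale at which
   the power is linearised. *)
have a0 : 0 < b * L by rewrite mulr_gt0.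
pose E : R := 4 * n%:R ^+ 2 * (b * L) `^ p.
have E0 : 0 <= E by rewrite mulr_ge0 ?powR_ge0// mulr_ge0// sqr_ge0.
have W0 w : (0 <= toric_Wp n p (tilde_mu n (mu w)) (tilde_L n) ^+ 2)%E.
  exact: sqre_ge0.
have -> : 2 * Num.sqrt (1 + c) * alpha d n b p = Num.sqrt (E * (1 + c)).
  have -> : alpha d n b p = Num.sqrt ((b * L) `^ p) * n%:R.
    rewrite /alpha (negbTE d1) powRM ?(ltW b0) ?(ltW L0)// sqrtrM ?powR_ge0// /L.
    by case: ifP => _; rewrite ?powR1 ?sqrtr1 ?mulr1//; ring.
  rewrite sqrtrM// /E sqrtrM; last by rewrite mulr_ge0// sqr_ge0.
  have -> : 4 * n%:R ^+ 2 = (2 * n%:R) ^+ 2 :> R by ring.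
  by rewrite sqrtr_sqr ger0_norm ?mulr_ge0//; ring.
apply: poweR_half_le; first by apply: integral_ge0 => w _; exact: W0.
have eE : E * (1 + c) = E + E / n%:R / (b * L) * (c * (b * rate2 d n)).
  by rewrite rateE; field; rewrite ?gt_eqF.
rewrite eE; apply: cP => //; first by rewrite !divr_ge0 ?(ltW a0).
move=> w; apply: (le_trans (toric_Wp_sqr_le d0 n0 Kn (Lambda_fin n w) p01 a0)).
by rewrite lee_fin le_eqVlt; apply/orP; left; apply/eqP; rewrite /E; ring.
Qed.

End assembly.

(** * Exponents at most one on the line *)

Section line.
Context {R : realType} (p : R).
Hypothesis p01 : 0 < p <= 1.
Let d0 : (0 < 1)%N := ltn0Sn 0.

Let rho : R := 2 `^ (- 2^-1).
Let sigma : R := 2 `^ 2^-1.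
Let r : R := 2 `^ (p - 2^-1).

Let rho0 : 0 < rho. Proof. exact: powR_gt0. Qed.
Let sigma0 : 0 < sigma. Proof. exact: powR_gt0. Qed.

Let rho2 : rho ^+ 2 = 2^-1.
Proof. by rewrite /rho powRN powR12_sqrt// exprVn sqr_sqrtr. Qed.

Let sigma2 : sigma ^+ 2 = 2.
Proof. by rewrite /sigma powR12_sqrt// sqr_sqrtr. Qed.

Let rE : 2 `^ p * rho = r.
Proof. by rewrite -powRD ?pnatr_eq0 ?implybT. Qed.

Let rE2 : 2 `^ p * sigma = 2 * r.
Proof.
have -> : 2 * r = 2 `^ 1 * r by rewrite powRr1.
by rewrite -!powRD ?pnatr_eq0 ?implybT//; congr powR; field.
Qed.

Let J K := ('I_(1 * K) * cells 1 K + unit)%type.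
Let a K (j : J K) : cells 1 K -> R := match j with
  | inl tx => haar_row d0 tx.1 tx.2 | inr _ => fun=> 1 end.
Let c K (j : J K) : R := match j with
  | inl tx => 12 * (2 ^+ (tx.1 %/ 1)) `^ p | inr _ => (1 * 2 ^+ K) `^ p end.
(* The standard deviation of [\sum_y a j y * X y], up to a constant, when the
   quadratic form of [X] is bounded. *)
Let u K (j : J K) : R := match j with
  | inl tx => rho ^+ tx.1 | inr _ => sigma ^+ K end.

Let c0 K (j : J K) : 0 <= c j.
Proof. by case: j => [tx|?]; rewrite /c ?mulr_ge0 ?powR_ge0. Qed.
Let u0 K (j : J K) : 0 < u j.
Proof. by case: j => [tx|?]; rewrite /u exprn_gt0. Qed.

Let sum_J K (G : J K -> R) :
  \sum_j G j = \sum_t \sum_x G (inl (t, x)) + G (inr tt).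
Proof.
rewrite big_sumType/= [X in _ + X](big_pred1 tt); last by case.
by rewrite pair_big; congr (_ + _); apply: eq_bigr => -[t x].
Qed.

Let a_norm K (j : J K) : \sum_y a j y ^+ 2 <= u j ^+ 2.
Proof.
case: j => [[t x]|_] /=.
  rewrite haar_row_norm ?ltn_ord// exprAC rho2 exprVn.
  by rewrite lef_pV2 ?posrE ?exprn_gt0// ler_weXn2l ?ler1n.
under eq_bigr do rewrite expr1n.
by rewrite sumr_const card_cells mul1n natrX exprAC sigma2.
Qed.

(** Level [t] contributes [12 * 2 ^+ K * r ^+ t] over its cells; by [rE2] the total mass contributes
    [2 ^+ K * r ^+ K], like one further level. *)
Let sum_cu K : \sum_(j : J K) c j * u j <=
  12 * 2 ^+ K * \sum_(t < K.+1) r ^+ t.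
Proof.
rewrite sum_J /= big_ord_recr /= mulrDr; apply: lerD.
  rewrite mulr_sumr; have := mul1n K; move: (1 * K)%N => K' ->.
  apply: ler_sum => t _; rewrite sumr_const card_cells mul1n.
  by rewrite divn1 powRX// -rE exprMn -[leLHS]mulr_natr natrX le_eqVlt; apply/orP; left; apply/eqP; ring.
rewrite mul1r powRX// -exprMn rE2 exprMn ler_wpM2r ?exprn_ge0 ?powR_ge0//.
by rewrite ler_peMl ?exprn_ge0// ler1n.
Qed.

(** Cauchy-Schwarz with weights [c j * u j]. In expectation the second factor is again at most of
    the order of their sum, so the squared cost is controlled by the square of a sum of standard
    deviations. *)
Let pow_cost_sqr K n (m : {measure set 'rV[R]_1 -> \bar R}) :
  pow_cost K n d0 m p ^+ 2 <= 2 * (mesh 1 K n `^ p) ^+ 2 *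
    ((1 + n%:R) ^+ 2 + (\sum_(j : J K) c j * u j) *
      \sum_(j : J K) c j / u j *
        (\sum_y a j y * (fine (m (cell n y)) - @mesh R 1 K n ^+ 1)) ^+ 2).
Proof.
pose X (y : cells 1 K) := fine (m (cell n y)) - @mesh R 1 K n ^+ 1; pose S := \sum_(j : J K) c j * `|\sum_y a j y * X y|.
have -> : pow_cost K n d0 m p = mesh 1 K n `^ p * (1 + n%:R + S).
  rewrite /pow_cost powR1 mul1r.
  have -> : S = 12 * (\sum_(t < 1 * K) \sum_x
      (2 ^+ (t %/ 1)) `^ p * `|haar d0 t X x|) + (1 * 2 ^+ K) `^ p * `|\sum_x X x|.
    rewrite /S sum_J; congr (_ + _).
      rewrite mulr_sumr; apply: eq_bigr => t _; rewrite mulr_sumr.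
      by apply: eq_bigr => x _; rewrite -mulrA.
    by congr (_ * `|_|); apply: eq_bigr => y _; rewrite mul1r.
  by rewrite -/X; congr (_ * _); ring.
have S2 : S ^+ 2 <= (\sum_(j : J K) c j * u j) *
    \sum_(j : J K) c j / u j * (\sum_y a j y * X y) ^+ 2.
  have -> : S = \sum_(j : J K) c j * u j * (`|\sum_y a j y * X y| / u j).
    by apply: eq_bigr => j _; field; rewrite gt_eqF.
  apply: le_trans (sqr_wsum_le _ _) _ => [j|]; first by rewrite mulr_ge0 ?c0 ?ltW.
  apply: ler_wpM2l; first by apply: sumr_ge0 => j _; rewrite mulr_ge0 ?c0 ?ltW.
  apply: ler_sum => j _; rewrite expr_div_n real_normK ?num_real//.
  by rewrite le_eqVlt; apply/orP; left; apply/eqP; field; rewrite gt_eqF.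
apply: (@le_trans _ _ (2 * (mesh 1 K n `^ p) ^+ 2 * ((1 + n%:R) ^+ 2 + S ^+ 2))).
  rewrite -subr_ge0; have -> : 2 * (mesh 1 K n `^ p) ^+ 2 * ((1 + n%:R) ^+ 2 + S ^+ 2) -
    (mesh 1 K n `^ p * (1 + n%:R + S)) ^+ 2 = (mesh 1 K n `^ p * (1 + n%:R - S)) ^+ 2 by ring.
  exact: sqr_ge0.
by apply: ler_wpM2l; [rewrite mulr_ge0// sqr_ge0|rewrite lerD2l; exact: S2].
Qed.

Context (dO : measure_display) (O : measurableType dO)
  (P : probability O R) (mu : R.-ker O ~> 'rV[R]_1) (beta : set 'rV[R]_1 -> \bar R).
Hypothesis mu_pp : point_process mu.
Hypothesis mu_stationary : stationary P mu.
Hypothesis mu_intensity : unit_intensity P mu.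
Hypothesis mu_square : locally_square_integrable P mu.
Hypothesis rpcm : is_rpcm P mu beta.

(** Concavity applied to the quadratic cost would give, besides the factor [n], the power p/2 of
    [n], of larger order than each of these rates when [p < 1]. *)
Lemma integral_toric_Wp_line_le : exists c : R, forall n, (2 <= n)%N ->
  ((\int[P]_w (toric_Wp n p (tilde_mu n (mu w)) (tilde_L n)) ^+ 2) `^ 2^-1 <=
    (c * alpha 1 n (bn beta n) p)%:E)%E.
Proof.
have [B B0 BP] := count_quadratic_le d0 mu_pp mu_stationary mu_intensity mu_square rpcm.
have [c1 c10 c1P] := sum_powR_rate p.
have /andP[p0 p1] := p01.
(* The 4 comes from [(1 + n) ^+ 2 <= 4 * n ^+ 2], and 144 is the square of the 12 in [sum_cu]. *)
pose D : R := 2 * ((4 * pi) `^ p) ^+ 2 * (4 + 144 * B) * c1 ^+ 2.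
have D0 : 0 <= D.
  have B1 : 0 <= 4 + 144 * B by apply: addr_ge0 => //; apply: mulr_ge0 => //; exact: ltW.
  by rewrite mulr_ge0 ?sqr_ge0// mulr_ge0// mulr_ge0// sqr_ge0.
exists (Num.sqrt D) => n n2; have n0 : (0 < n)%N by rewrite (leq_trans _ n2).
set K := level 1 n; have [Kn _] := @level_bounds 1 n d0 n0.
have N0 : 0 < n%:R :> R by rewrite ltr0n.
set b := bn beta n; have b1 : 1 <= b by exact: (bn_ge1 d0 rpcm).
have b0 : 0 <= b by rewrite (le_trans _ b1).
set h : R := @mesh R 1 K n.
have h0 : 0 < h by exact: mesh_gt0.
have hH : h <= 4 * pi by exact: mesh_le.
set Th := \sum_(t < K.+1) r ^+ t.
have Th1 : 1 <= Th.
  by rewrite /Th big_ord_recl expr0 lerDl sumr_ge0// => t _; rewrite exprn_ge0// powR_ge0.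
have Thc : Th <= c1 * rate p n by exact: c1P.
have rate0 : 0 <= rate p n.
  by rewrite -(pmulr_rge0 _ c10) (le_trans _ Thc)// (le_trans _ Th1).
have -> : Num.sqrt D * alpha 1 n b p = Num.sqrt (D * (b * (n%:R * rate p n) ^+ 2)).
  rewrite [Num.sqrt (D * _)]sqrtrM// [Num.sqrt (b * _)]sqrtrM// sqrtr_sqr ger0_norm; last by rewrite mulr_ge0// ltW.
  rewrite /alpha /rate /=; congr (_ * _).
  by case: ifP => _; [ring|case: ifP => _; ring].
pose V := \sum_(j : J K) c j * u j.
have V0 : 0 <= V by apply: sumr_ge0 => j _; rewrite mulr_ge0 ?c0 ?ltW.
have VTh : V <= 12 * n%:R * Th.
  apply: le_trans (sum_cu K) _; apply: ler_wpM2r; first by rewrite (le_trans _ Th1).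
  by rewrite ler_wpM2l// -natrX ler_nat expn_level.
pose X (y : cells 1 K) w : R := count n mu y w - h ^+ 1.
have mX y : measurable_fun setT (X y).
  by apply: measurable_funB; [exact: measurable_count|exact: measurable_cst].
pose k : R := 2 * (h `^ p) ^+ 2 * (1 + n%:R) ^+ 2.
have hp0 : 0 <= 2 * (h `^ p) ^+ 2 by apply: mulr_ge0 => //; exact: sqr_ge0.
have k0 : 0 <= k by rewrite mulr_ge0// sqr_ge0.
pose e (j : J K) := 2 * (h `^ p) ^+ 2 * V * (c j / u j).
have e0 j : 0 <= e j by apply: mulr_ge0; [exact: mulr_ge0|exact: divr_ge0 (c0 j) (ltW (u0 j))].
have W0 w : (0 <= toric_Wp n p (tilde_mu n (mu w)) (tilde_L n) ^+ 2)%E.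
  exact: sqre_ge0.
have moo w : (mu w (Lambda n) < +oo)%E.
  by case: mu_pp => + _; apply; [exact: measurable_Lambda|exact: bounded_Lambda].
have FE w : (toric_Wp n p (tilde_mu n (mu w)) (tilde_L n) ^+ 2 <=
    (k + \sum_j e j * (\sum_y a j y * X y w) ^+ 2)%:E)%E.
  have le1 := toric_Wp_le d0 n0 Kn (moo w) p01.
  apply: (@le_trans _ _ ((pow_cost K n d0 (mu w) p) ^+ 2)%:E).
    by rewrite EFin_expe !expe2; apply: lee_pmul => //; exact: toric_Wp_ge0.
  rewrite lee_fin; apply: le_trans (pow_cost_sqr K n (mu w)) _.
  rewrite le_eqVlt; apply/orP; left; apply/eqP; rewrite mulrDr; congr (_ + _).
  by rewrite mulrA mulr_sumr; apply: eq_bigr => j _; rewrite /e !mulrA.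
have IE := integral_quadratic_le mX (BP n n2) k0 e0 W0 FE.
apply: poweR_half_le; first by apply: integral_ge0 => w _; exact: W0.
apply: (le_trans IE); rewrite lee_fin.
have eS : \sum_j e j * \sum_y a j y ^+ 2 <= 2 * (h `^ p) ^+ 2 * V ^+ 2.
  rewrite [V ^+ 2]expr2 mulrA [leRHS]mulr_sumr; apply: ler_sum => j _.
  apply: (le_trans (ler_wpM2l (e0 j) (a_norm j))); rewrite /e.
  by rewrite le_eqVlt; apply/orP; left; apply/eqP; field; rewrite gt_eqF.
have hp : 2 * (h `^ p) ^+ 2 <= 2 * ((4 * pi) `^ p) ^+ 2.
  have pi0 := @pi_gt0 R; have q0 : 0 <= 4 * pi :> R by rewrite mulr_ge0// ltW.
  rewrite ler_wpM2l// ler_sqr ?nnegrE ?powR_ge0// ge0_ler_powR ?nnegrE// ltW//.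
have nT : n%:R ^+ 2 <= (n%:R * Th) ^+ 2.
  by rewrite ler_sqr ?nnegrE ?mulr_ge0 ?(ltW N0)// ?(le_trans _ Th1)// ler_peMr// ltW.
have k1 : (1 + n%:R) ^+ 2 <= 4 * (n%:R * Th) ^+ 2.
  apply: (@le_trans _ _ (4 * n%:R ^+ 2)); last by rewrite ler_wpM2l.
  have n1 : 1 <= n%:R :> R by rewrite ler1n.
  by nra.
have V2 : V ^+ 2 <= 144 * (n%:R * Th) ^+ 2.
  have -> : 144 * (n%:R * Th) ^+ 2 = (12 * n%:R * Th) ^+ 2 by ring.
  by rewrite ler_sqr ?nnegrE// (le_trans V0).
set G := (n%:R * Th) ^+ 2 in nT k1 V2.
have G0 : 0 <= G by exact: sqr_ge0.
have bk : (1 + n%:R) ^+ 2 + B * b * V ^+ 2 <= (4 + 144 * B) * (b * G).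
  have -> : (4 + 144 * B) * (b * G) = 4 * G * b + B * b * (144 * G) by ring.
  apply: lerD; last by rewrite ler_wpM2l// mulr_ge0// ltW.
  by apply: (le_trans k1); rewrite ler_peMr// mulr_ge0.
apply: (@le_trans _ _ (2 * (h `^ p) ^+ 2 * ((1 + n%:R) ^+ 2 + B * b * V ^+ 2))).
  rewrite [leRHS]mulrDr lerD2l [leRHS]mulrCA ler_wpM2l// mulr_ge0// ltW//.
have bG0 : 0 <= (1 + n%:R) ^+ 2 + B * b * V ^+ 2.
  by rewrite addr_ge0 ?sqr_ge0// mulr_ge0 ?sqr_ge0// mulr_ge0// ltW.
apply: (le_trans (ler_pM hp0 bG0 hp bk)).
have -> : D * (b * (n%:R * rate p n) ^+ 2) = 2 * ((4 * pi) `^ p) ^+ 2 *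
    ((4 + 144 * B) * (b * (n%:R * (c1 * rate p n)) ^+ 2)) by rewrite /D; ring.
apply: ler_wpM2l; first by rewrite mulr_ge0// sqr_ge0.
apply: ler_wpM2l; first by apply: addr_ge0 => //; apply: mulr_ge0 => //; exact: ltW.
rewrite ler_wpM2l// /G ler_sqr ?nnegrE.
- by rewrite ler_wpM2l// ltW.
- by rewrite mulr_ge0 ?(ltW N0)// (le_trans _ Th1).
- by rewrite !mulr_ge0 ?(ltW N0) ?(ltW c10).
Qed.

End line.

Theorem theorem3 (R : realType) (d : nat)
  (dO : measure_display) (Omega : measurableType dO) (P : probability Omega R)
  (mu : R.-ker Omega ~> 'rV[R]_d) (beta : set 'rV[R]_d -> \bar R)
  (d_ge1 : (1 <= d)%N)
  (mu_pp : point_process mu)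
  (mu_stationary : stationary P mu)
  (mu_intensity : unit_intensity P mu)
  (mu_square : locally_square_integrable P mu)
  (beta_rpcm : is_rpcm P mu beta) :
  (exists c : R, forall n : nat, (2 <= n)%N ->
     (\int[P]_w toric_Wp n 2 (tilde_mu n (mu w)) (tilde_L n)
        <= (c * alpha2 d n (bn beta n))%:E)%E) /\
  (forall p : R, 0 < p <= 1 ->
   exists c : R, forall n : nat, (2 <= n)%N ->
     ((\int[P]_w (toric_Wp n p (tilde_mu n (mu w)) (tilde_L n)) ^+ 2) `^ 2^-1
        <= (c * alpha d n (bn beta n) p)%:E)%E).
Proof.
split; first exact: (integral_toric_W2_le d_ge1 mu_pp mu_stationary mu_intensity mu_square beta_rpcm).
move=> p p01; have [d1|d1] := eqVneq d 1%N.
  subst d; exact: (integral_toric_Wp_line_le p01 mu_pp mu_stationary mu_intensity mu_square beta_rpcm).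
exact: (integral_toric_Wp_sqr_le d_ge1 mu_pp mu_stationary mu_intensity mu_square beta_rpcm d1 p01).
Qed.
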